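(* Let $I(z)=\int_a^b \exp\left(-zp(t)+z^{\nu/\mu}r(t)\right)q(t)\,dt$, where the integral is taken along a contour $\mathscr{P}$ in the complex plane joining $a$ to $b$, and suppose that $p,q,r,\mathscr{P},\mu,\nu,\lambda,\theta_1,\theta_2,Z$ satisfy Conditions (i)--(vi) listed in the context. Then $$I(z)\sim e^{-zp(a)}\sum_{n=0}^\infty \frac{1}{z^{(n+\lambda)/\mu}}\sum_{m=0}^n f_{n,m}\,\operatorname{Fi}\left(\frac{\nu}{\mu},\frac{n+\lambda+m\nu}{\mu};\frac{r_0}{p_0^{\nu/\mu}}\right)$$ as $|z|\to+\infty$ uniformly in the sector $\theta_1\le\arg z\le\theta_2$, where the branch of $z^{(n+\lambda)/\mu}$ is $\exp\left((n+\lambda)(\log|z|+i\theta)/\mu\right)$ with $\theta=\arg z$. The coefficients $f_{n,m}$ are expressible in terms of the $p_n$'s, $q_n$'s and $r_n$'s and are given by $$f_{n,m}=\frac{1}{m!}\sum_{j=m}^n b_{n-j}\,\mathsf{B}_{j,m}(c_1,\ldots,c_{j-m+1}),$$ $$b_n=\frac1\mu\operatorname*{Res}_{t=a}\left[\frac{q(t)}{(p(t)-p(a))^{(n+\lambda)/\mu}}\right]\ (n\ge 0),\qquad c_n=\frac1\mu\operatorname*{Res}_{t=a}\left[\frac{p'(t)r(t)}{(p(t)-p(a))^{(n+\nu)/\mu+1}}\right]\ (n\ge1).$$ For example, $$f_{0,0}=\frac{q_0}{\mu p_0^{\lambda/\mu}},\quad f_{1,0}=\left(\frac{q_1}{\mu}-\frac{(\lambda+1)p_1q_0}{\mu^2p_0}\right)\frac{1}{p_0^{(1+\lambda)/\mu}},\quad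 f_{1,1}=\left(\frac{r_1}{\mu}-\frac{\nu p_1r_0}{\mu^2p_0}\right)\frac{q_0}{p_0^{(1+\lambda+\nu)/\mu}}.$$
   Context: Notation. For points $t_1,t_2$ of the contour $\mathscr{P}$, $(t_1,t_2)_{\mathscr P}$ denotes the part of $\mathscr P$ strictly between $t_1$ and $t_2$. $\varpi=\lim \arg(t-a)$ as $t\to a$ along $\mathscr P$ is the angle of slope of $\mathscr P$ at $a$. $\theta=\arg z$; neither $\varpi$ nor $\theta$ need be principal values, provided consistency is maintained. $z^{\nu/\mu}=\exp\left((\nu/\mu)(\log|z|+i\theta)\right)$. Conditions. (i) The functions $p(t)$, $q(t)$, $r(t)$ are independent of $z$, and single-valued and analytic in a domain $\mathbf T\subset\mathbb C$. (ii) $\mathscr P$ is independent of $z$, $a$ is finite, $b$ is finite or infinite, and $(a,b)_{\mathscr P}$ lies within $\mathbf T$ (so $a$ and/or $b$ may be boundary points of $\mathbf T$). (iii) In the neighbourhood of $a$, $p,q,r$ can be expanded in convergent series $$p(t)=p(a)+\sum_{n=0}^\infty p_n(t-a)^{n+\mu},\quad q(t)=\sum_{n=0}^\infty q_n(t-a)^{n+\lambda-1},\quad r(t)=\sum_{n=0}^\infty r_n(t-a)^{n+\nu},$$ where $p_0\neq0$, $\mu>\nu\ge0$ are (real) constants, and $\Re(\lambda)>0$. When $\mu$, $\lambda$ or $\nu$ is not an integer (possible only when $a$ is on the boundary of $\mathbf T$), the branches of $(t-a)^\mu,(t-a)^\lambda,(t-a)^\nu$ are specified by $(t-a)^\mu\sim|t-a|^\mu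 e^{i\mu\varpi}$, $(t-a)^\lambda\sim|t-a|^\lambda e^{i\lambda\varpi}$, $(t-a)^\nu\sim|t-a|^\nu e^{i\nu\varpi}$ as $t\to a$ along $\mathscr P$, and by continuity elsewhere on $\mathscr P$. (iv) $z$ ranges along a ray or over an annular sector given by $\theta_1\le\theta\le\theta_2$ and $|z|\ge Z$, where $\theta=\arg z$, $\theta_2-\theta_1<\pi$, and $Z>0$. Furthermore, $I(Ze^{i\theta})$ converges at $b$ both absolutely and uniformly with respect to $\theta$. (v) $\left|\arg\left(e^{i\theta}p(t)-e^{i\theta}p(a)\right)\right|\le\frac\pi2-\delta$ with a fixed (small) positive $\delta$ when $t\in(a,b)_{\mathscr P}$, and $\Re\left(e^{i\theta}p(t)-e^{i\theta}p(a)\right)$ is bounded away from zero uniformly with respect to $\theta$ as $t\to b$ along $\mathscr P$. (vi) $r(t)=\mathcal O(|p(t)-p(a)|)$ as $t\to b$ along $\mathscr P$. Branch of powers of $p_0$. All powers $p_0^s$ mean $\exp\left(s(\log|p_0|+i\varpi_0)\right)$, where $\varpi_0$ is the value of $\arg p_0$ (not necessarily principal) chosen so that $|\varpi_0+\theta+\mu\varpi|\le\frac\pi2$; under the conditions this $\varpi_0$ is unique and independent of $\theta\in[\theta_1,\theta_2]$. In the residues, $(p(t)-p(a))^{s}$ means $p_0^{s}(t-a)^{\mu s}\left(1+\sum_{n\ge1}(p_n/p_0)(t-a)^n\right)^{s}$ with the last factor equal to $1$ at $t=a$; the functions whose residues are taken are then single-valued Laurent series about $a$. Faxén integral: $\operatorname{Fi}(\alpha,\beta;x)=\int_0^{+\infty}\exp(-t+xt^\alpha)t^{\beta-1}\,dt$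 for $0\le\alpha<1$, $\Re(\beta)>0$, $x\in\mathbb C$. Partial ordinary Bell polynomials: $\mathsf B_{n,m}(x_1,\ldots,x_{n-m+1})$ is the coefficient of $y^n$ in $\left(\sum_{j\ge1}x_jy^j\right)^m$ (so $\mathsf B_{0,0}=1$ and $\mathsf B_{n,0}=0$ for $n\ge1$). Meaning of the expansion: for each integer $N\ge0$, $e^{zp(a)}I(z)$ minus the sum of the terms with $n\le N-1$ is $\mathcal O\left(|z|^{-(N+\Re\lambda)/\mu}\right)$ as $|z|\to+\infty$, uniformly with respect to $\theta\in[\theta_1,\theta_2]$. *)

(* Defs.v *)
From Stdlib Require Import Reals Arith.
From Coquelicot Require Import Coquelicot.

Open Scope R_scope.

(** * Complex exponentials, arguments and powers *)

Definition Cexp (w : C) : C := (exp (Re w) * cos (Im w), exp (Re w) * sin (Im w)).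

Definition polar (rho theta : R) : C := (rho * cos theta, rho * sin theta).

(* [alpha] is a (not necessarily principal) value of [arg w]. *)
Definition is_arg (w : C) (alpha : R) : Prop :=
  w <> RtoC 0 /\ w = polar (Cmod w) alpha.

(* The power [w ^ s] of the nonzero number [w = polar rho theta], in the branch
   determined by the argument [theta]: [(ln rho, theta)] is that value of [log w]. *)
Definition polar_pow (rho theta : R) (s : C) : C :=
  Cexp (s * ((ln rho, theta) : C))%C.

(* Principal power, used only for [w] close to 1 (it is the principal one for [0 < Re w]). *)
Definition principal_pow (w s : C) : C :=
  polar_pow (Cmod w) (atan (Im w / Re w)) s.

(* Derivative of a complex function of a real variable. *)
Definition derivRC (f : R -> C) (s : R) : C :=
  (Derive (fun u => Re (f u)) s, Derive (fun u => Im (f u)) s).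

Definition CSeries (u : nat -> C) : C :=
  (Series (fun n => Re (u n)), Series (fun n => Im (u n))).

(** * Domains and contours *)

Definition analytic_in (T : C -> Prop) (f : C -> C) : Prop :=
  forall t : C, T t -> ex_derive (K := C_AbsRing) (V := C_NormedModule) f t.

Definition connected_set (T : C -> Prop) : Prop :=
  forall U V : C -> Prop,
    open U -> open V ->
    (forall t, T t -> U t \/ V t) ->
    (exists t, T t /\ U t) -> (exists t, T t /\ V t) ->
    exists t, T t /\ U t /\ V t.

Definition complex_domain (T : C -> Prop) : Prop :=
  (exists t, T t) /\ open T /\ connected_set T.

Inductive endpoint : Type :=
  | finite_end (b : C)
  | infinite_end.

(* [gamma], restricted to [[x, y]], is a smooth (regular) arc: it is continuously
   differentiable with non-vanishing derivative, one-sided at the two ends. *)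
Definition smooth_arc (gamma : R -> C) (x y : R) : Prop :=
  (forall s, x <= s <= y ->
     filterlim gamma (within (fun u => x <= u <= y) (locally s)) (locally (gamma s))) /\
  exists dgamma : R -> C,
    (forall s, x <= s <= y -> continuous dgamma s /\ dgamma s <> RtoC 0) /\
    (forall s, x < s < y ->
       is_derive (K := R_AbsRing) (V := C_R_NormedModule) gamma s (dgamma s)).

Inductive smooth_chain (gamma : R -> C) : R -> R -> Prop :=
  | chain_arc (x y : R) :
      x < y -> smooth_arc gamma x y -> smooth_chain gamma x y
  | chain_cat (x y z : R) :
      smooth_chain gamma x y -> smooth_chain gamma y z -> smooth_chain gamma x z.

(* A contour from [a] to [b] is parametrised by [[0, 1)], so that [b] may be infinite;
   the open part (a, b) is the image of the open interval (0, 1).  Each compact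
   initial part is a finite chain of smooth arcs. *)
Definition contour (gamma : R -> C) (a : C) (b : endpoint) : Prop :=
  gamma 0 = a /\
  (forall x, 0 < x < 1 -> smooth_chain gamma 0 x) /\
  match b with
  | finite_end b0 => filterlim gamma (at_left 1) (locally b0)
  | infinite_end => filterlim (fun s => Cmod (gamma s)) (at_left 1) (Rbar_locally p_infty)
  end.

(** * The integral *)

(* The integrand at [z = polar rho theta], pulled back to the parameter [s];
   [kappa] stands for nu / mu. *)
Definition integrand (p q r : C -> C) (gamma : R -> C) (kappa rho theta s : R) : C :=
  (Cexp (- (polar rho theta * p (gamma s)) + polar_pow rho theta kappa * r (gamma s))
   * q (gamma s) * derivRC gamma s)%C.

(* Improper at both ends. *)
Definition ex_contour_integral (p q r : C -> C) (gamma : R -> C) (kappa rho theta : R) : Prop :=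
  ex_RInt_gen (V := C_R_NormedModule)
    (integrand p q r gamma kappa rho theta) (at_right 0) (at_left 1).

Definition contour_integral (p q r : C -> C) (gamma : R -> C) (kappa rho theta : R) : C :=
  RInt_gen (V := C_R_CompleteNormedModule)
    (integrand p q r gamma kappa rho theta) (at_right 0) (at_left 1).

(** * Hypotheses on the integrand *)

(* [sum_n u_n (t - a) ^ (n + e)] is a convergent expansion of [f] at the
   points [t = gamma s] of the contour near [a], where the branches are specified; [phi s] is the value of [arg (t - a)] that fixes
   the branch of the powers. *)
Definition expands_along (gamma : R -> C) (a : C) (phi : R -> R)
    (f : C -> C) (u : nat -> C) (e : C) : Prop :=
  at_right 0 (fun s =>
    is_series (K := C_AbsRing) (V := C_NormedModule)
      (fun n => u n * polar_pow (Cmod (gamma s - a)) (phi s) (INR n + e))%C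
      (f (gamma s))).

(* The branches are those for which [arg (t - a)] tends to the angle of slope [varpi]
   as [t] tends to [a] along the contour. *)
Definition endpoint_expansions (p q r : C -> C) (gamma : R -> C) (a : C) (varpi : R)
    (mu nu : R) (lambda : C) (p_ q_ r_ : nat -> C) : Prop :=
  exists phi : R -> R,
    at_right 0 (fun s => is_arg (gamma s - a)%C (phi s)) /\
    filterlim phi (at_right 0) (locally varpi) /\
    expands_along gamma a phi (fun t => p t - p a)%C p_ mu /\
    expands_along gamma a phi q q_ (lambda - 1)%C /\
    expands_along gamma a phi r r_ nu.

(* Convergence at the end [b] (the parameter value 1), absolute for each
   [theta] and uniform with respect to [theta]. *)
Definition converges_abs_unif_at_end (F : R -> R -> C) (theta1 theta2 : R) : Prop :=
  exists x0 : R, 0 < x0 < 1 /\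
    (forall theta, theta1 <= theta <= theta2 ->
       ex_RInt_gen (fun s => Cmod (F theta s)) (at_point x0) (at_left 1)) /\
    (exists J : R -> C, forall eps, 0 < eps ->
       at_left 1 (fun x => forall theta, theta1 <= theta <= theta2 ->
         Cmod (RInt (V := C_R_CompleteNormedModule) (F theta) x0 x - J theta)%C < eps)).

Definition sector_condition (p : C -> C) (gamma : R -> C) (a : C)
    (theta1 theta2 delta : R) : Prop :=
  (forall theta s, theta1 <= theta <= theta2 -> 0 < s < 1 ->
     exists alpha,
       is_arg (polar 1 theta * p (gamma s) - polar 1 theta * p a)%C alpha /\
       Rabs alpha <= PI / 2 - delta) /\
  (exists c, 0 < c /\
     at_left 1 (fun s => forall theta, theta1 <= theta <= theta2 ->
       c <= Rabs (Re (polar 1 theta * p (gamma s) - polar 1 theta * p a)%C))).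

Definition big_O_at_end (p r : C -> C) (gamma : R -> C) (a : C) : Prop :=
  exists K, at_left 1 (fun s => Cmod (r (gamma s)) <= K * Cmod (p (gamma s) - p a)%C).

(** * Ingredients of the expansion *)

Definition Faxen (alpha : R) (beta x : C) : C :=
  RInt_gen (V := C_R_CompleteNormedModule)
    (fun t : R => Cexp (- t + x * Rpower t alpha) * polar_pow t 0 (beta - 1))%C
    (at_right 0) (Rbar_locally p_infty).

(* Coefficients of products and powers of formal power series in y. *)
Definition fps_mul (u v : nat -> C) (n : nat) : C :=
  sum_n (fun k => u k * v (n - k)%nat)%C n.

Fixpoint fps_pow (u : nat -> C) (m : nat) : nat -> C :=
  match m with
  | O => fun n => match n with O => RtoC 1 | S _ => RtoC 0 end
  | S m' => fps_mul u (fps_pow u m')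
  end.

(* Partial ordinary Bell polynomial B_{n,m}(x_1, x_2, ...); [x 0] is ignored. *)
Definition Bell (n m : nat) (x : nat -> C) : C :=
  fps_pow (fun j => match j with O => RtoC 0 | S _ => x j end) m n.

(* Functions of [t] near [a], possibly multivalued, are given on the Riemann surface of
   [log (t - a)] as functions [G] of the polar coordinates of [t - a].  Here
   [G] has a single-valued Laurent expansion
   [sum_n l_n (t - a) ^ (n - k)], and [c] is its coefficient of [(t - a) ^ (-1)]. *)
Definition is_residue (G : R -> R -> C) (c : C) : Prop :=
  exists (k : nat) (l : nat -> C) (eps : R),
    0 < eps /\
    (forall x phi, 0 < x < eps ->
       is_series (K := C_AbsRing) (V := C_NormedModule)
         (fun n => l n * polar x phi ^ n)%C (G x phi * polar x phi ^ k)%C) /\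
    c = match k with O => RtoC 0 | S k' => l k' end.

Definition residue (G : R -> R -> C) : C :=
  iota (T := C_R_CompleteNormedModule) (is_residue G).

(* [sum_n u_n (t - a) ^ (n + e)] with [t - a] in polar coordinates [x], [phi]. *)
Definition germ (u : nat -> C) (e : C) (x phi : R) : C :=
  CSeries (fun n => u n * polar_pow x phi (INR n + e))%C.

(* d/dt of an analytic germ, computed along the ray [arg (t - a) = phi],
   on which [dt = exp (i phi) dx]. *)
Definition germ_deriv (G : R -> R -> C) (x phi : R) : C :=
  (derivRC (fun y => G y phi) x / polar 1 phi)%C.

(* [(p t - p a) ^ s = p_0 ^ s (t - a) ^ (mu s) (1 + sum_{n >= 1} (p_n / p_0) (t - a) ^ n) ^ s],
   where [varpi0] is the chosen value of [arg p_0]. *)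
Definition p_pow (p_ : nat -> C) (mu varpi0 : R) (s : C) (x phi : R) : C :=
  (polar_pow (Cmod (p_ 0%nat)) varpi0 s * polar_pow x phi (mu * s)
   * principal_pow
       (1 + CSeries (fun n => p_ (S n) / p_ 0%nat * polar x phi ^ (S n))) s)%C.

Definition b_coef (p_ q_ : nat -> C) (mu : R) (lambda : C) (varpi0 : R) (n : nat) : C :=
  (/ mu * residue (fun x phi =>
     germ q_ (lambda - 1) x phi / p_pow p_ mu varpi0 ((INR n + lambda) / mu) x phi))%C.

Definition c_coef (p_ r_ : nat -> C) (mu nu varpi0 : R) (n : nat) : C :=
  (/ mu * residue (fun x phi =>
     germ_deriv (germ p_ mu) x phi * germ r_ nu x phi
     / p_pow p_ mu varpi0 ((INR n + nu) / mu + 1) x phi))%C.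

Definition f_coef (p_ q_ r_ : nat -> C) (mu nu : R) (lambda : C) (varpi0 : R)
    (n m : nat) : C :=
  (/ INR (fact m) *
   sum_n_m (fun j => b_coef p_ q_ mu lambda varpi0 (n - j)
                     * Bell j m (c_coef p_ r_ mu nu varpi0)) m n)%C.

(* [u 0 + ... + u (N - 1)]. *)
Definition partial_sum (u : nat -> C) (N : nat) : C :=
  match N with O => RtoC 0 | S N' => sum_n u N' end.

(* The value of [arg p_0] used for all powers of [p_0]. *)
Definition arg_p0 (p0 : C) (mu varpi theta1 theta2 varpi0 : R) : Prop :=
  is_arg p0 varpi0 /\
  forall theta, theta1 <= theta <= theta2 -> Rabs (varpi0 + theta + mu * varpi) <= PI / 2.

(* Main.v *)
(* The local parameter is w = (p(t) - p(a))^(1/mu). In terms of it, q dt equals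
   w^(lambda-1) (B_0 + B_1 w + ...) dw and r equals w^nu (c_0 + c_1 w + ...), and the B_n and c_n
   are the stated residues by Lagrange inversion: t^(-k-1) (t w'/w) w^(-k) dt is exact for k <> 0,
   so it has no residue. Expanding exp(z^(nu/mu) w^nu (c_1 w + c_2 w^2 + ...)) produces the Bell
   polynomials, and each resulting term is a Faxen integral taken along the image of an initial
   piece of the contour. That image is moved to the positive half-line in the variable
   log(z w^mu), in which the Faxen integrand is entire and so has a primitive; the error is
   exponentially small because Re(z w^mu) is comparable to |z w^mu|. The rest of the contour is
   compared with the absolutely convergent integral at |z| = Z and is exponentially small. *)

Require Import Defs.
From Stdlib Require Import Reals Arith Lra Lia Psatz.
From Coquelicot Require Import Coquelicot.

Open Scope R_scope.

(** Near [a] no integral is estimated directly: the increments of a primitive are dominated by those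
    of an explicit real function [G] that has a limit. The hypotheses give convergence at [b] only;
    convergence at [a] comes out of the same estimate as the error term. Put B = (N + Re lambda) /
    mu and Y = ln rho + mu ln s. After N terms the error is rho^(-B) times a multiple of exp (B Y -
    eta exp Y) ds / s. Replacing this exponential by the bump exp (B Y) / (1 + exp (B Y))^2 makes
    [G] explicit, with total variation independent of rho, so the prefactor alone carries the order
    of the error. All branches come from one logarithm of p(t) - p(a) along the whole contour,
    [log_phase]. Because theta2 - theta1 < PI it serves every theta at once; noninteger powers are
    exponentials of its multiples, and near [a] it ties [varpi0] to the argument of t - a. The
    expansions at [a] are assumed at points of the contour only; convergence at one of them already
    gives a disc. *)

Lemma exp_monotone (x y : R) : x <= y -> exp x <= exp y.
Proof. intros [h| ->]; [left; now apply exp_increasing | right; reflexivity]. Qed.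

(** * The complex exponential, polar form and the principal logarithm *)

Lemma Cexp_plus (z w : C) : Cexp (z + w) = (Cexp z * Cexp w)%C.
Proof.
  destruct z as [x y], w as [x' y']. unfold Cexp, Cplus, Cmult, Re, Im; simpl.
  rewrite exp_plus, cos_plus, sin_plus. f_equal; ring.
Qed.

Lemma Cexp_0 : Cexp 0 = RtoC 1.
Proof.
  unfold Cexp, RtoC, Re, Im; simpl. rewrite exp_0, cos_0, sin_0. f_equal; ring.
Qed.

Lemma Cmod_Cexp (z : C) : Cmod (Cexp z) = exp (Re z).
Proof.
  unfold Cmod, Cexp; simpl.
  replace (_ + _) with ((exp (Re z)) ^ 2 * (Rsqr (sin (Im z)) + Rsqr (cos (Im z))))
    by (unfold Rsqr; ring).
  rewrite sin2_cos2, Rmult_1_r. apply sqrt_pow2. left; apply exp_pos.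
Qed.

Lemma Cexp_neq_0 (z : C) : Cexp z <> 0.
Proof.
  intros h. apply (f_equal Cmod) in h. rewrite Cmod_Cexp, Cmod_0 in h.
  generalize (exp_pos (Re z)). lra.
Qed.

Lemma Cexp_opp (z : C) : Cexp (- z) = (/ Cexp z)%C.
Proof.
  assert (h : (Cexp (- z) * Cexp z)%C = 1).
  { rewrite <- Cexp_plus. replace (- z + z)%C with (RtoC 0) by ring. apply Cexp_0. }
  rewrite <- (Cmult_1_l (/ Cexp z)), <- h. field. apply Cexp_neq_0.
Qed.

Lemma Cexp_minus (z w : C) : Cexp (z - w) = (Cexp z / Cexp w)%C.
Proof. unfold Cminus, Cdiv. now rewrite Cexp_plus, Cexp_opp. Qed.

Lemma Cexp_nat (n : nat) (z : C) : Cexp (INR n * z) = (Cexp z ^ n)%C.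
Proof.
  induction n as [|n IH].
  - simpl. replace (0 * z)%C with (RtoC 0) by ring. apply Cexp_0.
  - rewrite S_INR, Cpow_S, <- IH, RtoC_plus, <- Cexp_plus. f_equal. ring.
Qed.

Lemma Cexp_RtoC (x : R) : Cexp x = RtoC (exp x).
Proof.
  unfold Cexp, RtoC, Re, Im; simpl. rewrite cos_0, sin_0. f_equal; ring.
Qed.

(** [cos (x - y) = 1] makes the sine of half the difference vanish, and the sine has no zero
    strictly between 0 and [PI]. *)
Lemma cos_sin_eq (x y : R) :
  cos x = cos y -> sin x = sin y -> Rabs (x - y) < 2 * PI -> x = y.
Proof.
  intros hc hs h.
  assert (h1 : cos (x - y) = 1).
  { rewrite cos_minus, hc, hs. generalize (sin2_cos2 y). unfold Rsqr. lra. }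
  assert (h2 : sin ((x - y) / 2) = 0).
  { replace (x - y) with (2 * ((x - y) / 2)) in h1 by field.
    rewrite cos_2a_sin in h1. nra. }
  destruct (Rtotal_order x y) as [l|[e|l]]; [|exact e|].
  - exfalso. apply Rabs_def2 in h.
    assert (0 < sin ((y - x) / 2)) by (apply sin_gt_0; lra).
    replace ((x - y) / 2) with (- ((y - x) / 2)) in h2 by field.
    rewrite sin_neg in h2. lra.
  - exfalso. apply Rabs_def2 in h.
    assert (0 < sin ((x - y) / 2)) by (apply sin_gt_0; lra). lra.
Qed.

(** The moduli determine the real parts. Every comparison of two branches of a logarithm below is
    reduced to this: equal exponentials, and imaginary parts less than a full turn apart. *)
Lemma Cexp_inj (z w : C) :
  Cexp z = Cexp w -> Rabs (Im z - Im w) < 2 * PI -> z = w.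
Proof.
  intros h hi.
  assert (hr : Re z = Re w).
  { apply exp_inv. now rewrite <- !Cmod_Cexp, h. }
  assert (hI : Im z = Im w).
  { injection h as h1 h2. rewrite hr in h1, h2.
    assert (he := exp_pos (Re w)).
    apply cos_sin_eq; trivial; apply (Rmult_eq_reg_l (exp (Re w))); lra. }
  destruct z, w; simpl in *; congruence.
Qed.

Lemma polar_Cexp (x phi : R) : 0 < x -> polar x phi = Cexp (ln x, phi).
Proof. intros h. unfold polar, Cexp; simpl. now rewrite exp_ln. Qed.

Lemma Cmod_polar (x phi : R) : 0 <= x -> Cmod (polar x phi) = x.
Proof.
  intros [h|<-].
  - rewrite polar_Cexp, Cmod_Cexp by trivial. now apply exp_ln.
  - unfold polar. rewrite !Rmult_0_l. apply Cmod_0.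
Qed.

Lemma polar_neq_0 (x phi : R) : 0 < x -> polar x phi <> 0.
Proof. intros h. rewrite polar_Cexp by trivial. apply Cexp_neq_0. Qed.

Lemma polar_scale (y x phi : R) : polar (y * x) phi = (y * polar x phi)%C.
Proof. unfold polar, Cmult, RtoC; simpl. f_equal; ring. Qed.

Lemma polar_pow_plus (x phi : R) (u v : C) :
  polar_pow x phi (u + v) = (polar_pow x phi u * polar_pow x phi v)%C.
Proof. unfold polar_pow. rewrite <- Cexp_plus. f_equal. ring. Qed.

Lemma polar_pow_nat (x phi : R) (n : nat) :
  0 < x -> polar_pow x phi (INR n) = (polar x phi ^ n)%C.
Proof. intros h. unfold polar_pow. now rewrite Cexp_nat, <- polar_Cexp. Qed.

Lemma polar_pow_neq_0 (x phi : R) (u : C) : polar_pow x phi u <> 0.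
Proof. apply Cexp_neq_0. Qed.

Lemma Cmod_polar_pow (x phi : R) (u : C) :
  Cmod (polar_pow x phi u) = exp (Re u * ln x - Im u * phi).
Proof. unfold polar_pow. rewrite Cmod_Cexp. f_equal. Qed.

(** The logarithm hidden in [principal_pow]: identities between powers become linear identities
    between exponents. It is a logarithm of [w] only for [0 < Re w], where [atan] gives the
    argument. *)
Definition plog (w : C) : C := (ln (Cmod w), atan (Im w / Re w)).

Lemma principal_pow_plog (w s : C) : principal_pow w s = Cexp (s * plog w).
Proof. reflexivity. Qed.

Lemma Re_gt_0_neq_0 (w : C) : 0 < Re w -> w <> 0.
Proof. intros h e. rewrite e in h. simpl in h. lra. Qed.

Lemma Cmod_sqr (w : C) : Cmod w * Cmod w = Re w * Re w + Im w * Im w.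
Proof. generalize (Cmod2_alt w). simpl. lra. Qed.

Lemma Cexp_plog (w : C) : 0 < Re w -> Cexp (plog w) = w.
Proof.
  intros h. assert (hm : 0 < Cmod w) by now apply Cmod_gt_0, Re_gt_0_neq_0.
  unfold Cexp, plog; simpl. rewrite exp_ln by trivial.
  rewrite cos_atan, sin_atan.
  assert (hs : sqrt (1 + (Im w / Re w)²) = Cmod w / Re w).
  { apply sqrt_lem_1.
    - generalize (Rle_0_sqr (Im w / Re w)); lra.
    - apply Rlt_le, Rdiv_lt_0_compat; trivial.
    - replace (Cmod w / Re w * (Cmod w / Re w))
        with ((Cmod w * Cmod w) / (Re w * Re w)) by (field; lra).
      rewrite Cmod_sqr. unfold Rsqr. field. lra. }
  rewrite hs. destruct w as [x y]; simpl in *. f_equal; field; lra.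
Qed.

Lemma Im_plog (w : C) : - (PI / 2) < Im (plog w) < PI / 2.
Proof. unfold plog; simpl. destruct (atan_bound (Im w / Re w)). lra. Qed.

Lemma Cmod_le_Re_Im (z : C) : Cmod z <= Rabs (Re z) + Rabs (Im z).
Proof.
  rewrite <- (sqrt_Rsqr (Rabs (Re z) + Rabs (Im z)))
    by (generalize (Rabs_pos (Re z)) (Rabs_pos (Im z)); lra).
  apply sqrt_le_1_alt. unfold Re, Im, Rsqr.
  rewrite <- (pow2_abs (fst z)), <- (pow2_abs (snd z)).
  generalize (Rabs_pos (fst z)) (Rabs_pos (snd z)). nra.
Qed.

Lemma im_le_Cmod (z : C) : Rabs (Im z) <= Cmod z.
Proof. eapply Rle_trans; [apply Rmax_r | apply Rmax_Cmod]. Qed.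

Lemma Cmod_minus_sym (z w : C) : Cmod (z - w) = Cmod (w - z).
Proof. rewrite <- Cmod_opp. f_equal. ring. Qed.

Lemma Cmod_triangle_minus (z w : C) : Cmod (z - w) <= Cmod z + Cmod w.
Proof. rewrite <- (Cmod_opp w). apply Cmod_triangle. Qed.

Lemma Cmod_triangle_inv (z w : C) : Cmod z - Cmod w <= Cmod (z - w).
Proof.
  generalize (Cmod_triangle (z - w) w). replace (z - w + w)%C with z by ring. lra.
Qed.

(* [ring] does not see through the carriers of Coquelicot's structures. *)
Ltac Rring := match goal with |- @eq _ ?x ?y => change (@eq R x y); ring end.
Ltac Cring := match goal with |- @eq _ ?x ?y => change (@eq C x y); ring end.
Ltac Cfield := match goal with |- @eq _ ?x ?y => change (@eq C x y); field end.

(** * Derivatives of curves *)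

Notation is_deriv_curve :=
  (@is_derive R_AbsRing C_R_NormedModule).

Lemma Cmod_norm_R (z : C) : @norm R_AbsRing C_R_NormedModule z = Cmod z.
Proof. symmetry. apply Cmod_norm. Qed.

(** The norm of the real module [C] is a product norm and its operations are componentwise. Both are
    unfolded once here, so that later estimates are about [Cmod] and field operations only. *)
Lemma is_deriv_curve_eps (f : R -> C) (s : R) (l : C) :
  is_deriv_curve f s l <->
  forall eps, 0 < eps -> exists d, 0 < d /\ forall h, Rabs h < d ->
    Cmod (f (s + h) - f s - h * l) <= eps * Rabs h.
Proof.
  split.
  - intros [_ H] eps heps.
    destruct (H s (fun P h => h) (mkposreal eps heps)) as [d hd].
    exists d. split; [apply cond_pos|]. intros h hh.
    assert (hb : ball s d (s + h)).
    { unfold ball; simpl; unfold AbsRing_ball, abs, minus, plus, opp; simpl.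
      now replace (s + h + - s) with h by ring. }
    specialize (hd _ hb). rewrite Cmod_norm_R in hd. simpl in hd.
    match type of hd with _ <= eps * ?n => replace n with (Rabs h) in hd end.
    2:{ unfold norm, minus, plus, opp; simpl. unfold abs; simpl. f_equal. ring. }
    eapply Rle_trans; [|exact hd]. right. f_equal.
    unfold minus, plus, opp, scal; simpl. unfold prod_plus, prod_opp, prod_scal; simpl.
    unfold plus, opp, scal; simpl. unfold mult; simpl.
    apply injective_projections; simpl; Rring.
  - intros H. split; [apply (is_linear_scal_l (V := C_R_NormedModule))|].
    intros x hx eps.
    apply (is_filter_lim_locally_unique (V := R_NormedModule)) in hx. subst x.
    destruct (H eps (cond_pos eps)) as [d [hd0 hd]].
    exists (mkposreal d hd0). intros y hy.
    unfold ball in hy; simpl in hy; unfold AbsRing_ball, abs, minus, plus, opp in hy;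
      simpl in hy.
    specialize (hd (y - s) hy). rewrite Cmod_norm_R.
    assert (E : forall t : R, s + (t - s) = t) by (intros; ring). rewrite E in hd.
    eapply Rle_trans; [|exact hd]. right. f_equal.
    unfold minus, plus, opp, scal; simpl. unfold prod_plus, prod_opp, prod_scal; simpl.
    unfold plus, opp, scal; simpl. unfold mult; simpl.
    apply injective_projections; simpl; Rring.
Qed.

Lemma is_derive_eps (f : R -> R) (s l : R) :
  is_derive f s l <->
  forall eps, 0 < eps -> exists d, 0 < d /\ forall h, Rabs h < d ->
    Rabs (f (s + h) - f s - h * l) <= eps * Rabs h.
Proof.
  split.
  - intros H. apply is_derive_Reals in H. intros eps heps.
    destruct (H eps heps) as [d hd]. exists d. split; [apply cond_pos|].
    intros h hh. destruct (Req_dec h 0) as [->|hn].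
    + rewrite Rplus_0_r, Rabs_R0.
      replace (f s - f s - 0 * l) with 0 by ring. rewrite Rabs_R0. lra.
    + specialize (hd h hn hh).
      replace (f (s + h) - f s - h * l) with (((f (s + h) - f s) / h - l) * h) by (field; trivial).
      rewrite Rabs_mult. apply Rmult_le_compat_r; [apply Rabs_pos|lra].
  - intros H. apply is_derive_Reals. intros eps heps.
    destruct (H (eps / 2)) as [d [hd0 hd]]; [lra|].
    exists (mkposreal d hd0). intros h hn hh. specialize (hd h hh).
    replace ((f (s + h) - f s) / h - l) with ((f (s + h) - f s - h * l) / h) by (field; trivial).
    unfold Rdiv. rewrite Rabs_mult, Rabs_inv.
    assert (0 < Rabs h) by now apply Rabs_pos_lt.
    apply Rmult_lt_reg_r with (Rabs h); trivial. rewrite Rmult_assoc, Rinv_l, Rmult_1_r by lra. nra.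
Qed.

Lemma is_deriv_curve_Re (f : R -> C) (s : R) (l : C) :
  is_deriv_curve f s l -> is_derive (fun u : R => Re (f u)) s (Re l).
Proof.
  rewrite is_deriv_curve_eps, is_derive_eps. intros H eps heps.
  destruct (H eps heps) as [d [hd0 hd]]. exists d. split; trivial. intros h hh.
  eapply Rle_trans; [|exact (hd h hh)].
  eapply Rle_trans; [|apply re_le_Cmod]. right. f_equal. simpl. unfold Re. ring.
Qed.

Lemma is_deriv_curve_Im (f : R -> C) (s : R) (l : C) :
  is_deriv_curve f s l -> is_derive (fun u : R => Im (f u)) s (Im l).
Proof.
  rewrite is_deriv_curve_eps, is_derive_eps. intros H eps heps.
  destruct (H eps heps) as [d [hd0 hd]]. exists d. split; trivial. intros h hh.
  eapply Rle_trans; [|exact (hd h hh)].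
  eapply Rle_trans; [|apply im_le_Cmod]. right. f_equal. simpl. unfold Im. ring.
Qed.

Lemma is_deriv_curve_pair (f : R -> C) (s : R) (l : C) :
  is_derive (fun u : R => Re (f u)) s (Re l) -> is_derive (fun u : R => Im (f u)) s (Im l) ->
  is_deriv_curve f s l.
Proof.
  rewrite is_deriv_curve_eps, !is_derive_eps. intros H1 H2 eps heps.
  destruct (H1 (eps / 2)) as [d1 [hd1 h1]]; [lra|].
  destruct (H2 (eps / 2)) as [d2 [hd2 h2]]; [lra|].
  exists (Rmin d1 d2). split; [now apply Rmin_pos|]. intros h hh.
  specialize (h1 h (Rlt_le_trans _ _ _ hh (Rmin_l _ _))).
  specialize (h2 h (Rlt_le_trans _ _ _ hh (Rmin_r _ _))).
  eapply Rle_trans; [apply Cmod_le_Re_Im|].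
  replace (Re (f (s + h) - f s - h * l)) with (Re (f (s + h)) - Re (f s) - h * Re l)
    by (simpl; unfold Re; ring).
  replace (Im (f (s + h) - f s - h * l)) with (Im (f (s + h)) - Im (f s) - h * Im l)
    by (simpl; unfold Im; ring).
  lra.
Qed.

Lemma derivRC_correct (f : R -> C) (s : R) (l : C) :
  is_deriv_curve f s l -> derivRC f s = l.
Proof.
  intros H. unfold derivRC.
  rewrite (is_derive_unique _ _ _ (is_deriv_curve_Re _ _ _ H)).
  rewrite (is_derive_unique _ _ _ (is_deriv_curve_Im _ _ _ H)). now destruct l.
Qed.

Lemma is_deriv_curve_const (c : C) (s : R) : is_deriv_curve (fun _ => c) s (RtoC 0).
Proof. apply (@is_derive_const R_AbsRing C_R_NormedModule). Qed.

Lemma is_deriv_curve_plus (f g : R -> C) (s : R) (lf lg : C) :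
  is_deriv_curve f s lf -> is_deriv_curve g s lg ->
  is_deriv_curve (fun u => f u + g u)%C s (lf + lg)%C.
Proof. apply (@is_derive_plus R_AbsRing C_R_NormedModule). Qed.

Lemma is_deriv_curve_minus (f g : R -> C) (s : R) (lf lg : C) :
  is_deriv_curve f s lf -> is_deriv_curve g s lg ->
  is_deriv_curve (fun u => f u - g u)%C s (lf - lg)%C.
Proof. apply (@is_derive_minus R_AbsRing C_R_NormedModule). Qed.

Lemma is_deriv_curve_mult (f g : R -> C) (s : R) (lf lg : C) :
  is_deriv_curve f s lf -> is_deriv_curve g s lg ->
  is_deriv_curve (fun u => f u * g u)%C s (lf * g s + f s * lg)%C.
Proof.
  intros Hf Hg.
  assert (f1 := is_deriv_curve_Re _ _ _ Hf). assert (f2 := is_deriv_curve_Im _ _ _ Hf).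
  assert (g1 := is_deriv_curve_Re _ _ _ Hg). assert (g2 := is_deriv_curve_Im _ _ _ Hg).
  assert (X : forall (a b c d : R -> R) la lb lc ld,
    is_derive a s la -> is_derive b s lb -> is_derive c s lc -> is_derive d s ld ->
    is_derive (fun u => a u * b u + c u * d u) s
      (la * b s + a s * lb + (lc * d s + c s * ld))).
  { intros a b c d la lb lc ld ha hb hc hd.
    auto_derive; [repeat split; eexists; eassumption|].
    rewrite (is_derive_unique (fun x : R => a x) _ _ ha), (is_derive_unique (fun x : R => b x) _ _ hb),
      (is_derive_unique (fun x : R => c x) _ _ hc), (is_derive_unique (fun x : R => d x) _ _ hd). ring. }
  apply is_deriv_curve_pair.
  - assert (g3 := is_derive_opp _ _ _ g2).
    eapply is_derive_ext; [|eapply eq_rect; [exact (X _ _ _ _ _ _ _ _ f1 g1 f2 g3)|]].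
    + intros t; simpl. unfold opp; simpl. unfold Re, Im. ring.
    + simpl; unfold opp; simpl; unfold Re, Im; ring.
  - eapply is_derive_ext; [|eapply eq_rect; [exact (X _ _ _ _ _ _ _ _ f1 g2 f2 g1)|]].
    + intros t; simpl. unfold Re, Im. ring.
    + simpl; unfold Re, Im; ring.
Qed.

Lemma is_deriv_curve_eq (f : R -> C) (s : R) (l l' : C) :
  is_deriv_curve f s l -> l = l' -> is_deriv_curve f s l'.
Proof. now intros H <-. Qed.

Lemma is_deriv_curve_scal (c : C) (f : R -> C) (s : R) (l : C) :
  is_deriv_curve f s l -> is_deriv_curve (fun u => c * f u)%C s (c * l)%C.
Proof.
  intros H. eapply is_deriv_curve_eq.
  - apply is_deriv_curve_mult; [apply is_deriv_curve_const | exact H].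
  - simpl. ring.
Qed.

Lemma is_deriv_curve_Cexp (f : R -> C) (s : R) (l : C) :
  is_deriv_curve f s l -> is_deriv_curve (fun u => Cexp (f u)) s (Cexp (f s) * l)%C.
Proof.
  intros H.
  assert (f1 := is_deriv_curve_Re _ _ _ H). assert (f2 := is_deriv_curve_Im _ _ _ H).
  assert (X : forall (a b : R -> R) la lb, is_derive a s la -> is_derive b s lb ->
    is_derive (fun u => exp (a u) * cos (b u)) s
      (exp (a s) * cos (b s) * la - exp (a s) * sin (b s) * lb) /\
    is_derive (fun u => exp (a u) * sin (b u)) s
      (exp (a s) * cos (b s) * lb + exp (a s) * sin (b s) * la)).
  { intros a b la lb ha hb.
    split; (auto_derive; [repeat split; eexists; eassumption|];
    rewrite (is_derive_unique (fun x : R => a x) _ _ ha), (is_derive_unique (fun x : R => b x) _ _ hb); ring). }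
  destruct (X _ _ _ _ f1 f2) as [X1 X2].
  apply is_deriv_curve_pair.
  - exact X1.
  - exact X2.
Qed.

Lemma is_deriv_curve_plog (f : R -> C) (s : R) (l : C) :
  is_deriv_curve f s l -> 0 < Re (f s) ->
  is_deriv_curve (fun u => plog (f u)) s (l / f s)%C.
Proof.
  intros H hs.
  assert (f1 := is_deriv_curve_Re _ _ _ H). assert (f2 := is_deriv_curve_Im _ _ _ H).
  assert (X : forall (a b : R -> R) la lb, is_derive a s la -> is_derive b s lb ->
    0 < a s ->
    is_derive (fun u => ln (a u * a u + b u * b u) / 2) s
      ((la * a s + lb * b s) / (a s * a s + b s * b s)) /\
    is_derive (fun u => atan (b u / a u)) s
      ((a s * lb - b s * la) / (a s * a s + b s * b s))).
  { intros a b la lb ha hb has.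
    assert (hq : 0 < a s * a s + b s * b s)
      by (generalize (Rle_0_sqr (b s)); unfold Rsqr; nra).
    split; (auto_derive; [repeat split; trivial; try (now apply Rgt_not_eq);
       (eexists; eassumption)|];
      rewrite (is_derive_unique (fun x : R => a x) _ _ ha), (is_derive_unique (fun x : R => b x) _ _ hb)).
    - field. lra.
    - field. repeat split; try lra; try nra. }
  destruct (X _ _ _ _ f1 f2 hs) as [X1 X2].
  apply is_deriv_curve_pair.
  - eapply is_derive_ext; [|eapply eq_rect; [exact X1|]].
    + intros t; simpl. rewrite <- Cmod_sqr.
      (* [is_derive_ext] asks for the identity at every [t], also where [f t = 0]; there both sides
         are the default value 0 of [ln] at 0. *)
      destruct (Req_dec (Cmod (f t)) 0) as [->|hn].
      * rewrite Rmult_0_r. unfold ln. destruct (Rlt_dec 0 0); [exfalso|]; lra.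
      * assert (0 < Cmod (f t)) by (generalize (Cmod_ge_0 (f t)); lra).
        rewrite ln_mult by trivial. field.
    + simpl. unfold Re, Im in *. field. nra.
  - eapply eq_rect; [exact X2|]. simpl. unfold Re, Im in *. field. nra.
Qed.

(* Complex differentiability in a form that composes with curves, which are differentiated
   over [R]. *)
Definition Cdiff (F : C -> C) (z l : C) : Prop :=
  forall eps, 0 < eps -> exists d, 0 < d /\ forall k, Cmod k < d ->
    Cmod (F (z + k) - F z - l * k)%C <= eps * Cmod k.

Lemma is_derive_Cdiff (F : C -> C) (z l : C) :
  is_derive (K := C_AbsRing) (V := C_NormedModule) F z l -> Cdiff F z l.
Proof.
  intros [_ H] eps heps.
  destruct (H z (fun P h => h) (mkposreal eps heps)) as [d hd].
  exists d. split; [apply cond_pos|]. intros k hk.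
  assert (e : Cminus (z + k) z = k) by ring.
  assert (hb : Cmod (Cminus (z + k) z) < d) by now rewrite e.
  specialize (hd (z + k)%C hb).
  assert (hd' : Cmod ((F (z + k) - F z) - ((z + k) - z) * l)%C <= eps * Cmod ((z + k) - z)%C)
    by exact hd.
  rewrite e in hd'. now rewrite (Cmult_comm l k).
Qed.

Lemma Cdiff_curve (F : C -> C) (g : R -> C) (s : R) (l v : C) :
  Cdiff F (g s) l -> is_deriv_curve g s v ->
  is_deriv_curve (fun u => F (g u)) s (l * v)%C.
Proof.
  rewrite !is_deriv_curve_eps. intros HF Hg eps heps.
  set (A := Cmod v + 1). set (B := Cmod l + 1).
  assert (hA : 0 < A) by (unfold A; generalize (Cmod_ge_0 v); lra).
  assert (hB : 0 < B) by (unfold B; generalize (Cmod_ge_0 l); lra).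
  destruct (HF (eps / (2 * A))) as [d1 [hd1 H1]].
  { apply Rdiv_lt_0_compat; lra. }
  assert (hm : 0 < Rmin 1 (eps / (2 * B))).
  { apply Rmin_pos; [lra|]. apply Rdiv_lt_0_compat; lra. }
  destruct (Hg _ hm) as [d2 [hd2 H2]].
  exists (Rmin d2 (d1 / A)). split.
  { apply Rmin_pos; trivial. now apply Rdiv_lt_0_compat. }
  intros h hh.
  assert (hh2 := Rlt_le_trans _ _ _ hh (Rmin_l _ _)).
  assert (hh1 := Rlt_le_trans _ _ _ hh (Rmin_r _ _)).
  specialize (H2 h hh2). set (k := (g (s + h)%R - g s)%C) in *.
  assert (ha := Rabs_pos h).
  assert (hk : Cmod k <= A * Rabs h).
  { replace k with ((k - h * v) + h * v)%C by ring.
    eapply Rle_trans; [apply Cmod_triangle|]. rewrite Cmod_mult, Cmod_R.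
    assert (Rmin 1 (eps / (2 * B)) * Rabs h <= 1 * Rabs h)
      by (apply Rmult_le_compat_r; [|apply Rmin_l]; trivial).
    unfold A. lra. }
  assert (hk1 : Cmod k < d1).
  { apply Rle_lt_trans with (1 := hk).
    apply Rmult_lt_reg_r with (/ A); [now apply Rinv_0_lt_compat|].
    replace (A * Rabs h * / A) with (Rabs h) by (field; lra). exact hh1. }
  specialize (H1 k hk1). replace (g s + k)%C with (g (s + h)%R) in H1 by (unfold k; ring).
  replace (F (g (s + h)%R) - F (g s) - h * (l * v))%C
    with ((F (g (s + h)%R) - F (g s) - l * k) + l * (k - h * v))%C by ring.
  eapply Rle_trans; [apply Cmod_triangle|]. rewrite Cmod_mult.
  assert (e1 : eps / (2 * A) * Cmod k <= eps / 2 * Rabs h).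
  { replace (eps / 2 * Rabs h) with (eps / (2 * A) * (A * Rabs h)) by (field; lra).
    apply Rmult_le_compat_l; trivial. apply Rlt_le, Rdiv_lt_0_compat; lra. }
  assert (e2 : Cmod l * Cmod (k - h * v) <= eps / 2 * Rabs h).
  { replace (eps / 2 * Rabs h) with (B * (eps / (2 * B) * Rabs h)) by (field; lra).
    apply Rmult_le_compat; try apply Cmod_ge_0; [unfold B; lra|].
    eapply Rle_trans; [exact H2|]. apply Rmult_le_compat_r; [trivial|apply Rmin_r]. }
  lra.
Qed.

(* Test [f b - f a] against the unit vector in its own direction and compare real derivatives. *)
Lemma curve_mean_value (f df : R -> C) (g dg : R -> R) (a b : R) :
  a <= b ->
  (forall s, a <= s <= b -> is_deriv_curve f s (df s)) ->
  (forall s, a <= s <= b -> is_derive g s (dg s)) ->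
  (forall s, a <= s <= b -> Cmod (df s) <= dg s) ->
  Cmod (f b - f a)%C <= g b - g a.
Proof.
  intros hab hf hg hle. set (D := (f b - f a)%C).
  (* A zero increment has no direction. Then it suffices that [g] increases, which holds because
     [dg] dominates a modulus. *)
  destruct (Req_dec (Cmod D) 0) as [h0|hn].
  - rewrite h0.
    destruct (MVT_gen g a b dg) as [c [hc ec]].
    + intros x hx. rewrite Rmin_left, Rmax_right in hx by trivial. apply hg; lra.
    + intros x hx. rewrite Rmin_left, Rmax_right in hx by trivial.
      apply derivable_continuous_pt. exists (dg x). apply is_derive_Reals, hg; lra.
    + rewrite Rmin_left, Rmax_right in hc by trivial.
      assert (0 <= dg c) by (eapply Rle_trans; [apply Cmod_ge_0|apply hle; lra]).
      rewrite ec. apply Rmult_le_pos; lra.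
  - assert (hm : 0 < Cmod D) by (generalize (Cmod_ge_0 D); lra).
    set (u := (Cconj D / Cmod D)%C).
    assert (hu : Cmod u = 1).
    { unfold u. rewrite Cmod_div, Cmod_conj, Cmod_R, Rabs_pos_eq by
        (try apply Cmod_ge_0; intros e; injection e; lra). field. lra. }
    set (h := fun s : R => g s - Re (u * f s)).
    set (dh := fun s : R => dg s - Re (u * df s)).
    assert (hd : forall s, a <= s <= b -> is_derive h s (dh s)).
    { intros s hs. apply (is_derive_minus (V := R_NormedModule)); [now apply hg|].
      apply (is_deriv_curve_Re (fun s => u * f s)%C). now apply is_deriv_curve_scal, hf. }
    destruct (MVT_gen h a b dh) as [c [hc ec]].
    + intros x hx. rewrite Rmin_left, Rmax_right in hx by trivial. apply hd; lra.
    + intros x hx. rewrite Rmin_left, Rmax_right in hx by trivial.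
      apply derivable_continuous_pt. exists (dh x). apply is_derive_Reals, hd; lra.
    + rewrite Rmin_left, Rmax_right in hc by trivial.
      assert (0 <= dh c).
      { unfold dh. assert (Rabs (Re (u * df c)) <= dg c).
        { eapply Rle_trans; [apply re_le_Cmod|]. rewrite Cmod_mult, hu, Rmult_1_l.
          apply hle; lra. }
        generalize (Rle_abs (Re (u * df c))). lra. }
      assert (hh : 0 <= h b - h a) by (rewrite ec; apply Rmult_le_pos; lra).
      assert (e : Re (u * f b) - Re (u * f a) = Cmod D).
      { replace (Re (u * f b) - Re (u * f a)) with (Re (u * D))
          by (unfold D; simpl; unfold Re, Im; ring).
        replace (u * D)%C with (RtoC (Cmod D)); [reflexivity|].
        unfold u. replace (Cconj D / Cmod D * D)%C with (D * Cconj D / Cmod D)%C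
          by (field; intros e; injection e; lra).
        rewrite <- Cmod2_conj, RtoC_pow. field. intros e; injection e; lra. }
      unfold h in hh. lra.
Qed.

(** * Entire functions and their primitives *)

(** Encodes entire functions by a second-order remainder that is uniform on each disc. The
    uniformity in [z] is what passes through the integration along segments in [Qdiff_primitive]. *)
Definition Qdiff (f f' : C -> C) : Prop :=
  forall M, exists K, 0 <= K /\ forall z k, Cmod z <= M -> Cmod (z + k) <= M ->
    Cmod (f (z + k) - f z - f' z * k)%C <= K * (Cmod k * Cmod k).

(** Both bounds are contained in the remainder estimate: increments from 0 bound [f], and the
    increment 1, on a disc larger by 1, bounds [f']. *)
Lemma Qdiff_bounded (f f' : C -> C) : Qdiff f f' ->
  forall M, exists B, 0 <= B /\ forall z, Cmod z <= M -> Cmod (f z) <= B /\ Cmod (f' z) <= B.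
Proof.
  intros H.
  assert (H1 : forall M, exists B, 0 <= B /\ forall z, Cmod z <= M -> Cmod (f z) <= B).
  { intros M. destruct (H (Rmax 0 M)) as [K [hK0 hK]].
    exists (Cmod (f 0) + Cmod (f' 0) * Rmax 0 M + K * (Rmax 0 M * Rmax 0 M)).
    assert (hM := Rmax_l 0 M). split.
    { generalize (Cmod_ge_0 (f 0)) (Cmod_ge_0 (f' 0)); intros.
      repeat apply Rplus_le_le_0_compat; repeat apply Rmult_le_pos; trivial. }
    intros z hz. assert (hz' : Cmod z <= Rmax 0 M) by (generalize (Rmax_r 0 M); lra).
    specialize (hK 0 z). rewrite Cplus_0_l in hK. rewrite Cmod_0 in hK.
    specialize (hK hM hz').
    replace (f z) with ((f z - f 0 - f' 0 * z) + (f 0 + f' 0 * z))%C by ring.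
    eapply Rle_trans; [apply Cmod_triangle|].
    assert (Cmod (f 0 + f' 0 * z) <= Cmod (f 0) + Cmod (f' 0) * Rmax 0 M).
    { eapply Rle_trans; [apply Cmod_triangle|]. rewrite Cmod_mult.
      apply Rplus_le_compat_l, Rmult_le_compat_l; trivial. apply Cmod_ge_0. }
    assert (K * (Cmod z * Cmod z) <= K * (Rmax 0 M * Rmax 0 M)).
    { apply Rmult_le_compat_l; trivial. apply Rmult_le_compat; trivial; apply Cmod_ge_0. }
    lra. }
  intros M. destruct (H1 (M + 1)) as [B [hB0 hB]]. destruct (H (M + 1)) as [K [hK0 hK]].
  exists (B + B + K). split; [lra|]. intros z hz.
  assert (hz1 : Cmod (z + 1) <= M + 1).
  { eapply Rle_trans; [apply Cmod_triangle|]. rewrite Cmod_1. lra. }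
  assert (a1 := hB z). assert (a2 := hB _ hz1). specialize (hK z 1).
  split; [generalize (Cmod_ge_0 (f z)); lra|].
  replace (f' z) with (f (z + 1)%C - f z - (f (z + 1)%C - f z - f' z * 1))%C by ring.
  eapply Rle_trans; [apply Cmod_triangle_minus|].
  eapply Rle_trans; [apply Rplus_le_compat_r, Cmod_triangle_minus|].
  rewrite Cmod_1 in hK. lra.
Qed.

Lemma Qdiff_Cdiff (f f' : C -> C) (z : C) : Qdiff f f' -> Cdiff f z (f' z).
Proof.
  intros H eps heps. destruct (H (Cmod z + 1)) as [K [hK0 hK]].
  exists (Rmin 1 (eps / (K + 1))). split.
  { apply Rmin_pos; [lra|]. apply Rdiv_lt_0_compat; lra. }
  intros k hk.
  assert (h1 := Rlt_le_trans _ _ _ hk (Rmin_l _ _)).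
  assert (h2 := Rlt_le_trans _ _ _ hk (Rmin_r _ _)).
  eapply Rle_trans.
  - apply hK; [lra|]. eapply Rle_trans; [apply Cmod_triangle|]. lra.
  - rewrite <- Rmult_assoc. apply Rmult_le_compat_r; [apply Cmod_ge_0|].
    apply Rle_trans with ((K + 1) * (eps / (K + 1))); [|right; field; lra].
    apply Rmult_le_compat; try lra. apply Cmod_ge_0.
Qed.

Lemma Qdiff_affine (c d : C) : Qdiff (fun z => c * z + d)%C (fun _ => c).
Proof.
  intros M. exists 0. split; [lra|]. intros z k _ _.
  replace (_ - _)%C with (RtoC 0) by ring. rewrite Cmod_0. lra.
Qed.

Lemma Qdiff_ext (f g f' : C -> C) : (forall z, f z = g z) -> Qdiff f f' -> Qdiff g f'.
Proof.
  intros e H M. destruct (H M) as [K [hK H1]]. exists K. split; trivial.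
  intros z k hz hk. rewrite <- !e. now apply H1.
Qed.

Lemma Qdiff_plus (f f' g g' : C -> C) : Qdiff f f' -> Qdiff g g' ->
  Qdiff (fun z => f z + g z)%C (fun z => f' z + g' z)%C.
Proof.
  intros hf hg M. destruct (hf M) as [K [hK0 hK]]. destruct (hg M) as [L [hL0 hL]].
  exists (K + L). split; [lra|]. intros z k hz hk.
  specialize (hK z k hz hk). specialize (hL z k hz hk).
  replace (_ - _)%C with
    ((f (z + k) - f z - f' z * k) + (g (z + k) - g z - g' z * k))%C by ring.
  eapply Rle_trans; [apply Cmod_triangle|]. lra.
Qed.

Lemma Qdiff_comp (f f' g g' : C -> C) : Qdiff f f' -> Qdiff g g' ->
  Qdiff (fun z => f (g z)) (fun z => f' (g z) * g' z)%C.
Proof.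
  intros hf hg M. destruct (Qdiff_bounded _ _ hg M) as [B [hB0 hB]].
  destruct (Qdiff_bounded _ _ hf B) as [A [hA0 hA]].
  destruct (hf B) as [K [hK0 hK]]. destruct (hg M) as [L [hL0 hL]].
  set (M' := Rmax 0 M). assert (hM' : 0 <= M') by apply Rmax_l.
  assert (hMM : M <= M') by apply Rmax_r.
  exists (K * ((B + 2 * L * M') * (B + 2 * L * M')) + A * L). split.
  { assert (0 <= B + 2 * L * M') by (assert (0 <= L * M') by (now apply Rmult_le_pos); lra).
    apply Rplus_le_le_0_compat; repeat apply Rmult_le_pos; trivial. }
  intros z k hz hk. set (d := (g (z + k) - g z)%C).
  specialize (hL z k hz hk). fold d in hL.
  destruct (hB z hz) as [b1 b2]. destruct (hB _ hk) as [b3 _].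
  assert (hk2 : Cmod k <= 2 * M').
  { replace k with ((z + k) - z)%C by ring. eapply Rle_trans; [apply Cmod_triangle_minus|].
    lra. }
  assert (hk0 := Cmod_ge_0 k).
  assert (hd : Cmod d <= (B + 2 * L * M') * Cmod k).
  { replace d with ((d - g' z * k) + g' z * k)%C by ring.
    eapply Rle_trans; [apply Cmod_triangle|]. rewrite Cmod_mult.
    assert (Cmod (g' z) * Cmod k <= B * Cmod k) by now apply Rmult_le_compat_r.
    assert (L * (Cmod k * Cmod k) <= L * (2 * M' * Cmod k)).
    { apply Rmult_le_compat_l; trivial. now apply Rmult_le_compat_r. }
    lra. }
  specialize (hK (g z) d b1). replace (g z + d)%C with (g (z + k))%C in hK
    by (unfold d; ring).
  specialize (hK b3). destruct (hA _ b1) as [_ a2].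
  replace (_ - _)%C with
    ((f (g (z + k)) - f (g z) - f' (g z) * d) + f' (g z) * (d - g' z * k))%C by ring.
  eapply Rle_trans; [apply Cmod_triangle|]. rewrite Cmod_mult.
  assert (e1 : K * (Cmod d * Cmod d) <=
    K * (((B + 2 * L * M') * Cmod k) * ((B + 2 * L * M') * Cmod k))).
  { apply Rmult_le_compat_l; trivial. apply Rmult_le_compat; trivial; apply Cmod_ge_0. }
  assert (e2 : Cmod (f' (g z)) * Cmod (d - g' z * k) <= A * (L * (Cmod k * Cmod k))).
  { apply Rmult_le_compat; trivial; apply Cmod_ge_0. }
  lra.
Qed.

Lemma is_deriv_curve_line (z k : C) (s : R) : is_deriv_curve (fun u => z + u * k)%C s k.
Proof.
  apply is_deriv_curve_eps. intros eps heps. exists 1. split; [lra|]. intros h _.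
  replace (_ - _)%C with (RtoC 0) by (rewrite RtoC_plus; ring).
  rewrite Cmod_0. generalize (Rabs_pos h). nra.
Qed.

Lemma is_derive_scal_id (c s : R) : is_derive (fun u => c * u) s c.
Proof. auto_derive; trivial. ring. Qed.

Lemma Cexp_order1 (k : C) : Cmod (Cexp k - 1) <= Cmod k * exp (Cmod k).
Proof.
  generalize (curve_mean_value (fun u => Cexp (0 + u * k)%C)
    (fun u => Cexp (0 + u * k) * k)%C (fun u => (Cmod k * exp (Cmod k)) * u)
    (fun _ => Cmod k * exp (Cmod k)) 0 1).
  intros H. replace (0 + 1 * k)%C with k in H by ring.
  replace (0 + 0 * k)%C with (RtoC 0) in H by ring. rewrite Cexp_0 in H.
  eapply Rle_trans; [apply H|right; ring]; clear H.
  - lra.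
  - intros s _. apply is_deriv_curve_Cexp, is_deriv_curve_line.
  - intros s _. apply is_derive_scal_id.
  - intros s hs. rewrite Cmod_mult, Cmod_Cexp, Rmult_comm.
    apply Rmult_le_compat_l; [apply Cmod_ge_0|]. apply exp_monotone.
    eapply Rle_trans; [apply Rle_abs|]. eapply Rle_trans; [apply re_le_Cmod|].
    rewrite Cplus_0_l, Cmod_mult, Cmod_R, Rabs_pos_eq by lra.
    generalize (Cmod_ge_0 k). nra.
Qed.

Lemma Cexp_order2 (k : C) : Cmod (Cexp k - 1 - k) <= Cmod k * Cmod k * exp (Cmod k).
Proof.
  generalize (curve_mean_value (fun u => Cexp (0 + u * k) - (1 + u * k))%C
    (fun u => Cexp (0 + u * k) * k - k)%C (fun u => (Cmod k * Cmod k * exp (Cmod k)) * u)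
    (fun _ => Cmod k * Cmod k * exp (Cmod k)) 0 1).
  intros H. cbv beta in H. replace (0 + 1 * k)%C with k in H by ring.
  replace (0 + 0 * k)%C with (RtoC 0) in H by ring. rewrite Cexp_0 in H.
  replace (Cexp k - (1 + 1 * k) - (1 - (1 + 0 * k)))%C with (Cexp k - 1 - k)%C in H by ring.
  eapply Rle_trans; [apply H|right; ring]; clear H.
  - lra.
  - intros s _. apply is_deriv_curve_minus; [apply is_deriv_curve_Cexp|];
      apply is_deriv_curve_line.
  - intros s _. apply is_derive_scal_id.
  - intros s hs. replace (Cexp (0 + s * k) * k - k)%C with (k * (Cexp (s * k) - 1))%C
      by (rewrite Cplus_0_l; ring).
    rewrite Cmod_mult, Rmult_assoc. apply Rmult_le_compat_l; [apply Cmod_ge_0|].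
    eapply Rle_trans; [apply Cexp_order1|].
    assert (hk := Cmod_ge_0 k).
    assert (hsk : Cmod (s * k) <= Cmod k)
      by (rewrite Cmod_mult, Cmod_R, Rabs_pos_eq by lra; nra).
    apply Rmult_le_compat; trivial; [apply Cmod_ge_0|left; apply exp_pos|now apply exp_monotone].
Qed.

Lemma Qdiff_Cexp : Qdiff Cexp Cexp.
Proof.
  intros M. exists (exp M * exp (2 * M)). split.
  { apply Rmult_le_pos; left; apply exp_pos. }
  intros z k hz hk.
  rewrite Cexp_plus.
  replace (_ - _)%C with (Cexp z * (Cexp k - 1 - k))%C by ring.
  rewrite Cmod_mult, Rmult_assoc. apply Rmult_le_compat; try apply Cmod_ge_0.
  - rewrite Cmod_Cexp. apply exp_monotone. generalize (re_le_Cmod z) (Rle_abs (Re z)). lra.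
  - eapply Rle_trans; [apply Cexp_order2|]. rewrite Rmult_comm.
    apply Rmult_le_compat_r; [apply Rmult_le_pos; apply Cmod_ge_0|].
    apply exp_monotone. replace k with ((z + k) - z)%C by ring.
    eapply Rle_trans; [apply Cmod_triangle_minus|]. lra.
Qed.

Definition segment_integral (h : C -> C) (z : C) (s : R) : C :=
  RInt (V := C_R_CompleteNormedModule) (fun u : R => h (u * z) * z)%C 0 s.

Lemma is_deriv_curve_continuous (f : R -> C) (s : R) (l : C) :
  is_deriv_curve f s l -> @continuous R_UniformSpace C_UniformSpace f s.
Proof.
  intros H. apply (@ex_derive_continuous R_AbsRing C_R_NormedModule). now exists l.
Qed.

Lemma is_derive_segment_integral (h h' : C -> C) (z : C) (s : R) : Qdiff h h' ->
  is_deriv_curve (segment_integral h z) s (h (s * z) * z)%C.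
Proof.
  intros H.
  assert (hc : forall u : R, @continuous R_UniformSpace C_UniformSpace
    (fun u : R => h (u * z) * z)%C u).
  { intros u. eapply is_deriv_curve_continuous. apply is_deriv_curve_mult.
    - apply (Cdiff_curve h (fun u : R => (u * z)%C)).
      + apply Qdiff_Cdiff, H.
      + generalize (is_deriv_curve_line 0 z u). apply is_derive_ext. intros t.
        now rewrite Cplus_0_l.
    - apply is_deriv_curve_const. }
  apply (is_derive_RInt (V := C_R_NormedModule) (fun u : R => h (u * z) * z)%C) with (a := 0).
  - apply filter_forall. intros x.
    apply (RInt_correct (V := C_R_CompleteNormedModule)).
    apply (ex_RInt_continuous (V := C_R_CompleteNormedModule)).
    intros u _. apply hc.
  - apply hc.
Qed.

(** Subtract [s * k * h (s * z)] from the difference of the two segment integrals: at [s = 1] this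
    is the remainder to be bounded. Its derivative in [s] collapses to r (z + k) + h'(s z) (s k) k,
    where r is the remainder of [h] between s z and s (z + k), and both terms are quadratic in
    [k]. *)
Lemma Qdiff_primitive (h h' : C -> C) : Qdiff h h' ->
  Qdiff (fun z => segment_integral h z 1) h.
Proof.
  intros H M. destruct (H M) as [K [hK0 hK]].
  destruct (Qdiff_bounded _ _ H M) as [B [hB0 hB]].
  set (M' := Rmax 0 M). assert (hM' : 0 <= M') by apply Rmax_l.
  assert (hMM : M <= M') by apply Rmax_r.
  assert (hKM : 0 <= K * M') by now apply Rmult_le_pos.
  exists (3 * (K * M') + B). split; [lra|]. intros z k hz hk.
  set (c := 3 * (K * M') + B).
  generalize (curve_mean_value
    (fun s => segment_integral h (z + k)%C s - segment_integral h z s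
              - (0 + s * k) * h (0 + s * z))%C
    (fun s => h (s * (z + k)) * (z + k) - h (s * z) * z
              - (k * h (0 + s * z) + (0 + s * k) * (h' (0 + s * z) * z)))%C
    (fun s => c * (Cmod k * Cmod k) * s) (fun _ => c * (Cmod k * Cmod k)) 0 1).
  intros E. cbv beta in E.
  assert (e0 : forall y, segment_integral h y 0 = RtoC 0).
  { intros y. unfold segment_integral. now rewrite RInt_point. }
  rewrite !e0 in E.
  replace (_ - _ - (0 - 0 - (0 + 0 * k) * h (0 + 0 * z)))%C
    with (segment_integral h (z + k) 1 - segment_integral h z 1 - h (0 + 1 * z) * k)%C in E
    by ring.
  replace (0 + 1 * z)%C with z in E by ring.
  eapply Rle_trans; [apply E|right; ring]; clear E.
  - lra.
  - intros s hs. apply is_deriv_curve_minus; [apply is_deriv_curve_minus|].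
    + apply (is_derive_segment_integral h h'), H.
    + apply (is_derive_segment_integral h h'), H.
    + apply is_deriv_curve_mult; [apply is_deriv_curve_line|].
      apply (Cdiff_curve h (fun s : R => (0 + s * z)%C)); [apply Qdiff_Cdiff, H|].
      apply is_deriv_curve_line.
  - intros s _. apply is_derive_scal_id.
  - intros s hs. rewrite !Cplus_0_l.
    assert (hk0 := Cmod_ge_0 k).
    assert (hs1 : forall y, Cmod y <= M -> Cmod (s * y) <= M).
    { intros y hy. rewrite Cmod_mult, Cmod_R, Rabs_pos_eq by lra.
      generalize (Cmod_ge_0 y). nra. }
    assert (hsk : Cmod (s * k) <= Cmod k)
      by (rewrite Cmod_mult, Cmod_R, Rabs_pos_eq by lra; nra).
    assert (q1 := hs1 z hz). assert (q2 := hs1 _ hk).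
    specialize (hK (s * z)%C (s * k)%C q1).
    replace (s * z + s * k)%C with (s * (z + k))%C in hK by ring.
    specialize (hK q2).
    set (r := (h (s * (z + k)) - h (s * z) - h' (s * z) * (s * k))%C) in *.
    replace (_ - _ - _)%C with (r * (z + k) + h' (s * z) * (s * k) * k)%C
      by (unfold r; ring).
    assert (hr : Cmod r <= K * (Cmod k * Cmod k)).
    { eapply Rle_trans; [exact hK|]. apply Rmult_le_compat_l; trivial.
      apply Rmult_le_compat; trivial; apply Cmod_ge_0. }
    eapply Rle_trans; [apply Cmod_triangle|]. rewrite !(Cmod_mult _ k), Cmod_mult.
    rewrite (Cmod_mult (h' _) _).
    destruct (hB _ q1) as [_ b].
    assert (t1 : Cmod r * Cmod (z + k) <= K * (Cmod k * Cmod k) * M').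
    { apply Rmult_le_compat; trivial; try apply Cmod_ge_0. lra. }
    assert (t2 : Cmod (h' (s * z)%C) * Cmod (s * k) * Cmod k <= B * Cmod k * Cmod k).
    { apply Rmult_le_compat_r; trivial.
      apply Rmult_le_compat; trivial; apply Cmod_ge_0. }
    unfold c. assert (0 <= Cmod k * Cmod k) by now apply Rmult_le_pos.
    assert (0 <= K * M' * (Cmod k * Cmod k)) by now apply Rmult_le_pos.
    nra.
Qed.

(** Takes the place of Cauchy's theorem: with a primitive, moving a path of integration costs only
    the values at its two ends. *)
Theorem entire_primitive (h h' : C -> C) : Qdiff h h' ->
  exists H : C -> C, forall z, Cdiff H z (h z).
Proof.
  intros H. exists (fun z => segment_integral h z 1). intros z.
  now apply Qdiff_Cdiff, (Qdiff_primitive h h').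
Qed.

(** * Complex series *)

Notation is_series_C := (@is_series C_AbsRing C_NormedModule).
Notation sum_C := (@sum_n C_NormedModule).

Lemma sum_C_S (u : nat -> C) (n : nat) : sum_C u (S n) = (sum_C u n + u (S n))%C.
Proof. apply (sum_Sn (G := C_NormedModule)). Qed.

Lemma sum_C_O (u : nat -> C) : sum_C u 0 = u 0%nat.
Proof. apply (sum_O (G := C_NormedModule)). Qed.

Lemma sum_n_S (u : nat -> R) (n : nat) : sum_n u (S n) = sum_n u n + u (S n).
Proof. apply (sum_Sn (G := R_AbelianMonoid)). Qed.

Lemma sum_n_0 (u : nat -> R) : sum_n u 0 = u 0%nat.
Proof. apply (sum_O (G := R_AbelianMonoid)). Qed.

Lemma Re_sum (u : nat -> C) (n : nat) : Re (sum_C u n) = sum_n (fun k => Re (u k)) n.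
Proof.
  induction n as [|n IH].
  - now rewrite sum_C_O, sum_n_0.
  - rewrite sum_C_S, sum_n_S, <- IH. reflexivity.
Qed.

Lemma Im_sum (u : nat -> C) (n : nat) : Im (sum_C u n) = sum_n (fun k => Im (u k)) n.
Proof.
  induction n as [|n IH].
  - now rewrite sum_C_O, sum_n_0.
  - rewrite sum_C_S, sum_n_S, <- IH. reflexivity.
Qed.

Lemma is_series_C_eps (u : nat -> C) (l : C) :
  is_series_C u l <->
  forall eps, 0 < eps -> exists N, forall n, (N <= n)%nat -> Cmod (sum_C u n - l)%C < eps.
Proof.
  split.
  - intros H eps heps.
    destruct (proj1 (filterlim_locally_ball_norm (K := C_AbsRing) (U := C_NormedModule)
      (F := eventually) (sum_C u) l) H (mkposreal eps heps)) as [N hN].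
    exists N. intros n hn. exact (hN n hn).
  - intros H. apply (filterlim_locally_ball_norm (K := C_AbsRing) (U := C_NormedModule)
      (F := eventually) (sum_C u) l). intros eps. destruct (H eps (cond_pos eps)) as [N hN].
    exists N. intros n hn. exact (hN n hn).
Qed.

Lemma is_series_eps (u : nat -> R) (l : R) :
  is_series u l <->
  forall eps, 0 < eps -> exists N, forall n, (N <= n)%nat -> Rabs (sum_n u n - l) < eps.
Proof.
  split.
  - intros H eps heps.
    destruct (proj1 (filterlim_locally (F := eventually) (U := R_UniformSpace)
      (sum_n u) l) H (mkposreal eps heps)) as [N hN].
    exists N. intros n hn. exact (hN n hn).
  - intros H. apply (filterlim_locally (F := eventually) (U := R_UniformSpace)
      (sum_n u) l). intros eps. destruct (H eps (cond_pos eps)) as [N hN].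
    exists N. intros n hn. exact (hN n hn).
Qed.

Lemma is_series_C_Re (u : nat -> C) (l : C) :
  is_series_C u l -> is_series (fun n => Re (u n)) (Re l).
Proof.
  rewrite is_series_C_eps, is_series_eps. intros H eps heps.
  destruct (H eps heps) as [N hN]. exists N. intros n hn.
  eapply Rle_lt_trans; [|exact (hN n hn)].
  eapply Rle_trans; [|apply re_le_Cmod]. rewrite <- Re_sum. right. reflexivity.
Qed.

Lemma is_series_C_Im (u : nat -> C) (l : C) :
  is_series_C u l -> is_series (fun n => Im (u n)) (Im l).
Proof.
  rewrite is_series_C_eps, is_series_eps. intros H eps heps.
  destruct (H eps heps) as [N hN]. exists N. intros n hn.
  eapply Rle_lt_trans; [|exact (hN n hn)].
  eapply Rle_trans; [|apply im_le_Cmod]. rewrite <- Im_sum. right. reflexivity.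
Qed.

Lemma is_series_C_pair (u : nat -> C) (l : C) :
  is_series (fun n => Re (u n)) (Re l) -> is_series (fun n => Im (u n)) (Im l) ->
  is_series_C u l.
Proof.
  rewrite is_series_C_eps, !is_series_eps. intros H1 H2 eps heps.
  destruct (H1 (eps / 2)) as [N1 h1]; [lra|]. destruct (H2 (eps / 2)) as [N2 h2]; [lra|].
  exists (N1 + N2)%nat. intros n hn.
  specialize (h1 n ltac:(lia)). specialize (h2 n ltac:(lia)).
  rewrite <- Re_sum in h1. rewrite <- Im_sum in h2.
  eapply Rle_lt_trans; [apply Cmod_le_Re_Im|].
  change (Rabs (Re (sum_C u n) - Re l) + Rabs (Im (sum_C u n) - Im l) < eps). lra.
Qed.

Lemma is_series_C_unique (u : nat -> C) (l l' : C) :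
  is_series_C u l -> is_series_C u l' -> l = l'.
Proof.
  intros H H'.
  assert (h1 := is_series_unique _ _ (is_series_C_Re _ _ H)).
  rewrite (is_series_unique _ _ (is_series_C_Re _ _ H')) in h1.
  assert (h2 := is_series_unique _ _ (is_series_C_Im _ _ H)).
  rewrite (is_series_unique _ _ (is_series_C_Im _ _ H')) in h2.
  destruct l, l'; simpl in *; congruence.
Qed.

Lemma CSeries_correct (u : nat -> C) (l : C) : is_series_C u l -> CSeries u = l.
Proof.
  intros H. unfold CSeries.
  rewrite (is_series_unique _ _ (is_series_C_Re _ _ H)).
  rewrite (is_series_unique _ _ (is_series_C_Im _ _ H)). now destruct l.
Qed.

Lemma is_series_C_ext (u v : nat -> C) (l : C) :
  (forall n, u n = v n) -> is_series_C u l -> is_series_C v l.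
Proof. apply (@is_series_ext C_AbsRing C_NormedModule). Qed.

Lemma is_series_C_plus (u v : nat -> C) (l m : C) :
  is_series_C u l -> is_series_C v m -> is_series_C (fun n => u n + v n)%C (l + m)%C.
Proof. apply (@is_series_plus C_AbsRing C_NormedModule). Qed.

Lemma is_series_C_scal (c : C) (u : nat -> C) (l : C) :
  is_series_C u l -> is_series_C (fun n => c * u n)%C (c * l)%C.
Proof. apply (@is_series_scal C_AbsRing C_NormedModule). Qed.

Lemma is_series_C_bounded (u : nat -> C) (l : C) :
  is_series_C u l -> exists K, 0 <= K /\ forall n, Cmod (u n) <= K.
Proof.
  intros H. destruct (proj1 (is_series_C_eps _ _) H 1) as [N hN]; [lra|].
  assert (X : forall N, exists K, 0 <= K /\ forall n, (n <= N)%nat -> Cmod (u n) <= K).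
  { clear. induction N as [|N [K [hK0 hK]]].
    - exists (Cmod (u 0%nat)). split; [apply Cmod_ge_0|]. intros n hn.
      replace n with 0%nat by lia. lra.
    - exists (K + Cmod (u (S N))). assert (h := Cmod_ge_0 (u (S N))). split; [lra|].
      intros n hn. destruct (Nat.eq_dec n (S N)) as [->|hne]; [lra|].
      specialize (hK n ltac:(lia)). lra. }
  destruct (X N) as [K [hK0 hK]]. exists (K + 2). split; [lra|]. intros n.
  destruct (Nat.le_gt_cases n N) as [h|h]; [specialize (hK n h); lra|].
  destruct n as [|n]; [lia|].
  assert (a1 := hN n ltac:(lia)). assert (a2 := hN (S n) ltac:(lia)).
  replace (u (S n)) with ((sum_C u (S n) - l) - (sum_C u n - l))%C
    by (rewrite sum_C_S; ring).
  eapply Rle_trans; [apply Cmod_triangle_minus|]. lra.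
Qed.

Lemma Cmod_sum_le (u : nat -> C) (v : nat -> R) (n : nat) :
  (forall k, (k <= n)%nat -> Cmod (u k) <= v k) -> Cmod (sum_C u n) <= sum_n v n.
Proof.
  induction n as [|n IH]; intros h.
  - rewrite sum_C_O, sum_n_0. now apply h.
  - rewrite sum_C_S, sum_n_S. eapply Rle_trans; [apply Cmod_triangle|].
    apply Rplus_le_compat; [apply IH; intros k hk|]; apply h; lia.
Qed.

Lemma is_series_C_norm (u : nat -> C) (v : nat -> R) (l : C) (m : R) :
  is_series_C u l -> is_series v m -> (forall n, Cmod (u n) <= v n) -> Cmod l <= m.
Proof.
  intros Hu Hv h. apply Rnot_lt_le. intros hlt.
  destruct (proj1 (is_series_C_eps _ _) Hu ((Cmod l - m) / 2)) as [N1 h1]; [lra|].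
  destruct (proj1 (is_series_eps _ _) Hv ((Cmod l - m) / 2)) as [N2 h2]; [lra|].
  specialize (h1 (N1 + N2)%nat ltac:(lia)). specialize (h2 (N1 + N2)%nat ltac:(lia)).
  assert (h3 := Cmod_sum_le u v (N1 + N2) (fun k _ => h k)).
  rewrite Cmod_minus_sym in h1.
  assert (h4 := Cmod_triangle_inv l (sum_C u (N1 + N2))).
  apply Rabs_def2 in h2. lra.
Qed.

Lemma is_series_half (K : R) : is_series (fun n => K * (1 / 2) ^ n) (2 * K).
Proof.
  replace (2 * K) with (K * / (1 - 1 / 2)) by field.
  apply (is_series_scal (K := R_AbsRing) (V := R_NormedModule) K). apply is_series_geom. rewrite Rabs_pos_eq; lra.
Qed.

(** The fixed ratio 1/2 serves every power series with coefficients bounded by K R^n at the points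
    with [Cmod t <= / (2 * R)]. *)
Lemma is_series_C_geom (u : nat -> C) (K : R) :
  (forall n, Cmod (u n) <= K * (1 / 2) ^ n) ->
  exists l, is_series_C u l /\ Cmod l <= 2 * K.
Proof.
  intros h.
  assert (he : @ex_series C_AbsRing C_NormedModule u).
  { apply (ex_series_le (K := C_AbsRing) (V := C_CompleteNormedModule) u
      (fun n => K * (1 / 2) ^ n) h). eexists. apply is_series_half. }
  destruct he as [l hl]. exists l. split; trivial.
  eapply is_series_C_norm; [exact hl|apply is_series_half|exact h].
Qed.

(** * Germs of analytic functions *)

(** The radius is existential, and only the values of [F] near 0 matter: identities between germs
    are combined by intersecting neighbourhoods with [near0_and]. *)
Definition has_ps (F : C -> C) (l : nat -> C) : Prop :=
  exists eps, 0 < eps /\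
    forall t, Cmod t < eps -> is_series_C (fun n => l n * t ^ n)%C (F t).

Definition near0 (P : C -> Prop) : Prop :=
  exists eps, 0 < eps /\ forall t, Cmod t < eps -> P t.

Lemma near0_and (P Q : C -> Prop) : near0 P -> near0 Q -> near0 (fun t => P t /\ Q t).
Proof.
  intros [e [he H]] [d [hd H']]. exists (Rmin e d). split; [now apply Rmin_pos|].
  intros t ht. assert (h1 := Rlt_le_trans _ _ _ ht (Rmin_l _ _)).
  assert (h2 := Rlt_le_trans _ _ _ ht (Rmin_r _ _)). split; auto.
Qed.

Lemma near0_imp (P Q : C -> Prop) : (forall t, P t -> Q t) -> near0 P -> near0 Q.
Proof. intros h [e [he H]]. exists e. split; auto. Qed.

Lemma near0_lt (r : R) : 0 < r -> near0 (fun t => Cmod t < r).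
Proof. intros h. exists r. auto. Qed.

Lemma has_ps_ext (F G : C -> C) (l : nat -> C) :
  has_ps F l -> near0 (fun t => F t = G t) -> has_ps G l.
Proof.
  intros H E. eapply near0_imp; [|apply (near0_and _ _ H E)].
  intros t [h e]. simpl in h. now rewrite <- e.
Qed.

Lemma has_ps_coef_ext (F : C -> C) (l m : nat -> C) :
  has_ps F l -> (forall n, l n = m n) -> has_ps F m.
Proof.
  intros [e [he H]] E. exists e. split; trivial. intros t ht.
  eapply is_series_C_ext; [|exact (H t ht)]. intros n. simpl. now rewrite E.
Qed.

Lemma Cmod_R_pos (x : R) : 0 <= x -> Cmod x = x.
Proof. intros h. now rewrite Cmod_R, Rabs_pos_eq. Qed.

(** Abel's lemma: the terms of a series that converges at one point are bounded. This turns
    convergence known only at points of the contour into convergence in a full disc. *)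
Lemma ps_point_bound (l : nat -> C) (x : R) (t s : C) : 0 < x -> Cmod t = x ->
  is_series_C (fun n => l n * t ^ n)%C s ->
  exists R K, 0 < R /\ 0 <= K /\ forall n, Cmod (l n) <= K * R ^ n.
Proof.
  intros hx ht H. destruct (is_series_C_bounded _ _ H) as [K [hK0 hK]].
  exists (/ x), K. split; [now apply Rinv_0_lt_compat|]. split; trivial.
  intros n. specialize (hK n). rewrite Cmod_mult, Cmod_pow, ht in hK.
  rewrite pow_inv. assert (hp := pow_lt x n hx).
  apply Rmult_le_reg_r with (x ^ n); trivial.
  rewrite Rmult_assoc, Rinv_l, Rmult_1_r by lra. exact hK.
Qed.

Lemma has_ps_bound (F : C -> C) (l : nat -> C) : has_ps F l ->
  exists R K, 0 < R /\ 0 <= K /\ forall n, Cmod (l n) <= K * R ^ n.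
Proof.
  intros [e [he H]].
  apply (ps_point_bound l (e / 2) (RtoC (e / 2)) (F (RtoC (e / 2)))); [lra| |].
  - apply Cmod_R_pos; lra.
  - apply H. rewrite Cmod_R_pos; lra.
Qed.

Lemma geom_half (l : nat -> C) (R K : R) (t : C) :
  0 < R -> (forall n, Cmod (l n) <= K * R ^ n) -> Cmod t <= / (2 * R) ->
  forall n, Cmod (l n * t ^ n) <= K * (1 / 2) ^ n.
Proof.
  intros hR h ht n. rewrite Cmod_mult, Cmod_pow.
  assert (hK : 0 <= K).
  { generalize (h 0%nat) (Cmod_ge_0 (l 0%nat)). simpl. lra. }
  replace (1 / 2) with (R * (/ (2 * R))) by (field; lra).
  rewrite Rpow_mult_distr, <- Rmult_assoc.
  apply Rmult_le_compat; trivial; try apply Cmod_ge_0.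
  - apply pow_le, Cmod_ge_0.
  - apply pow_incr. split; trivial. apply Cmod_ge_0.
Qed.

Definition cps (l : nat -> C) (t : C) : C := CSeries (fun n => l n * t ^ n)%C.

Lemma geom_has_ps (l : nat -> C) (R K : R) :
  0 < R -> (forall n, Cmod (l n) <= K * R ^ n) -> has_ps (cps l) l.
Proof.
  intros hR h. exists (/ (2 * R)). split; [apply Rinv_0_lt_compat; lra|].
  intros t ht.
  destruct (is_series_C_geom _ _ (geom_half l R K t hR h (Rlt_le _ _ ht))) as [s [hs _]].
  unfold cps. now rewrite (CSeries_correct _ _ hs).
Qed.

Lemma has_ps_bounded (F : C -> C) (l : nat -> C) : has_ps F l ->
  exists B, 0 <= B /\ near0 (fun t => Cmod (F t) <= B).
Proof.
  intros H. destruct (has_ps_bound _ _ H) as [R [K [hR [hK h]]]].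
  exists (2 * K). split; [lra|].
  assert (hr : 0 < / (2 * R)) by (apply Rinv_0_lt_compat; lra).
  eapply near0_imp; [|apply (near0_and _ _ H (near0_lt _ hr))].
  intros t [h1 h2]. simpl in h1, h2.
  destruct (is_series_C_geom _ _ (geom_half l R K t hR h (Rlt_le _ _ h2))) as [s [hs b]].
  now rewrite (is_series_C_unique _ _ _ h1 hs).
Qed.

Lemma has_ps_plus (F G : C -> C) (l m : nat -> C) : has_ps F l -> has_ps G m ->
  has_ps (fun t => F t + G t)%C (fun n => l n + m n)%C.
Proof.
  intros H H'. eapply near0_imp; [|apply (near0_and _ _ H H')].
  intros t [h h']. eapply is_series_C_ext; [|apply (is_series_C_plus _ _ _ _ h h')].
  intros n. simpl. ring.
Qed.

Lemma has_ps_scal (c : C) (F : C -> C) (l : nat -> C) : has_ps F l ->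
  has_ps (fun t => c * F t)%C (fun n => c * l n)%C.
Proof.
  intros H. eapply near0_imp; [|exact H].
  intros t h. eapply is_series_C_ext; [|apply (is_series_C_scal c _ _ h)].
  intros n. simpl. ring.
Qed.

Lemma has_ps_minus (F G : C -> C) (l m : nat -> C) : has_ps F l -> has_ps G m ->
  has_ps (fun t => F t - G t)%C (fun n => l n - m n)%C.
Proof.
  intros H H'. eapply has_ps_coef_ext.
  - eapply has_ps_ext; [apply (has_ps_plus _ _ _ _ H (has_ps_scal (RtoC (-1)) _ _ H'))|].
    exists 1. split; [lra|]. intros t _. simpl. ring.
  - intros n. simpl. ring.
Qed.

Lemma is_series_C_split (u : nat -> C) (s : C) :
  is_series_C (fun n => u (S n)) s -> is_series_C u (u 0%nat + s)%C.
Proof.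
  intros H. apply (is_series_decr_1 (K := C_AbsRing) (V := C_NormedModule)).
  replace (plus _ _) with s; [exact H|].
  unfold plus, opp; simpl. Cring.
Qed.

Lemma is_series_C_split_inv (u : nat -> C) (s : C) :
  is_series_C u (u 0%nat + s)%C -> is_series_C (fun n => u (S n)) s.
Proof.
  intros H. apply (is_series_incr_1 (K := C_AbsRing) (V := C_NormedModule)).
  replace (plus _ _) with (u 0%nat + s)%C; [exact H|].
  unfold plus; simpl. Cring.
Qed.

Lemma has_ps_at_0 (F : C -> C) (l : nat -> C) : has_ps F l -> F 0 = l 0%nat.
Proof.
  intros [e [he H]]. specialize (H 0). rewrite Cmod_0 in H. specialize (H he).
  eapply is_series_C_unique; [exact H|].
  replace (l 0%nat) with (l 0%nat * 0 ^ 0 + 0)%C by (simpl; ring).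
  apply is_series_C_split.
  apply is_series_C_ext with (fun _ => RtoC 0); [intros n; simpl; ring|].
  apply is_series_C_eps. intros eps heps. exists 0%nat. intros n _.
  replace (sum_C (fun _ : nat => RtoC 0) n - 0)%C with (RtoC 0); [now rewrite Cmod_0|].
  induction n as [|n IH]; [rewrite sum_C_O; ring|]. rewrite sum_C_S.
  rewrite IH at 1. ring.
Qed.

Definition shift_coef (l : nat -> C) (n : nat) : C :=
  match n with O => RtoC 0 | S n' => l n' end.

Lemma has_ps_shift (G : C -> C) (l : nat -> C) : has_ps G l ->
  has_ps (fun t => t * G t)%C (shift_coef l).
Proof.
  intros H. eapply near0_imp; [|exact H]. intros t h.
  replace (t * G t)%C with (shift_coef l 0 * t ^ 0 + t * G t)%C by (simpl; ring).
  apply is_series_C_split.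
  eapply is_series_C_ext; [|apply (is_series_C_scal t _ _ h)]. intros n. simpl. ring.
Qed.

Lemma has_ps_unshift (F : C -> C) (l : nat -> C) : has_ps F l ->
  has_ps (cps (fun n => l (S n))) (fun n => l (S n)) /\
  near0 (fun t => F t = l 0%nat + t * cps (fun n => l (S n)) t)%C.
Proof.
  intros H. destruct (has_ps_bound _ _ H) as [R [K [hR [hK h]]]].
  assert (H1 : has_ps (cps (fun n => l (S n))) (fun n => l (S n))).
  { apply (geom_has_ps _ R (K * R)); trivial. intros n. specialize (h (S n)).
    simpl in h. lra. }
  split; trivial. eapply near0_imp; [|apply (near0_and _ _ H H1)].
  intros t [h1 h2]. eapply is_series_C_unique; [exact h1|].
  replace (l 0%nat) with (l 0%nat * t ^ 0)%C by (simpl; ring).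
  apply is_series_C_split.
  eapply is_series_C_ext; [|apply (is_series_C_scal t _ _ h2)]. intros n. simpl. ring.
Qed.

Lemma has_ps_zero_0 (F : C -> C) (l : nat -> C) : has_ps F l ->
  near0 (fun t => t <> 0 -> F t = 0) -> l 0%nat = 0.
Proof.
  intros H Z. destruct (has_ps_unshift _ _ H) as [H1 E].
  destruct (has_ps_bounded _ _ H1) as [B [hB0 hB]].
  destruct (near0_and _ _ (near0_and _ _ Z E) hB) as [e [he X]].
  apply Cmod_eq_0. apply Rle_antisym; [|apply Cmod_ge_0].
  apply Rnot_lt_le. intros hlt.
  (* At this point the sum of [l 0] and [x] times a number of modulus at most [B] cannot vanish, the
     second term being at most half of [Cmod (l 0)]. *)
  set (x := Rmin (e / 2) (Cmod (l 0%nat) / (2 * (B + 1)))).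
  assert (hx0 : 0 < x) by (apply Rmin_pos; [lra|apply Rdiv_lt_0_compat; lra]).
  assert (hx1 : x <= e / 2) by apply Rmin_l.
  assert (hx2 : x <= Cmod (l 0%nat) / (2 * (B + 1))) by apply Rmin_r.
  destruct (X (RtoC x)) as [[a1 a2] a3]; [rewrite Cmod_R_pos; lra|].
  rewrite a1 in a2 by (intros q; injection q; lra).
  assert (e1 : Cmod (l 0%nat) <= x * B).
  { replace (l 0%nat) with (0 - x * cps (fun n => l (S n)) x)%C by (rewrite a2; ring).
    eapply Rle_trans; [apply Cmod_triangle_minus|].
    rewrite Cmod_0, Cmod_mult, Cmod_R_pos by lra.
    rewrite Rplus_0_l. apply Rmult_le_compat_l; lra. }
  assert (x * (2 * (B + 1)) <= Cmod (l 0%nat)).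
  { apply Rmult_le_compat_r with (r := 2 * (B + 1)) in hx2; [|lra].
    unfold Rdiv in hx2. rewrite Rmult_assoc, Rinv_l, Rmult_1_r in hx2; lra. }
  nra.
Qed.

(** Repeated division by [t]. The origin is left out of the hypothesis because division says nothing
    there, and because a residue prescribes its function only off the pole. *)
Lemma has_ps_zero (n : nat) : forall (F : C -> C) (l : nat -> C), has_ps F l ->
  near0 (fun t => t <> 0 -> F t = 0) -> l n = 0.
Proof.
  induction n as [|n IH]; intros F l H Z; [now apply (has_ps_zero_0 F)|].
  destruct (has_ps_unshift _ _ H) as [H1 E].
  apply (IH _ (fun n => l (S n)) H1).
  eapply near0_imp; [|apply (near0_and _ _ Z E)]. intros t [z e] ht. specialize (z ht).
  simpl in e. rewrite z, (has_ps_zero_0 F l H Z), Cplus_0_l in e.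
  set (y := cps _ t) in *. replace y with (/ t * (t * y))%C by (field; trivial).
  rewrite <- e. ring.
Qed.

Lemma has_ps_unique (F G : C -> C) (l m : nat -> C) : has_ps F l -> has_ps G m ->
  near0 (fun t => t <> 0 -> F t = G t) -> forall n, l n = m n.
Proof.
  intros H H' E n.
  assert (Z : (l n - m n)%C = 0).
  { apply (has_ps_zero n _ (fun n => l n - m n)%C (has_ps_minus _ _ _ _ H H')).
    eapply near0_imp; [|exact E]. intros t h ht. simpl. rewrite h by trivial. ring. }
  replace (l n) with ((l n - m n) + m n)%C by ring. rewrite Z. ring.
Qed.

Lemma sum_f_R0_sum_n (u : nat -> R) (n : nat) : sum_f_R0 u n = sum_n u n.
Proof. symmetry. apply sum_n_Reals. Qed.

(** The geometric bounds make the real and imaginary parts absolutely convergent; their four real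
    Cauchy products recombine coefficient by coefficient. *)
Lemma is_series_C_mult (u v : nat -> C) (K L : R) (su sv : C) :
  is_series_C u su -> is_series_C v sv ->
  (forall n, Cmod (u n) <= K * (1 / 2) ^ n) -> (forall n, Cmod (v n) <= L * (1 / 2) ^ n) ->
  is_series_C (fun n => sum_C (fun k => u k * v (n - k)%nat)%C n) (su * sv)%C.
Proof.
  intros Hu Hv hu hv.
  assert (X : forall (f : C -> R) (w : nat -> C) M, (forall z, Rabs (f z) <= Cmod z) ->
    (forall n, Cmod (w n) <= M * (1 / 2) ^ n) -> ex_series (fun n => Rabs (f (w n)))).
  { intros f w M hf hw.
    apply (ex_series_le (V := R_CompleteNormedModule) _ (fun n => M * (1 / 2) ^ n)).
    - intros n. change (Rabs (Rabs (f (w n))) <= M * (1 / 2) ^ n). rewrite Rabs_Rabsolu.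
      eapply Rle_trans; [apply hf|apply hw].
    - eexists; apply is_series_half. }
  assert (ru := is_series_C_Re _ _ Hu). assert (iu := is_series_C_Im _ _ Hu).
  assert (rv := is_series_C_Re _ _ Hv). assert (iv := is_series_C_Im _ _ Hv).
  assert (aru := X _ u K re_le_Cmod hu). assert (aiu := X _ u K im_le_Cmod hu).
  assert (arv := X _ v L re_le_Cmod hv). assert (aiv := X _ v L im_le_Cmod hv).
  assert (s1 := is_series_mult _ _ _ _ ru rv aru arv).
  assert (s2 := is_series_mult _ _ _ _ iu iv aiu aiv).
  assert (s3 := is_series_mult _ _ _ _ ru iv aru aiv).
  assert (s4 := is_series_mult _ _ _ _ iu rv aiu arv).
  apply is_series_C_pair.
  - apply is_series_ext with (2 := is_series_minus _ _ _ _ s1 s2).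
    intros n. rewrite Re_sum, !sum_f_R0_sum_n.
    enough (Y : forall w m, sum_n (fun k => Re (u k) * Re (w k)) m -
      sum_n (fun k => Im (u k) * Im (w k)) m = sum_n (fun k => Re (u k * w k)) m)
      by exact (Y (fun k => v (n - k)%nat) n).
    intros w m.
    induction m as [|m IH]; [rewrite !sum_n_0; simpl; unfold Re, Im; ring|].
    rewrite !sum_n_S, <- IH. simpl; unfold Re, Im; ring.
  - apply is_series_ext with (2 := is_series_plus _ _ _ _ s3 s4).
    intros n. rewrite Im_sum, !sum_f_R0_sum_n.
    enough (Y : forall w m, sum_n (fun k => Re (u k) * Im (w k)) m +
      sum_n (fun k => Im (u k) * Re (w k)) m = sum_n (fun k => Im (u k * w k)) m)
      by exact (Y (fun k => v (n - k)%nat) n).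
    intros w m.
    induction m as [|m IH]; [rewrite !sum_n_0; simpl; unfold Re, Im; ring|].
    rewrite !sum_n_S, <- IH. simpl; unfold Re, Im; ring.
Qed.

Lemma fps_mul_sum (u v : nat -> C) (n : nat) :
  fps_mul u v n = sum_C (fun k => u k * v (n - k)%nat)%C n.
Proof. reflexivity. Qed.

Lemma sum_C_ext (u v : nat -> C) (n : nat) :
  (forall k, (k <= n)%nat -> u k = v k) -> sum_C u n = sum_C v n.
Proof. apply (sum_n_ext_loc (G := C_NormedModule)). Qed.

Lemma sum_C_scal (c : C) (u : nat -> C) (n : nat) :
  sum_C (fun k => c * u k)%C n = (c * sum_C u n)%C.
Proof.
  induction n as [|n IH]; [now rewrite !sum_C_O|]. rewrite !sum_C_S, IH. Cring.
Qed.

Lemma has_ps_mult (F G : C -> C) (l m : nat -> C) : has_ps F l -> has_ps G m ->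
  has_ps (fun t => F t * G t)%C (fps_mul l m).
Proof.
  intros H H'.
  destruct (has_ps_bound _ _ H) as [R [K [hR [hK h]]]].
  destruct (has_ps_bound _ _ H') as [R' [K' [hR' [hK' h']]]].
  assert (hr : 0 < / (2 * R)) by (apply Rinv_0_lt_compat; lra).
  assert (hr' : 0 < / (2 * R')) by (apply Rinv_0_lt_compat; lra).
  eapply near0_imp; [|apply (near0_and _ _ (near0_and _ _ H H')
    (near0_and _ _ (near0_lt _ hr) (near0_lt _ hr')))].
  intros t [[h1 h2] [h3 h4]]. simpl in h3, h4.
  eapply is_series_C_ext; [|apply (is_series_C_mult _ _ K K' _ _ h1 h2)].
  - intros n. simpl. rewrite fps_mul_sum, Cmult_comm, <- sum_C_scal. apply sum_C_ext.
    intros k hk. replace (t ^ n)%C with (t ^ k * t ^ (n - k))%C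
      by (rewrite <- Cpow_add_r; f_equal; lia). ring.
  - apply geom_half with R; trivial; lra.
  - apply geom_half with R'; trivial; lra.
Qed.

Definition const_coef (c : C) (n : nat) : C := match n with O => c | S _ => RtoC 0 end.

Lemma has_ps_const (c : C) : has_ps (fun _ => c) (const_coef c).
Proof.
  exists 1. split; [lra|]. intros t _.
  assert (Z : is_series_C (fun n => const_coef c (S n) * t ^ S n)%C (RtoC 0)).
  { destruct (is_series_C_geom (fun n => const_coef c (S n) * t ^ S n)%C 0) as [s [hs hb]].
    { intros n. simpl. rewrite Cmult_0_l, Cmod_0. lra. }
    replace (RtoC 0) with s; [exact hs|]. apply Cmod_eq_0.
    generalize (Cmod_ge_0 s). lra. }
  apply (is_series_C_split (fun n => const_coef c n * t ^ n)%C) in Z. simpl in Z.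
  now replace (c * 1 + 0)%C with c in Z by ring.
Qed.

(** The second-order Taylor remainder of t^(n+1), bounded by (n+1)^2 M^(n-1) times the square of the
    increment. The factor [M * M] stands on the left to keep n - 1 out of the exponent. *)
Lemma pow_taylor_bound (M : R) (t k : C) (n : nat) : 0 < M ->
  Cmod t <= M -> Cmod (t + k) <= M ->
  M * M * Cmod ((t + k) ^ S n - t ^ S n - INR (S n) * t ^ n * k)
    <= (INR (S n) * INR (S n)) * M ^ S n * (Cmod k * Cmod k).
Proof.
  intros hM ht hk. assert (hk0 := Cmod_ge_0 k).
  assert (hkk : 0 <= Cmod k * Cmod k) by now apply Rmult_le_pos.
  induction n as [|n IH].
  - replace (_ - _)%C with (RtoC 0) by (simpl; ring). rewrite Cmod_0, Rmult_0_r.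
    simpl. rewrite !Rmult_1_r, Rmult_1_l. apply Rmult_le_pos; lra.
  - set (T := ((t + k) ^ S n - t ^ S n - INR (S n) * t ^ n * k)%C) in *.
    replace ((t + k) ^ S (S n) - t ^ S (S n) - INR (S (S n)) * t ^ S n * k)%C
      with ((t + k) * T + INR (S n) * t ^ n * (k * k))%C
      by (unfold T; rewrite !(Cpow_S _ (S n)), !(S_INR (S n)), !RtoC_plus, (Cpow_S t n); ring).
    eapply Rle_trans; [apply Rmult_le_compat_l; [nra|apply Cmod_triangle]|].
    rewrite !Cmod_mult, Cmod_pow, (Cmod_R_pos (INR (S n))) by apply pos_INR.
    assert (hn : 0 <= INR n) by apply pos_INR.
    assert (a1 : M * M * (Cmod (t + k) * Cmod T)
      <= M * (INR (S n) * INR (S n) * M ^ S n * (Cmod k * Cmod k))).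
    { replace (M * M * (Cmod (t + k) * Cmod T)) with (Cmod (t + k) * (M * M * Cmod T)) by ring.
      apply Rmult_le_compat; trivial; [apply Cmod_ge_0|].
      apply Rmult_le_pos; [nra|apply Cmod_ge_0]. }
    assert (a2 : M * M * (INR (S n) * Cmod t ^ n * (Cmod k * Cmod k))
      <= INR (S n) * M ^ S (S n) * (Cmod k * Cmod k)).
    { replace (INR (S n) * M ^ S (S n) * (Cmod k * Cmod k))
        with (M * M * (INR (S n) * M ^ n * (Cmod k * Cmod k))) by (simpl; ring).
      apply Rmult_le_compat_l; [nra|]. apply Rmult_le_compat_r; trivial.
      apply Rmult_le_compat_l; [apply pos_INR|]. apply pow_incr.
      split; [apply Cmod_ge_0|trivial]. }
    rewrite Rmult_plus_distr_l.
    eapply Rle_trans; [apply Rplus_le_compat; [exact a1|exact a2]|].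
    rewrite !S_INR. simpl pow.
    assert (hp : 0 <= M ^ n * M * M * (Cmod k * Cmod k)).
    { repeat apply Rmult_le_pos; trivial; try lra. now apply pow_le, Rlt_le. }
    match goal with |- ?a <= ?b => assert (0 <= b - a) end; [|lra].
    match goal with |- 0 <= ?b =>
      replace b with ((INR n + 2) * (M ^ n * M * M * (Cmod k * Cmod k))) by ring end.
    apply Rmult_le_pos; lra.
Qed.

Lemma INR_le_pow2 (n : nat) : INR n <= 2 ^ n.
Proof.
  induction n as [|n IH]; [simpl; lra|]. rewrite S_INR. simpl.
  assert (1 <= 2 ^ n) by (apply pow_R1_Rle; lra). lra.
Qed.

Definition deriv_coef (l : nat -> C) (n : nat) : C := (INR (S n) * l (S n))%C.

(** Termwise differentiation: the remainders of [pow_taylor_bound] are summed against the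
    coefficients and give one remainder that is quadratic in the increment. *)
Lemma has_ps_deriv (F : C -> C) (l : nat -> C) : has_ps F l ->
  has_ps (cps (deriv_coef l)) (deriv_coef l) /\
  near0 (fun t => Cdiff F t (cps (deriv_coef l) t)).
Proof.
  intros H. destruct (has_ps_bound _ _ H) as [R [K [hR [hK h]]]].
  assert (H1 : has_ps (cps (deriv_coef l)) (deriv_coef l)).
  { apply (geom_has_ps _ (2 * R) (K * (2 * R))); [lra|]. intros n. unfold deriv_coef.
    rewrite Cmod_mult, Cmod_R_pos by apply pos_INR.
    replace (K * (2 * R) * (2 * R) ^ n) with (2 ^ S n * (K * R ^ S n))
      by (rewrite Rpow_mult_distr; simpl; ring).
    apply Rmult_le_compat; [apply pos_INR|apply Cmod_ge_0|apply INR_le_pow2|apply h]. }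
  split; trivial.
  destruct H as [e [he H]]. destruct H1 as [e1 [he1 H1]].
  (* The squares (n+1)^2 are bounded by 4^(n+1), so the terms of the remainder are powers of 4 M R;
     the 8 makes this ratio at most 1/2. *)
  set (M := Rmin (e / 2) (/ (8 * R))).
  assert (hM : 0 < M) by (apply Rmin_pos; [lra|apply Rinv_0_lt_compat; lra]).
  assert (hM1 : M <= e / 2) by apply Rmin_l.
  assert (hM2 : M * R <= / 8).
  { replace (/ 8) with (/ (8 * R) * R) by (field; lra).
    apply Rmult_le_compat_r; [lra|apply Rmin_r]. }
  exists (Rmin M e1). split; [now apply Rmin_pos|]. intros t ht.
  assert (ht1 := Rlt_le_trans _ _ _ ht (Rmin_l _ _)).
  assert (ht2 := Rlt_le_trans _ _ _ ht (Rmin_r _ _)).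
  set (A := 2 * K / (M * M)).
  assert (hA : 0 <= A).
  { unfold A. apply Rdiv_le_0_compat; [lra|]. nra. }
  assert (Q : forall k, Cmod (t + k) < M ->
    Cmod (F (t + k) - F t - cps (deriv_coef l) t * k)%C <= A * (Cmod k * Cmod k)).
  { intros k hk.
    assert (s1 := H (t + k)%C ltac:(lra)). assert (s2 := H t ltac:(lra)).
    assert (s3 := H1 t ht2). simpl in s1, s2, s3.
    (* The derivative series is reindexed, with a zero term in front, so that the three series can
       be subtracted term by term. *)
    assert (s3' : is_series_C (fun n => l n * (INR n * match n with O => RtoC 0 | S n' => t ^ n' end) * k)%C
      (cps (deriv_coef l) t * k)%C).
    { replace (cps (deriv_coef l) t * k)%C
        with (l 0%nat * (INR 0 * 0) * k + k * cps (deriv_coef l) t)%C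
        by (simpl; ring).
      apply (is_series_C_split (fun n => l n * (INR n * match n with O => RtoC 0 | S n' => t ^ n' end) * k)%C).
      eapply is_series_C_ext; [|apply (is_series_C_scal k _ _ s3)].
      intros n. unfold deriv_coef. ring. }
    assert (s4 := is_series_C_plus _ _ _ _ s1 (is_series_C_scal (RtoC (-1)) _ _
      (is_series_C_plus _ _ _ _ s2 s3'))).
    replace (F (t + k) - F t - cps (deriv_coef l) t * k)%C
      with (F (t + k) + -1 * (F t + cps (deriv_coef l) t * k))%C by ring.
    replace (A * (Cmod k * Cmod k)) with (2 * (K / (M * M) * (Cmod k * Cmod k)))
      by (unfold A; field; lra).
    eapply is_series_C_norm; [exact s4|apply is_series_half|].
    assert (hkk : 0 <= Cmod k * Cmod k) by (apply Rmult_le_pos; apply Cmod_ge_0).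
    assert (hc : 0 <= K / (M * M) * (Cmod k * Cmod k)).
    { apply Rmult_le_pos; trivial. apply Rdiv_le_0_compat; trivial. nra. }
    intros [|n].
    - replace (_ + _)%C with (RtoC 0) by (simpl; ring). rewrite Cmod_0. simpl. lra.
    - replace (_ + _)%C with
        (l (S n) * ((t + k) ^ S n - t ^ S n - INR (S n) * t ^ n * k))%C by ring.
      rewrite Cmod_mult.
      assert (b := pow_taylor_bound M t k n hM ltac:(lra) ltac:(lra)).
      assert (hl := h (S n)).
      set (T := Cmod (_ - _)%C) in *.
      assert (hT : T <= 4 ^ S n * M ^ S n * (Cmod k * Cmod k) / (M * M)).
      { apply Rmult_le_reg_l with (M * M); [nra|].
        eapply Rle_trans; [exact b|].
        replace (M * M * (4 ^ S n * M ^ S n * (Cmod k * Cmod k) / (M * M)))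
          with (4 ^ S n * M ^ S n * (Cmod k * Cmod k)) by (field; lra).
        apply Rmult_le_compat_r; trivial. apply Rmult_le_compat_r; [apply pow_le; lra|].
        replace 4 with (2 * 2) by ring. rewrite Rpow_mult_distr.
        apply Rmult_le_compat; try apply pos_INR; apply INR_le_pow2. }
      eapply Rle_trans; [apply Rmult_le_compat; [apply Cmod_ge_0|apply Cmod_ge_0|exact hl|exact hT]|].
      replace (K * R ^ S n * (4 ^ S n * M ^ S n * (Cmod k * Cmod k) / (M * M)))
        with (K / (M * M) * (Cmod k * Cmod k) * ((4 * (M * R)) ^ S n))
        by (rewrite !Rpow_mult_distr; field; lra).
      apply Rmult_le_compat_l; trivial. apply pow_incr. split; [|lra].
      repeat apply Rmult_le_pos; lra. }
  intros eps heps. exists (Rmin (M - Cmod t) (eps / (A + 1))). split.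
  { apply Rmin_pos; [lra|]. apply Rdiv_lt_0_compat; lra. }
  intros k hk.
  assert (hk1 := Rlt_le_trans _ _ _ hk (Rmin_l _ _)).
  assert (hk2 := Rlt_le_trans _ _ _ hk (Rmin_r _ _)).
  eapply Rle_trans.
  - apply Q. eapply Rle_lt_trans; [apply Cmod_triangle|]. lra.
  - rewrite <- Rmult_assoc. apply Rmult_le_compat_r; [apply Cmod_ge_0|].
    apply Rle_trans with ((A + 1) * (eps / (A + 1))); [|right; field; lra].
    apply Rmult_le_compat; try lra. apply Cmod_ge_0.
Qed.

(** * Powers of a germ with value 1 at the origin *)

(** Course-of-values recursion: [pre n] already holds the final values up to index [n], and the
    hypothesis says that [Phi n] reads no others. *)
Lemma recursive_sequence (c : C) (Phi : nat -> (nat -> C) -> C) :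
  (forall n u v, (forall k, (k <= n)%nat -> u k = v k) -> Phi n u = Phi n v) ->
  exists e : nat -> C, e 0%nat = c /\ forall n, e (S n) = Phi n e.
Proof.
  intros hPhi.
  set (pre := fix pre (n : nat) : nat -> C :=
    match n with
    | O => fun _ => c
    | S m => fun i => if Nat.leb i m then pre m i else Phi m (pre m)
    end).
  assert (st : forall n k, (k <= n)%nat -> pre n k = pre k k).
  { induction n as [|n IH]; intros k hk; [now replace k with 0%nat by lia|].
    destruct (Nat.eq_dec k (S n)) as [->|hne]; [reflexivity|].
    simpl pre at 1. replace (Nat.leb k n) with true by (symmetry; apply Nat.leb_le; lia).
    apply IH; lia. }
  exists (fun n => pre n n). split; [reflexivity|]. intros n.
  change (pre (S n) (S n)) with (if Nat.leb (S n) n then pre n (S n) else Phi n (pre n)).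
  replace (Nat.leb (S n) n) with false by (symmetry; apply Nat.leb_gt; lia).
  apply hPhi. intros k hk. now apply st.
Qed.

Lemma sum_C_shift (u : nat -> C) (n : nat) :
  sum_C u (S n) = (u 0%nat + sum_C (fun k => u (S k)) n)%C.
Proof.
  induction n as [|n IH]; [now rewrite sum_C_S, !sum_C_O|].
  rewrite sum_C_S, IH, sum_C_S. Cring.
Qed.

Lemma sum_C_plus (u v : nat -> C) (n : nat) :
  sum_C (fun k => u k + v k)%C n = (sum_C u n + sum_C v n)%C.
Proof.
  induction n as [|n IH]; [now rewrite !sum_C_O|]. rewrite !sum_C_S, IH. Cring.
Qed.

(** The factorisation of a difference of powers; it closes the majorant induction in
    [power_coefficients]. *)
Lemma geom_convolution (A R : R) (n : nat) :
  A * sum_n (fun k => R ^ k * (R + A) ^ (n - k)) n = (R + A) ^ S n - R ^ S n.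
Proof.
  induction n as [|n IH]; [rewrite sum_n_0; simpl; ring|].
  rewrite sum_n_S, Nat.sub_diag.
  rewrite (sum_n_ext_loc (G := R_AbelianMonoid)
    _ (fun k => (R + A) * (R ^ k * (R + A) ^ (n - k))) n).
  - rewrite (sum_n_mult_l (K := R_Ring)). unfold mult; simpl mult.
    change (A * ((R + A) * sum_n (fun k => R ^ k * (R + A) ^ (n - k)) n + R ^ S n * (R + A) ^ 0)
      = (R + A) ^ S (S n) - R ^ S (S n)).
    replace (A * ((R + A) * sum_n (fun k => R ^ k * (R + A) ^ (n - k)) n + R ^ S n * (R + A) ^ 0))
      with ((R + A) * (A * sum_n (fun k => R ^ k * (R + A) ^ (n - k)) n) + A * R ^ S n)
      by (simpl; ring).
    rewrite IH. simpl; ring.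
  - intros k hk. replace (S n - k)%nat with (S (n - k)) by lia. simpl; ring.
Qed.

Section PrincipalPower.

Variables (F : C -> C) (w : nat -> C) (sigma : C).
Hypothesis (hF : has_ps F w) (hw0 : w 0%nat = 1).

(** Comparing the coefficients of t^n in F f' = sigma F' f gives the recursion (n+1) e_(n+1) = sum
    over k of (sigma (k+1) - (n-k)) w_(k+1) e_(n-k), which determines the coefficients of the power
    from e_0 = 1. *)
Lemma power_coefficients : exists e : nat -> C,
  e 0%nat = 1 /\ e 1%nat = (sigma * w 1%nat)%C /\
  (exists R K, 0 < R /\ forall n, Cmod (e n) <= K * R ^ n) /\
  (forall n, fps_mul w (deriv_coef e) n = fps_mul (fun k => sigma * deriv_coef w k)%C e n).
Proof.
  destruct (recursive_sequence 1 (fun n e => / INR (S n) *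
    sum_C (fun k => (sigma * INR (S k) - INR (n - k)) * w (S k) * e (n - k)%nat) n)%C)
    as [e [e0 he]].
  { intros n u v h. f_equal. apply sum_C_ext. intros k hk. now rewrite h by lia. }
  assert (hS : forall n, RtoC (INR (S n)) <> 0).
  { intros n q. apply RtoC_inj in q. revert q. apply not_0_INR. lia. }
  exists e. split; [exact e0|]. split; [|split].
  - rewrite he, sum_C_O. simpl (0 - 0)%nat. rewrite e0. simpl. field.
  - destruct (has_ps_bound _ _ hF) as [R [K [hR [hK h]]]].
    (* The bracket in the recursion is at most (n+1) (Cmod sigma + 1), and w_(k+1) is at most K
       R^(k+1). With this [A] the sequence (R + A)^n is a majorant, by [geom_convolution]. *)
    set (A := (Cmod sigma + 1) * (K * R)).
    assert (hA : 0 <= A).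
    { unfold A. apply Rmult_le_pos; [generalize (Cmod_ge_0 sigma); lra|].
      apply Rmult_le_pos; lra. }
    exists (R + A), 1. split; [lra|].
    enough (X : forall n k, (k <= n)%nat -> Cmod (e k) <= (R + A) ^ k)
      by (intros n; rewrite Rmult_1_l; now apply (X n)).
    induction n as [|n IH]; intros k hk.
    + replace k with 0%nat by lia. rewrite e0, Cmod_1. simpl; lra.
    + destruct (Nat.eq_dec k (S n)) as [->|hne]; [|apply IH; lia].
      rewrite he, Cmod_mult, Cmod_inv, Cmod_R_pos by (trivial; apply pos_INR).
      assert (hn : 0 < INR (S n)) by (apply lt_0_INR; lia).
      apply Rmult_le_reg_l with (INR (S n)); trivial.
      rewrite <- Rmult_assoc, Rinv_r, Rmult_1_l by lra.
      apply Rle_trans with (sum_n (fun k => INR (S n) * (A * (R ^ k * (R + A) ^ (n - k)))) n).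
      * apply Cmod_sum_le. intros j hj. rewrite !Cmod_mult.
        assert (b1 : Cmod (sigma * INR (S j) - INR (n - j)) <= INR (S n) * (Cmod sigma + 1)).
        { eapply Rle_trans; [apply Cmod_triangle_minus|].
          rewrite Cmod_mult, !Cmod_R_pos by apply pos_INR.
          assert (INR (S j) <= INR (S n)) by (apply le_INR; lia).
          assert (INR (n - j) <= INR (S n)) by (apply le_INR; lia).
          assert (c := Cmod_ge_0 sigma).
          assert (Cmod sigma * INR (S j) <= Cmod sigma * INR (S n))
            by now apply Rmult_le_compat_l.
          lra. }
        assert (b2 := h (S j)). assert (b3 := IH (n - j)%nat ltac:(lia)).
        replace (INR (S n) * (A * (R ^ j * (R + A) ^ (n - j))))
          with (INR (S n) * (Cmod sigma + 1) * (K * R ^ S j) * (R + A) ^ (n - j))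
          by (unfold A; simpl; ring).
        apply Rmult_le_compat; trivial; try apply Cmod_ge_0.
        -- apply Rmult_le_pos; apply Cmod_ge_0.
        -- apply Rmult_le_compat; trivial; apply Cmod_ge_0.
      * rewrite (sum_n_mult_l (K := R_Ring) (INR (S n))), (sum_n_mult_l (K := R_Ring) A).
        change (INR (S n) * (A * sum_n (fun k => R ^ k * (R + A) ^ (n - k)) n)
          <= INR (S n) * (R + A) ^ S n).
        apply Rmult_le_compat_l; [lra|]. rewrite geom_convolution.
        assert (0 <= R ^ S n) by (apply pow_le; lra). lra.
  - intros n. rewrite !fps_mul_sum.
    assert (X : (INR (S n) * e (S n))%C =
      sum_C (fun k => (sigma * INR (S k) - INR (n - k)) * w (S k) * e (n - k)%nat)%C n).
    { rewrite he. field. apply hS. }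
    transitivity (INR (S n) * e (S n)
      + sum_C (fun k => INR (n - k) * w (S k) * e (n - k)%nat)%C n)%C.
    + destruct n as [|n].
      * rewrite !sum_C_O. unfold deriv_coef. rewrite hw0. simpl. ring.
      * rewrite sum_C_shift. unfold deriv_coef at 1. rewrite hw0, Nat.sub_0_r.
        rewrite (sum_C_S (fun k => INR (S n - k) * w (S k) * e (S n - k)%nat)%C).
        rewrite Nat.sub_diag. unfold deriv_coef.
        rewrite (sum_C_ext _ (fun k => INR (S n - k) * w (S k) * e (S n - k)%nat)%C n).
        -- simpl (INR 0). Cring.
        -- intros k hk. replace (S n - k)%nat with (S (n - k)) by lia.
           replace (S n - S k)%nat with (n - k)%nat by lia. ring.
    + rewrite X, <- sum_C_plus. apply sum_C_ext. intros k hk. unfold deriv_coef. ring.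
Qed.

(* Along a ray, the series [f] with [F f' = sigma F' f] and [F ^ sigma] have a constant
   quotient. *)
Lemma principal_pow_has_ps : exists e : nat -> C,
  has_ps (fun t => principal_pow (F t) sigma) e /\
  e 0%nat = 1 /\ e 1%nat = (sigma * w 1%nat)%C /\
  near0 (fun t => 0 < Re (F t)) /\
  near0 (fun t => F t * cps (deriv_coef e) t
    = sigma * cps (deriv_coef w) t * principal_pow (F t) sigma)%C.
Proof.
  destruct power_coefficients as [e [e0 [e1 [[Q [K [hQ hb]]] hode]]]].
  assert (He := geom_has_ps e Q K hQ hb).
  destruct (has_ps_deriv _ _ He) as [He' De]. destruct (has_ps_deriv _ _ hF) as [HF' DF].
  assert (ode : near0 (fun t => F t * cps (deriv_coef e) t
    = sigma * cps (deriv_coef w) t * cps e t)%C).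
  { eapply near0_imp; [|apply (near0_and _ _ (has_ps_mult _ _ _ _ hF He')
      (has_ps_mult _ _ _ _ (has_ps_scal sigma _ _ HF') He))].
    intros t [h1 h2]. eapply is_series_C_unique; [exact h1|].
    eapply is_series_C_ext; [|exact h2]. intros n. simpl. now rewrite hode. }
  assert (hRe : near0 (fun t => 0 < Re (F t))).
  { destruct (has_ps_unshift _ _ hF) as [H1 E].
    destruct (has_ps_bounded _ _ H1) as [B [hB0 hB]].
    assert (hB1 : 0 < / (B + 1)) by (apply Rinv_0_lt_compat; lra).
    eapply near0_imp; [|apply (near0_and _ _ (near0_and _ _ E hB) (near0_lt _ hB1))].
    intros t [[a1 a2] a3]. simpl in a1, a2, a3. rewrite a1, hw0.
    set (y := cps _ t) in *.
    assert (a4 : Cmod (t * y) < 1).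
    { rewrite Cmod_mult. apply Rle_lt_trans with (Cmod t * (B + 1)).
      - apply Rmult_le_compat_l; [apply Cmod_ge_0|]. lra.
      - apply Rlt_le_trans with (/ (B + 1) * (B + 1)); [|right; field; lra].
        apply Rmult_lt_compat_r; lra. }
    assert (a5 := re_le_Cmod (t * y)). apply Rabs_le_between in a5.
    change (0 < 1 + Re (t * y)). lra. }
  assert (hpow : near0 (fun t => cps e t = principal_pow (F t) sigma)).
  { destruct (near0_and _ _ (near0_and _ _ De DF) (near0_and _ _ hRe ode))
      as [eps [heps X]].
    exists eps. split; trivial. intros t ht.
    assert (hst : forall s : R, 0 <= s <= 1 -> Cmod (0 + s * t) < eps).
    { intros s hs. rewrite Cplus_0_l, Cmod_mult, Cmod_R_pos by lra.
      apply Rle_lt_trans with (2 := ht). generalize (Cmod_ge_0 t). nra. }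
    generalize (curve_mean_value
      (fun s => cps e (0 + s * t) * Cexp (- sigma * plog (F (0 + s * t))))%C
      (fun _ => RtoC 0) (fun _ => 0) (fun _ => 0) 0 1).
    intros E. cbv beta in E.
    replace (0 + 1 * t)%C with t in E by ring.
    replace (0 + 0 * t)%C with (RtoC 0) in E by ring.
    rewrite (has_ps_at_0 _ _ He), (has_ps_at_0 _ _ hF), e0, hw0 in E.
    assert (p1 : plog 1 = RtoC 0).
    { unfold plog. rewrite Cmod_1, ln_1. simpl. rewrite Rdiv_0_l, atan_0. reflexivity. }
    rewrite p1 in E.
    replace (- sigma * 0)%C with (RtoC 0) in E by ring. rewrite Cexp_0 in E.
    assert (E0 : (cps e t * Cexp (- sigma * plog (F t)))%C = 1).
    { match type of E with _ -> _ -> _ -> _ -> Cmod ?z <= _ =>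
        assert (Z : z = RtoC 0) end.
      - apply Cmod_eq_0. apply Rle_antisym; [|apply Cmod_ge_0].
        eapply Rle_trans; [apply E; clear E|lra].
        + lra.
        + intros s hs. destruct (X _ (hst s hs)) as [[x1 x2] [x3 x4]].
          simpl in x1, x2, x3, x4.
          eapply is_deriv_curve_eq.
          * apply is_deriv_curve_mult.
            -- eapply (Cdiff_curve (cps e) (fun s : R => (0 + s * t)%C)); [exact x1|].
               apply is_deriv_curve_line.
            -- eapply is_deriv_curve_Cexp, is_deriv_curve_scal, is_deriv_curve_plog; [|exact x3].
               eapply (Cdiff_curve F (fun s : R => (0 + s * t)%C)); [exact x2|].
               apply is_deriv_curve_line.
          * simpl. set (tt := (0 + s * t)%C) in *.
            assert (hn := Re_gt_0_neq_0 _ x3).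
            replace (cps (deriv_coef e) tt) with
              (sigma * cps (deriv_coef w) tt * cps e tt / F tt)%C
              by (rewrite <- x4; field; trivial).
            field. trivial.
        + intros s _. apply (is_derive_const (V := R_NormedModule)).
        + intros s _. rewrite Cmod_0. lra.
      - replace (cps e t * Cexp (- sigma * plog (F t)))%C with
          ((cps e t * Cexp (- sigma * plog (F t)) - 1 * 1) + 1)%C by ring.
        rewrite Z. ring. }
    rewrite principal_pow_plog.
    replace (Cexp (sigma * plog (F t))) with (/ Cexp (- sigma * plog (F t)))%C.
    - rewrite <- (Cmult_1_l (/ _)), <- E0. field. apply Cexp_neq_0.
    - rewrite <- Cexp_opp. f_equal. ring. }
  exists e. split; [|split; [|split; [|split]]]; trivial.
  - exact (has_ps_ext _ _ _ He hpow).
  - eapply near0_imp; [|apply (near0_and _ _ ode hpow)]. intros t [o <-]. exact o.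
Qed.

End PrincipalPower.

(** * Single Taylor coefficients of germs *)

(** A relation that leaves the other coefficients existential, so that sums, multiples and shifts of
    germs can be followed at one index. *)
Definition is_coef (F : C -> C) (n : nat) (c : C) : Prop :=
  exists l, has_ps F l /\ l n = c.

Lemma is_coef_unique (F G : C -> C) (n : nat) (c c' : C) :
  is_coef F n c -> is_coef G n c' -> near0 (fun t => t <> 0 -> F t = G t) -> c = c'.
Proof.
  intros [l [H <-]] [l' [H' <-]] E. exact (has_ps_unique _ _ _ _ H H' E n).
Qed.

Lemma is_coef_ext (F G : C -> C) (n : nat) (c : C) :
  is_coef F n c -> near0 (fun t => F t = G t) -> is_coef G n c.
Proof. intros [l [H e]] E. exists l. split; trivial. now apply (has_ps_ext F). Qed.

Lemma is_coef_plus (F G : C -> C) (n : nat) (c d : C) :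
  is_coef F n c -> is_coef G n d -> is_coef (fun t => F t + G t)%C n (c + d)%C.
Proof.
  intros [l [H <-]] [m [H' <-]]. eexists. split; [apply (has_ps_plus _ _ _ _ H H')|].
  reflexivity.
Qed.

Lemma is_coef_scal (a : C) (F : C -> C) (n : nat) (c : C) :
  is_coef F n c -> is_coef (fun t => a * F t)%C n (a * c)%C.
Proof.
  intros [l [H <-]]. eexists. split; [apply (has_ps_scal a _ _ H)|]. reflexivity.
Qed.

Lemma is_coef_shift (F : C -> C) (m n : nat) (c : C) :
  is_coef F n c -> is_coef (fun t => t ^ m * F t)%C (m + n) c.
Proof.
  intros H. induction m as [|m [l [H' <-]]].
  - apply (is_coef_ext F); trivial. exists 1. split; [lra|]. intros t _. simpl. ring.
  - exists (shift_coef l). split; [|reflexivity].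
    eapply has_ps_ext; [apply (has_ps_shift _ _ H')|].
    exists 1. split; [lra|]. intros t _. simpl. ring.
Qed.

Lemma is_coef_shift_eq (F : C -> C) (m n k : nat) (c : C) :
  k = (m + n)%nat -> is_coef F n c -> is_coef (fun t => t ^ m * F t)%C k c.
Proof. intros ->. apply is_coef_shift. Qed.

Lemma is_coef_shift_low (F : C -> C) (l : nat -> C) (m j : nat) : has_ps F l -> (j < m)%nat ->
  is_coef (fun t => t ^ m * F t)%C j 0.
Proof.
  intros H. revert j. induction m as [|m IH]; intros j hj; [lia|].
  destruct j as [|j].
  - destruct (is_coef_shift F m 0 (l 0%nat)) as [l' [H' _]]; [now exists l|].
    exists (shift_coef l'). split; [|reflexivity].
    eapply has_ps_ext; [apply (has_ps_shift _ _ H')|].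
    exists 1. split; [lra|]. intros t _. simpl. ring.
  - destruct (IH j ltac:(lia)) as [l' [H' e]].
    exists (shift_coef l'). split; [|exact e].
    eapply has_ps_ext; [apply (has_ps_shift _ _ H')|].
    exists 1. split; [lra|]. intros t _. simpl. ring.
Qed.

Lemma partial_sum_S (u : nat -> C) (N : nat) :
  partial_sum u (S N) = (partial_sum u N + u N)%C.
Proof.
  destruct N as [|N]; simpl.
  - change (sum_C u 0 = 0 + u 0%nat)%C. rewrite sum_C_O. Cring.
  - change (sum_C u (S N) = sum_C u N + u (S N))%C. apply sum_C_S.
Qed.

Lemma is_coef_partial_sum (F : nat -> C -> C) (n N : nat) :
  (forall j, (j < N)%nat -> is_coef (F j) n 0) ->
  is_coef (fun t => partial_sum (fun j => F j t) N) n 0.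
Proof.
  induction N as [|N IH]; intros h.
  - eexists. split; [apply (has_ps_const 0)|]. now destruct n.
  - replace (RtoC 0) with (0 + 0)%C by ring.
    eapply is_coef_ext; [apply (is_coef_plus _ _ _ _ _ (IH (fun j hj => h j ltac:(lia)))
      (h N ltac:(lia)))|].
    exists 1. split; [lra|]. intros t _. now rewrite partial_sum_S.
Qed.

Lemma near0_intro (P : C -> Prop) : (forall t, P t) -> near0 P.
Proof. intros h. exists 1. split; [lra|auto]. Qed.

Lemma principal_pow_plus (w u v : C) :
  principal_pow w (u + v) = (principal_pow w u * principal_pow w v)%C.
Proof. apply polar_pow_plus. Qed.

Lemma principal_pow_neq_0 (w u : C) : principal_pow w u <> 0.
Proof. apply Cexp_neq_0. Qed.

Lemma principal_pow_m1 (w : C) : 0 < Re w -> principal_pow w (-1) = (/ w)%C.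
Proof.
  intros h. rewrite principal_pow_plog.
  replace (-1 * plog w)%C with (- plog w)%C by ring.
  now rewrite Cexp_opp, Cexp_plog.
Qed.

Lemma principal_pow_nat (w u : C) (n : nat) :
  principal_pow w (INR n * u) = (principal_pow w u ^ n)%C.
Proof.
  rewrite !principal_pow_plog, <- Cmult_assoc. apply Cexp_nat.
Qed.

Lemma fps_mul_0 (u v : nat -> C) : fps_mul u v 0 = (u 0%nat * v 0%nat)%C.
Proof. rewrite fps_mul_sum. apply sum_C_O. Qed.

(** * Inversion of the local parameter *)

(* [W t = omega t (F t) ^ (1 / mu)] is the local parameter and [t W' / W] its logarithmic
   derivative. *)
Section Lagrange.

Variables (F : C -> C) (w : nat -> C) (mu : R) (omega : C).
Hypotheses (hF : has_ps F w) (hw0 : w 0%nat = 1) (hmu : 0 < mu).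

Definition log_deriv (t : C) : C := (1 + / mu * (t * cps (deriv_coef w) t) / F t)%C.

Definition parameter (t : C) : C := (omega * (t * principal_pow (F t) (/ mu)))%C.

Lemma Re_F_near : near0 (fun t => 0 < Re (F t)).
Proof. now destruct (principal_pow_has_ps F w 0 hF hw0) as [e [_ [_ [_ [h _]]]]]. Qed.

Lemma log_deriv_has_ps : exists d, has_ps log_deriv d /\ d 0%nat = 1 /\
  d 1%nat = (/ mu * w 1%nat)%C.
Proof.
  (* Exponent -1 provides the power series of [1 / F]. *)
  destruct (principal_pow_has_ps F w (-1) hF hw0) as [e [He [e0 [_ [h _]]]]].
  destruct (has_ps_deriv _ _ hF) as [HF' _].
  eexists. split.
  - eapply has_ps_ext.
    + apply has_ps_plus; [apply (has_ps_const 1)|].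
      apply has_ps_scal with (c := (/ mu)%C).
      apply has_ps_mult; [apply has_ps_shift, HF'|exact He].
    + eapply near0_imp; [|exact h]. intros t ht. simpl in ht |- *. unfold log_deriv.
      rewrite principal_pow_m1 by trivial. unfold Cdiv. now rewrite !Cmult_assoc.
  - split.
    + simpl. rewrite fps_mul_0. simpl. ring.
    + simpl const_coef. rewrite fps_mul_sum, sum_C_S, sum_C_O.
      simpl (1 - 0)%nat. simpl (1 - 1)%nat. rewrite e0. unfold shift_coef, deriv_coef.
      simpl INR. ring.
Qed.

(* [t ^ (-k-1) t W' W ^ (-k)] is the derivative of [-(1 / k) W ^ (-k)]: no residue. *)
Lemma log_deriv_pow_coef (k : nat) :
  is_coef (fun t => log_deriv t * principal_pow (F t) (- (INR (S k) * / mu)))%C (S k) 0.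
Proof.
  destruct (principal_pow_has_ps F w (- (INR (S k) * / mu)) hF hw0)
    as [e [He [e0 [_ [h ode]]]]].
  destruct (has_ps_deriv _ _ He) as [He' De].
  assert (hmuC : RtoC mu <> 0) by (intros q; apply RtoC_inj in q; lra).
  assert (hk : RtoC (INR (S k)) <> 0).
  { intros q. apply RtoC_inj in q. revert q. apply not_0_INR. lia. }
  eexists. split.
  - eapply has_ps_ext.
    + apply has_ps_plus; [exact He|].
      apply has_ps_scal with (c := (- / INR (S k))%C). apply has_ps_shift, He'.
    + eapply near0_imp; [|apply (near0_and _ _ h ode)]. intros t [ht o]. cbv beta in ht, o.
      assert (hn := Re_gt_0_neq_0 _ ht). unfold log_deriv.
      replace (cps (deriv_coef e) t) with
        (- (INR (S k) * / mu) * cps (deriv_coef w) t *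
          principal_pow (F t) (- (INR (S k) * / mu)) / F t)%C
        by (rewrite <- o; field; trivial).
      cbv beta. set (P := principal_pow _ _). set (S1 := RtoC (INR (S k))) in *.
      field. repeat split; trivial.
  - unfold shift_coef, deriv_coef. field. trivial.
Qed.

Variables (M : C -> C) (m : nat -> C) (B : nat -> C).
Hypothesis hM : has_ps M m.
Hypothesis hB : forall n, is_coef (fun t => M t * principal_pow (F t) (- (INR n * / mu)))%C n
  (B n * omega ^ n)%C.

(** [hB] says that [B n] is the constant term of M W^(-n), W being the parameter. Once the terms
    below [N] are subtracted, t^N G remains, and the constant term of t^N G W^(-N) is G(0) /
    omega^N. By [log_deriv_pow_coef] the subtracted terms contribute nothing to it, so G(0) = B_N
    omega^N, and subtracting the N-th term gains one power of t. *)
Lemma Lagrange_step (N : nat) : exists (G : C -> C) (g : nat -> C), has_ps G g /\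
  near0 (fun t => M t - log_deriv t * partial_sum (fun n => B n * parameter t ^ n) N
    = t ^ N * G t)%C.
Proof.
  induction N as [|N [G [g [HG E]]]].
  - exists M, m. split; trivial. apply near0_intro. intros t. simpl. ring.
  - assert (hmuC : RtoC mu <> 0) by (intros q; apply RtoC_inj in q; lra).
    assert (e : (B N * omega ^ N)%C = g 0%nat).
    { destruct (principal_pow_has_ps F w (- (INR N * / mu)) hF hw0)
        as [v [Hv [v0 [_ [h _]]]]].
      apply (is_coef_unique _ (fun t => partial_sum (fun j => (B j * omega ^ j) *
          (t ^ j * (log_deriv t * principal_pow (F t) (- (INR (N - j) * / mu)))))%C N
        + t ^ N * (G t * principal_pow (F t) (- (INR N * / mu))))%C N _ _ (hB N)).
      - replace (g 0%nat) with (0 + g 0%nat)%C by ring. apply is_coef_plus.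
        + apply (is_coef_partial_sum (fun j t => (B j * omega ^ j) *
            (t ^ j * (log_deriv t * principal_pow (F t) (- (INR (N - j) * / mu)))))%C).
          intros j hj.
          replace (RtoC 0) with (B j * omega ^ j * 0)%C by ring. apply is_coef_scal.
          apply is_coef_shift_eq with (S (N - j - 1)); [lia|].
          assert (e : exists k, (N - j)%nat = S k) by (exists (N - j - 1)%nat; lia).
          destruct e as [k ->]. replace (S k - 1)%nat with k by lia.
          apply log_deriv_pow_coef.
        + apply is_coef_shift_eq with 0%nat; [lia|].
          eexists. split; [apply (has_ps_mult _ _ _ _ HG Hv)|].
          rewrite fps_mul_0, v0. ring.
      - eapply near0_imp; [|exact E]. intros t a _. simpl in a |- *.
        replace (t ^ N * (G t * principal_pow (F t) (- (INR N * / mu))))%C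
          with (t ^ N * G t * principal_pow (F t) (- (INR N * / mu)))%C by ring.
        rewrite <- a.
        assert (Z : (principal_pow (F t) (- (INR N * / mu)) * log_deriv t *
          partial_sum (fun n => B n * parameter t ^ n) N)%C =
          partial_sum (fun j => (B j * omega ^ j) *
          (t ^ j * (log_deriv t * principal_pow (F t) (- (INR (N - j) * / mu)))))%C N).
        { assert (X : forall j, (j <= N)%nat ->
            (principal_pow (F t) (- (INR N * / mu)) * parameter t ^ j
              = omega ^ j * t ^ j * principal_pow (F t) (- (INR (N - j) * / mu)))%C).
          { intros j hj. unfold parameter. rewrite !Cpow_mult_l, <- principal_pow_nat.
            replace (- (INR (N - j) * / mu))%C with (- (INR N * / mu) + INR j * / mu)%C
              by (rewrite minus_INR, RtoC_minus by trivial; ring).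
            rewrite principal_pow_plus. ring. }
          assert (Y : forall j, (j <= N)%nat -> (principal_pow (F t) (- (INR N * / mu)) *
            log_deriv t * partial_sum (fun n => B n * parameter t ^ n) j)%C =
            partial_sum (fun j => (B j * omega ^ j) *
            (t ^ j * (log_deriv t * principal_pow (F t) (- (INR (N - j) * / mu)))))%C j).
          { induction j as [|j IH]; intros hj; [simpl; ring|].
            rewrite !partial_sum_S, <- IH by lia.
            replace (B j * omega ^ j * (t ^ j * (log_deriv t *
              principal_pow (F t) (- (INR (N - j) * / mu)))))%C
              with (B j * log_deriv t * (omega ^ j * t ^ j *
                principal_pow (F t) (- (INR (N - j) * / mu))))%C by ring.
            rewrite <- X by lia. ring. }
          now apply Y. }
        rewrite <- Z. ring. }
    destruct (principal_pow_has_ps F w (INR N * / mu) hF hw0) as [v [Hv [v0 [_ [h _]]]]].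
    destruct log_deriv_has_ps as [d [Hd [d0 _]]].
    (* [log_deriv] and the power of [F] both start with 1, so this difference has constant term 0
       and can be divided by [t]. *)
    assert (H1 := has_ps_minus _ _ _ _ HG
      (has_ps_scal (g 0%nat) _ _ (has_ps_mult _ _ _ _ Hd Hv))).
    destruct (has_ps_unshift _ _ H1) as [H2 E2]. cbv beta in E2.
    rewrite fps_mul_0, d0, v0 in E2.
    eexists. eexists. split; [exact H2|].
    eapply near0_imp; [|apply (near0_and _ _ E E2)]. intros t [a a2]. cbv beta in a, a2.
    rewrite partial_sum_S. simpl (t ^ S N)%C.
    set (Q := cps _ t) in *.
    replace (t * t ^ N * Q)%C with (t ^ N * (g 0%nat - g 0%nat * (1 * 1) + t * Q))%C by ring.
    rewrite <- a2, <- e.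
    replace (parameter t ^ N)%C with (omega ^ N * t ^ N * principal_pow (F t) (INR N * / mu))%C
      by (unfold parameter; rewrite !Cpow_mult_l, <- principal_pow_nat; ring).
    replace (t ^ N * (G t - B N * omega ^ N * (log_deriv t * principal_pow (F t) (INR N * / mu))))%C
      with (t ^ N * G t - B N * omega ^ N * t ^ N * (log_deriv t * principal_pow (F t) (INR N * / mu)))%C
      by ring.
    rewrite <- a. ring.
Qed.

Lemma Lagrange_bound (N : nat) : exists K, 0 <= K /\ near0 (fun t =>
  Cmod (M t - log_deriv t * partial_sum (fun n => B n * parameter t ^ n) N)%C
    <= K * Cmod t ^ N).
Proof.
  destruct (Lagrange_step N) as [G [g [HG E]]].
  destruct (has_ps_bounded _ _ HG) as [K [hK0 hK]].
  exists K. split; trivial. eapply near0_imp; [|apply (near0_and _ _ E hK)].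
  intros t [a b]. simpl in a, b. rewrite a, Cmod_mult, Cmod_pow, Rmult_comm.
  apply Rmult_le_compat_r; trivial. apply pow_le, Cmod_ge_0.
Qed.

End Lagrange.

(** * Residues *)

Lemma polar_opp (x phi : R) : polar x (phi + PI) = (- polar x phi)%C.
Proof. unfold polar, Copp; simpl. rewrite neg_cos, neg_sin. f_equal; ring. Qed.

Lemma plog_polar (t : C) : 0 < Re t -> t = polar (Cmod t) (Im (plog t)).
Proof.
  intros h. rewrite polar_Cexp by (apply Cmod_gt_0; now apply Re_gt_0_neq_0).
  symmetry. now apply Cexp_plog.
Qed.

Lemma polar_exists (t : C) : t <> 0 -> exists phi, t = polar (Cmod t) phi.
Proof.
  intros ht. destruct (Rtotal_order (Re t) 0) as [h|[h|h]].
  - exists (Im (plog (- t)) + PI). rewrite polar_opp, <- (Cmod_opp t), <- plog_polar.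
    + ring.
    + simpl. unfold Re in h. lra.
  - assert (e : Cmod t = Rabs (Im t)).
    { unfold Cmod. change (fst t) with (Re t). change (snd t) with (Im t). rewrite h.
      replace (0 ^ 2 + Im t ^ 2) with (Rsqr (Im t)) by (unfold Rsqr; ring).
      apply sqrt_Rsqr_abs. }
    destruct t as [x y]. simpl in h, e. subst x. rewrite e.
    destruct (Rle_lt_dec 0 y) as [hy|hy].
    + exists (PI / 2). unfold polar. rewrite cos_PI2, sin_PI2, Rabs_pos_eq by trivial.
      f_equal; ring.
    + exists (PI / 2 + PI). rewrite polar_opp. unfold polar, Copp; simpl.
      rewrite cos_PI2, sin_PI2, Rabs_left by trivial. f_equal; ring.
  - exists (Im (plog t)). now apply plog_polar.
Qed.

(** [residue] is chosen by [iota], so its value must be unique among expansions with different pole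
    orders. After clearing denominators, [t ^ S n] times one series equals [t ^ k] times the other,
    and the coefficients of the same index are compared. *)
Lemma residue_coef (G : R -> R -> C) (F : C -> C) (n : nat) (c : C) :
  is_coef F n c ->
  (exists eps, 0 < eps /\ forall x phi, 0 < x < eps ->
     (G x phi * polar x phi ^ S n)%C = F (polar x phi)) ->
  residue G = c.
Proof.
  intros [l [[eps [heps H]] hc]] [eps1 [heps1 E]]. unfold residue.
  assert (HF : has_ps F l) by now exists eps.
  apply (iota_unique (V := C_R_CompleteNormedModule)).
  - intros c' [k [l' [eps' [heps' [H' ->]]]]].
    destruct (ps_point_bound l' (eps' / 2) (polar (eps' / 2) 0)
      (G (eps' / 2) 0 * polar (eps' / 2) 0 ^ k)) as [Q [K [hQ [_ hK]]]].
    { lra. } { apply Cmod_polar; lra. } { apply H'; lra. }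
    assert (HF' := geom_has_ps l' Q K hQ hK).
    assert (X : near0 (fun t => t <> 0 -> (t ^ S n * cps l' t)%C = (t ^ k * F t)%C)).
    { eapply near0_imp; [|apply (near0_and _ _ (near0_lt _ heps') (near0_and _ _
        (near0_lt _ heps1) HF'))].
      intros t [a1 [a2 a3]] ht. simpl in a1, a2.
      assert (ht0 := proj1 (Cmod_gt_0 t) ht).
      destruct (polar_exists t ht) as [phi ephi].
      assert (b := H' (Cmod t) phi ltac:(lra)). rewrite <- ephi in b.
      rewrite (is_series_C_unique _ _ _ a3 b).
      assert (b1 := E (Cmod t) phi ltac:(lra)). rewrite <- ephi in b1.
      rewrite <- b1. ring. }
    assert (c1 : is_coef (fun t => t ^ k * F t)%C (k + n) c)
      by (apply is_coef_shift; now exists l).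
    destruct k as [|k].
    (* Without a pole the convention gives 0, and indeed [t ^ S n * cps l' t] has no term of index
       [n]. *)
    + apply (is_coef_unique _ _ n _ _ (is_coef_shift_low _ _ (S n) n HF' ltac:(lia)) c1 X).
    + assert (c2 : is_coef (fun t => t ^ S n * cps l' t)%C (S n + k) (l' k))
        by (apply is_coef_shift; now exists l').
      replace (S k + n)%nat with (S n + k)%nat in c1 by lia.
      exact (is_coef_unique _ _ _ _ _ c2 c1 X).
  - exists (S n), l, (Rmin eps eps1). split; [now apply Rmin_pos|]. split; [|now symmetry].
    intros x phi hx. assert (h1 := Rmin_l eps eps1). assert (h2 := Rmin_r eps eps1).
    rewrite E by lra. apply H. rewrite Cmod_polar; lra.
Qed.

Lemma germ_cps (u : nat -> C) (e : C) (x phi : R) (s : C) : 0 < x ->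
  is_series_C (fun n => u n * polar x phi ^ n)%C s ->
  germ u e x phi = (polar_pow x phi e * s)%C.
Proof.
  intros hx H. apply CSeries_correct.
  eapply is_series_C_ext; [|apply (is_series_C_scal (polar_pow x phi e) _ _ H)].
  intros n. cbv beta. rewrite polar_pow_plus, polar_pow_nat by trivial. ring.
Qed.

Lemma RtoC_neq_0 (x : R) : x <> 0 -> RtoC x <> 0.
Proof. intros h q. now apply RtoC_inj in q. Qed.

Lemma is_deriv_curve_polar (phi x : R) : is_deriv_curve (fun y => polar y phi) x (polar 1 phi).
Proof.
  apply is_derive_ext with (fun y : R => (0 + y * polar 1 phi)%C).
  - intros t. rewrite Cplus_0_l, <- polar_scale. now rewrite Rmult_1_r.
  - apply is_deriv_curve_line.
Qed.

Lemma is_deriv_curve_polar_pow (phi x : R) (s : C) : 0 < x ->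
  is_deriv_curve (fun y => polar_pow y phi s) x (polar_pow x phi s * (s / x))%C.
Proof.
  intros hx. apply is_deriv_curve_Cexp.
  eapply is_deriv_curve_eq; [apply is_deriv_curve_scal with (l := (/ x)%C)|reflexivity].
  replace (/ x)%C with ((/ x, 0) : C) by (rewrite <- RtoC_inv by lra; reflexivity).
  apply is_deriv_curve_pair; simpl.
  - auto_derive; trivial. field. lra.
  - apply (is_derive_const (V := R_NormedModule)).
Qed.

(** * The residues [b_coef] and [c_coef] as Taylor coefficients *)

Section Coefficients.

Variables (p_ q_ r_ : nat -> C) (mu nu : R) (lambda : C) (varpi0 : R).
Hypotheses (hmu : 0 < mu) (hp0 : p_ 0%nat <> 0)
  (hp : has_ps (cps p_) p_) (hq : has_ps (cps q_) q_) (hr : has_ps (cps r_) r_)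
  (hvarpi0 : p_ 0%nat = polar (Cmod (p_ 0%nat)) varpi0).

(** The quotient of p(t) - p(a) by p_0 (t - a)^mu, a germ with value 1. It is spelled exactly like
    the last factor of [p_pow], so that [change] identifies the two. *)
Definition unit_part (t : C) : C := (1 + CSeries (fun n => p_ (S n) / p_ 0%nat * t ^ S n))%C.

Definition unit_coef (n : nat) : C := (p_ n / p_ 0%nat)%C.

Let p0_pow := polar_pow (Cmod (p_ 0%nat)) varpi0.

Lemma unit_coef_0 : unit_coef 0 = 1.
Proof. unfold unit_coef. field. trivial. Qed.

Lemma unit_part_has_ps : has_ps unit_part unit_coef.
Proof.
  assert (H := has_ps_scal (/ p_ 0%nat)%C _ _ hp).
  eapply has_ps_coef_ext; [eapply has_ps_ext; [exact H|]|].
  - eapply near0_imp; [|exact H]. intros t h.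
    assert (e : (/ p_ 0%nat * cps p_ t)%C =
      ((/ p_ 0%nat * p_ 0%nat * t ^ 0) + (/ p_ 0%nat * cps p_ t - 1))%C)
      by (simpl; field; trivial).
    cbv beta in h. rewrite e in h.
    apply (is_series_C_split_inv (fun n => / p_ 0%nat * p_ n * t ^ n)%C) in h.
    unfold unit_part. erewrite CSeries_correct; [|eapply is_series_C_ext; [|exact h]].
    + ring.
    + intros n. simpl. unfold Cdiv. ring.
  - intros n. unfold unit_coef, Cdiv. ring.
Qed.

Lemma unit_part_eq : near0 (fun t => cps p_ t = p_ 0%nat * unit_part t)%C.
Proof.
  eapply near0_imp; [|exact (near0_and _ _ hp unit_part_has_ps)].
  intros t [h1 h2]. eapply is_series_C_unique; [exact h1|].
  eapply is_series_C_ext; [|apply (is_series_C_scal (p_ 0%nat) _ _ h2)].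
  intros n. unfold unit_coef. simpl. field. trivial.
Qed.

Lemma p0_pow_plus (u v : C) : p0_pow (u + v) = (p0_pow u * p0_pow v)%C.
Proof. apply polar_pow_plus. Qed.

Lemma p0_pow_neq_0 (u : C) : p0_pow u <> 0.
Proof. apply polar_pow_neq_0. Qed.

Lemma p0_pow_opp (u : C) : p0_pow (- u) = (/ p0_pow u)%C.
Proof.
  unfold p0_pow, polar_pow. rewrite <- Cexp_opp. f_equal. ring.
Qed.

Lemma p0_pow_1 : p0_pow 1 = p_ 0%nat.
Proof.
  unfold p0_pow, polar_pow. rewrite Cmult_1_l, <- polar_Cexp; [now symmetry|].
  now apply Cmod_gt_0.
Qed.

Lemma p0_pow_nat (n : nat) (u : C) : p0_pow (INR n * u) = (p0_pow u ^ n)%C.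
Proof.
  unfold p0_pow, polar_pow. rewrite <- Cmult_assoc. apply Cexp_nat.
Qed.

(** In the residue the powers of t - a combine to the exponent lambda - 1 - (n + lambda) = - (n +
    1), whatever lambda and mu are. What remains is the n-th Taylor coefficient of the series of [q]
    times a principal power. *)
Lemma b_coef_eq (n : nat) : exists e,
  has_ps (fun t => principal_pow (unit_part t) (- ((INR n + lambda) / mu))) e /\
  e 0%nat = 1 /\ e 1%nat = (- ((INR n + lambda) / mu) * unit_coef 1)%C /\
  b_coef p_ q_ mu lambda varpi0 n =
    (/ mu * (p0_pow (- ((INR n + lambda) / mu)) * fps_mul q_ e n))%C.
Proof.
  set (s := ((INR n + lambda) / mu)%C).
  destruct (principal_pow_has_ps _ _ (- s) unit_part_has_ps unit_coef_0)
    as [e [He [e0 [e1 [hRe _]]]]].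
  exists e. split; [|split; [|split]]; trivial.
  unfold b_coef. f_equal.
  destruct (near0_and _ _ hq hRe) as [eps [heps E]].
  apply (residue_coef _ (fun t => p0_pow (- s) *
    (cps q_ t * principal_pow (unit_part t) (- s)))%C n).
  - apply is_coef_scal. eexists. split; [apply (has_ps_mult _ _ _ _ hq He)|reflexivity].
  - exists eps. split; trivial. intros x phi hx.
    destruct (E (polar x phi)) as [h1 h2]; [rewrite Cmod_polar; lra|]. cbv beta in h2.
    rewrite (germ_cps q_ (lambda - 1) x phi _ ltac:(lra) h1).
    unfold p_pow. fold s. change (1 + CSeries _)%C with (unit_part (polar x phi)).
    rewrite p0_pow_opp. unfold p0_pow.
    assert (X : (polar_pow x phi (lambda - 1) * polar x phi ^ S n)%C = polar_pow x phi (mu * s)).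
    { rewrite <- polar_pow_nat, <- polar_pow_plus by lra. f_equal.
      unfold s. rewrite S_INR, RtoC_plus. field. apply RtoC_neq_0; lra. }
    assert (Y : principal_pow (unit_part (polar x phi)) (- s) =
      (/ principal_pow (unit_part (polar x phi)) s)%C).
    { rewrite !principal_pow_plog, <- Cexp_opp. f_equal. ring. }
    rewrite Y. clear Y.
    assert (n1 := polar_pow_neq_0 (Cmod (p_ 0%nat)) varpi0 s).
    assert (n2 := polar_pow_neq_0 x phi (mu * s)).
    assert (n3 := principal_pow_neq_0 (unit_part (polar x phi)) s).
    set (y := polar_pow x phi (mu * s)) in *.
    replace (polar_pow x phi (lambda - 1) * cps q_ (polar x phi) /
      (polar_pow (Cmod (p_ 0%nat)) varpi0 s * y * principal_pow (unit_part (polar x phi)) s)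
      * polar x phi ^ S n)%C with
      ((polar_pow x phi (lambda - 1) * polar x phi ^ S n) * (cps q_ (polar x phi) /
      (polar_pow (Cmod (p_ 0%nat)) varpi0 s * y * principal_pow (unit_part (polar x phi)) s)))%C
      by (field; auto).
    rewrite X. field. auto.
Qed.

(** This is p' = mu (p - p(a)) / (t - a) times the logarithmic derivative of the local parameter,
    the form in which p' cancels against [p_pow] in [c_coef]. *)
Lemma germ_deriv_p : exists eps, 0 < eps /\ forall x phi, 0 < x < eps ->
  germ_deriv (germ p_ mu) x phi =
    (mu * p_ 0%nat * polar_pow x phi (mu - 1) * unit_part (polar x phi)
     * log_deriv unit_part unit_coef mu (polar x phi))%C.
Proof.
  assert (HU := unit_part_has_ps).
  destruct (has_ps_deriv _ _ HU) as [_ DU].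
  destruct (near0_and _ _ (near0_and _ _ hp unit_part_eq)
    (near0_and _ _ DU (Re_F_near _ _ HU unit_coef_0))) as [eps [heps E]].
  exists eps. split; trivial. intros x phi hx. unfold germ_deriv.
  destruct (E (polar x phi)) as [[h1 h2] [h3 h4]]; [rewrite Cmod_polar; lra|].
  cbv beta in h2, h3, h4.
  erewrite derivRC_correct with (l := _).
  2:{ eapply is_derive_ext_loc with
        (f := fun y : R => (polar_pow y phi mu * (p_ 0%nat * unit_part (polar y phi)))%C).
      - assert (hd : 0 < Rmin x (eps - x)) by (apply Rmin_pos; lra).
        exists (mkposreal _ hd). intros y hy. simpl in hy.
        assert (hy' : Rabs (y - x) < Rmin x (eps - x)) by exact hy.
        assert (a1 := Rmin_l x (eps - x)). assert (a2 := Rmin_r x (eps - x)).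
        apply Rabs_def2 in hy'.
        destruct (E (polar y phi)) as [[g1 g2] _]; [rewrite Cmod_polar; lra|].
        cbv beta in g2. rewrite <- g2. symmetry. now apply germ_cps; [lra|].
      - apply is_deriv_curve_mult; [apply is_deriv_curve_polar_pow; lra|].
        apply is_deriv_curve_scal. eapply (Cdiff_curve unit_part); [exact h3|].
        apply is_deriv_curve_polar. }
  unfold log_deriv.
  assert (n1 : polar 1 phi <> 0) by (apply polar_neq_0; lra).
  assert (n2 := Re_gt_0_neq_0 _ h4).
  assert (n3 : RtoC x <> 0) by (apply RtoC_neq_0; lra).
  assert (n4 : RtoC mu <> 0) by (apply RtoC_neq_0; lra).
  assert (e1 : (x * polar 1 phi)%C = polar x phi)
    by (rewrite <- polar_scale, Rmult_1_r; reflexivity).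
  assert (e2 : polar_pow x phi mu = (polar_pow x phi (mu - 1) * (x * polar 1 phi))%C).
  { rewrite e1. replace (polar x phi) with (polar_pow x phi (INR 1))
      by (rewrite polar_pow_nat by lra; ring).
    rewrite <- polar_pow_plus. f_equal. simpl. ring. }
  rewrite e2. rewrite <- e1. rewrite <- e1 in n2. field. auto.
Qed.

(** The quotient p' / (p - p(a)) contributes mu / (t - a) times [log_deriv]. The mu cancels the
    factor in front of the residue, and the remaining powers of t - a have exponent - (n + 1) as for
    [b_coef]. *)
Lemma c_coef_eq (n : nat) : exists d e,
  has_ps (log_deriv unit_part unit_coef mu) d /\
  has_ps (fun t => principal_pow (unit_part t) (- ((INR n + nu) / mu))) e /\
  d 0%nat = 1 /\ d 1%nat = (/ mu * unit_coef 1)%C /\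
  e 0%nat = 1 /\ e 1%nat = (- ((INR n + nu) / mu) * unit_coef 1)%C /\
  c_coef p_ r_ mu nu varpi0 n =
    (p0_pow (- ((INR n + nu) / mu)) * fps_mul d (fps_mul r_ e) n)%C.
Proof.
  set (s := ((INR n + nu) / mu)%C).
  assert (HU := unit_part_has_ps).
  destruct (principal_pow_has_ps _ _ (- s) HU unit_coef_0)
    as [e [He [e0 [e1 [hRe _]]]]].
  destruct (log_deriv_has_ps _ _ mu HU unit_coef_0) as [d [Hd [d0 d1]]].
  exists d, e. repeat (split; [assumption|]).
  destruct (near0_and _ _ hr hRe) as [eps [heps E]].
  destruct germ_deriv_p as [eps1 [heps1 E1]].
  assert (n0 : RtoC mu <> 0) by (apply RtoC_neq_0; lra).
  unfold c_coef.
  rewrite (residue_coef _ (fun t => (mu * p0_pow (- s)) *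
    (log_deriv unit_part unit_coef mu t *
      (cps r_ t * principal_pow (unit_part t) (- s))))%C n
    (mu * p0_pow (- s) * fps_mul d (fps_mul r_ e) n)%C).
  - field. trivial.
  - apply is_coef_scal. eexists. split;
      [apply (has_ps_mult _ _ _ _ Hd (has_ps_mult _ _ _ _ hr He))|reflexivity].
  - exists (Rmin eps eps1). split; [now apply Rmin_pos|]. intros x phi hx.
    assert (a1 := Rmin_l eps eps1). assert (a2 := Rmin_r eps eps1).
    destruct (E (polar x phi)) as [h1 h2]; [rewrite Cmod_polar; lra|]. cbv beta in h2.
    rewrite (germ_cps r_ nu x phi _ ltac:(lra) h1), E1 by lra.
    unfold p_pow. fold s. change (1 + CSeries _)%C with (unit_part (polar x phi)).
    rewrite p0_pow_opp.
    assert (X : (polar_pow x phi (mu - 1) * polar_pow x phi nu * polar x phi ^ S n)%C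
      = polar_pow x phi (mu * (s + 1))).
    { rewrite <- polar_pow_nat, <- !polar_pow_plus by lra. f_equal.
      unfold s. rewrite S_INR, RtoC_plus. field. trivial. }
    assert (Y : principal_pow (unit_part (polar x phi)) (- s) =
      (/ principal_pow (unit_part (polar x phi)) s)%C).
    { rewrite !principal_pow_plog, <- Cexp_opp. f_equal. ring. }
    assert (Y1 : principal_pow (unit_part (polar x phi)) (s + 1) =
      (principal_pow (unit_part (polar x phi)) s * unit_part (polar x phi))%C).
    { rewrite principal_pow_plus. f_equal.
      rewrite principal_pow_plog, Cmult_1_l. now apply Cexp_plog. }
    assert (Z : polar_pow (Cmod (p_ 0%nat)) varpi0 (s + 1) = (p0_pow s * p_ 0%nat)%C).
    { change (p0_pow (s + 1) = (p0_pow s * p_ 0%nat)%C). now rewrite p0_pow_plus, p0_pow_1. }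
    rewrite Y, Y1, Z. clear Y Y1 Z.
    assert (n1 := p0_pow_neq_0 s).
    assert (n2 := polar_pow_neq_0 x phi (mu * (s + 1))).
    assert (n3 := principal_pow_neq_0 (unit_part (polar x phi)) s).
    assert (n4 := Re_gt_0_neq_0 _ h2).
    set (y := polar_pow x phi (mu * (s + 1))) in *.
    set (L := log_deriv _ _ _ _). set (U := unit_part _) in *.
    set (V := principal_pow U s) in *.
    set (z1 := polar_pow x phi (mu - 1)) in *. set (z2 := polar_pow x phi nu) in *.
    set (T := (polar x phi ^ S n)%C) in *.
    transitivity ((z1 * z2 * T) * (mu * p_ 0%nat * U * L * cps r_ (polar x phi) /
      (p0_pow s * p_ 0%nat * y * (V * U))))%C; [field; auto|].
    rewrite X. field. auto.
Qed.

Let omega := p0_pow (/ mu).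

(** With w = (p - p(a))^(1/mu), [mu * q_local] is (t - a) q / w^lambda, and [r_local] is r / w^nu;
    all noninteger powers of t - a have cancelled. *)
Definition q_local (t : C) : C :=
  (/ mu * (p0_pow (- (lambda / mu)) *
    (cps q_ t * principal_pow (unit_part t) (- (lambda / mu)))))%C.

Definition r_local (t : C) : C :=
  (p0_pow (- (nu / mu)) * (cps r_ t * principal_pow (unit_part t) (- (nu / mu))))%C.

Lemma q_local_has_ps : exists m, has_ps q_local m.
Proof.
  destruct (principal_pow_has_ps _ _ (- (lambda / mu)) unit_part_has_ps unit_coef_0)
    as [e [He _]].
  eexists. apply has_ps_scal, has_ps_scal, has_ps_mult; [exact hq|exact He].
Qed.

Lemma r_local_has_ps : exists m, has_ps r_local m.
Proof.
  destruct (principal_pow_has_ps _ _ (- (nu / mu)) unit_part_has_ps unit_coef_0)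
    as [e [He _]].
  eexists. apply has_ps_scal, has_ps_mult; [exact hr|exact He].
Qed.

Lemma omega_pow (n : nat) : (omega ^ n)%C = p0_pow (INR n / mu).
Proof. unfold omega. now rewrite <- p0_pow_nat. Qed.

Lemma q_local_coef (n : nat) :
  is_coef (fun t => q_local t * principal_pow (unit_part t) (- (INR n * / mu)))%C n
    (b_coef p_ q_ mu lambda varpi0 n * omega ^ n)%C.
Proof.
  destruct (b_coef_eq n) as [e [He [_ [_ ->]]]].
  assert (n0 : RtoC mu <> 0) by (apply RtoC_neq_0; lra).
  eapply is_coef_ext.
  - replace (_ * omega ^ n)%C with ((/ mu * p0_pow (- ((INR n + lambda) / mu)) * omega ^ n)
      * fps_mul q_ e n)%C by ring.
    apply is_coef_scal. eexists. split; [apply (has_ps_mult _ _ _ _ hq He)|reflexivity].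
  - apply near0_intro. intros t. cbv beta. unfold q_local. rewrite omega_pow.
    replace (- ((INR n + lambda) / mu))%C with (- (lambda / mu) + - (INR n / mu))%C
      by (field; trivial).
    rewrite principal_pow_plus, p0_pow_plus, (p0_pow_opp (INR n / mu)).
    unfold Cdiv at 3. change (INR n * / mu)%C with (INR n / mu)%C.
    field. split; trivial. apply p0_pow_neq_0.
Qed.

(** The Lagrange expansion comes out as [log_deriv] times powers of the parameter. Multiplying
    [r_local] by [log_deriv] beforehand lets this factor be divided out again; it is the origin of
    p' in [c_coef]. *)
Lemma r_local_coef (n : nat) :
  is_coef (fun t => (log_deriv unit_part unit_coef mu t * r_local t)
    * principal_pow (unit_part t) (- (INR n * / mu)))%C n
    (c_coef p_ r_ mu nu varpi0 n * omega ^ n)%C.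
Proof.
  destruct (c_coef_eq n) as [d [e [Hd [He [_ [_ [_ [_ ->]]]]]]]].
  assert (n0 : RtoC mu <> 0) by (apply RtoC_neq_0; lra).
  eapply is_coef_ext.
  - replace (_ * omega ^ n)%C with ((p0_pow (- ((INR n + nu) / mu)) * omega ^ n)
      * fps_mul d (fps_mul r_ e) n)%C by ring.
    apply is_coef_scal. eexists.
    split; [apply (has_ps_mult _ _ _ _ Hd (has_ps_mult _ _ _ _ hr He))|reflexivity].
  - apply near0_intro. intros t. cbv beta. unfold r_local. rewrite omega_pow.
    replace (- ((INR n + nu) / mu))%C with (- (nu / mu) + - (INR n / mu))%C
      by (field; trivial).
    rewrite principal_pow_plus, p0_pow_plus, (p0_pow_opp (INR n / mu)).
    change (INR n * / mu)%C with (INR n / mu)%C.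
    field. apply p0_pow_neq_0.
Qed.

Lemma b_coef_0 : b_coef p_ q_ mu lambda varpi0 0 = (q_ 0%nat / (mu * p0_pow (lambda / mu)))%C.
Proof.
  destruct (b_coef_eq 0) as [e [_ [e0 [_ ->]]]].
  assert (n0 : RtoC mu <> 0) by (apply RtoC_neq_0; lra).
  rewrite fps_mul_0, e0, p0_pow_opp. simpl INR. rewrite Cplus_0_l.
  field. split; trivial. apply p0_pow_neq_0.
Qed.

Lemma fps_mul_1 (u v : nat -> C) :
  fps_mul u v 1 = (u 0%nat * v 1%nat + u 1%nat * v 0%nat)%C.
Proof. rewrite fps_mul_sum, sum_C_S, sum_C_O. reflexivity. Qed.

Lemma b_coef_1 : b_coef p_ q_ mu lambda varpi0 1 =
  ((q_ 1%nat / mu - (lambda + 1) * p_ 1%nat * q_ 0%nat / (mu ^ 2 * p_ 0%nat))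
     * (1 / p0_pow ((1 + lambda) / mu)))%C.
Proof.
  destruct (b_coef_eq 1) as [e [_ [e0 [e1 ->]]]].
  assert (n0 : RtoC mu <> 0) by (apply RtoC_neq_0; lra).
  rewrite fps_mul_1, e0, e1, p0_pow_opp. simpl INR. unfold unit_coef.
  field. repeat split; trivial. apply p0_pow_neq_0.
Qed.

Lemma c_coef_0 : c_coef p_ r_ mu nu varpi0 0 = (r_ 0%nat / p0_pow (nu / mu))%C.
Proof.
  destruct (c_coef_eq 0) as [d [e [_ [_ [d0 [_ [e0 [_ ->]]]]]]]].
  rewrite !fps_mul_0, d0, e0, p0_pow_opp. simpl INR. rewrite Cplus_0_l.
  field. apply p0_pow_neq_0.
Qed.

Lemma c_coef_1 : c_coef p_ r_ mu nu varpi0 1 =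
  ((r_ 1%nat - nu * p_ 1%nat * r_ 0%nat / (mu * p_ 0%nat)) / p0_pow ((1 + nu) / mu))%C.
Proof.
  destruct (c_coef_eq 1) as [d [e [_ [_ [d0 [d1 [e0 [e1 ->]]]]]]]].
  assert (n0 : RtoC mu <> 0) by (apply RtoC_neq_0; lra).
  rewrite fps_mul_1, fps_mul_0, fps_mul_1, d0, d1, e0, e1, p0_pow_opp. simpl INR.
  unfold unit_coef. field. repeat split; trivial. apply p0_pow_neq_0.
Qed.

End Coefficients.

(** * Finite expansions in powers of the local parameter, and Bell polynomials *)

Lemma partial_sum_ext (u v : nat -> C) (N : nat) :
  (forall n, (n < N)%nat -> u n = v n) -> partial_sum u N = partial_sum v N.
Proof.
  induction N as [|N IH]; intros h; [reflexivity|].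
  rewrite !partial_sum_S, h, IH by (intros; try apply h; lia). reflexivity.
Qed.

Lemma partial_sum_plus (u v : nat -> C) (N : nat) :
  partial_sum (fun n => u n + v n)%C N = (partial_sum u N + partial_sum v N)%C.
Proof.
  induction N as [|N IH]; [simpl; ring|]. rewrite !partial_sum_S, IH. ring.
Qed.

Lemma partial_sum_scal (c : C) (u : nat -> C) (N : nat) :
  partial_sum (fun n => c * u n)%C N = (c * partial_sum u N)%C.
Proof.
  induction N as [|N IH]; [simpl; ring|]. rewrite !partial_sum_S, IH. ring.
Qed.

Lemma partial_sum_shift (u : nat -> C) (N : nat) :
  partial_sum u (S N) = (u 0%nat + partial_sum (fun n => u (S n)) N)%C.
Proof.
  induction N as [|N IH]; [rewrite partial_sum_S; simpl; ring|].
  rewrite partial_sum_S, IH, partial_sum_S. ring.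
Qed.

Lemma partial_sum_exchange (u : nat -> nat -> C) (M N : nat) :
  partial_sum (fun m => partial_sum (fun n => u m n) N) M =
  partial_sum (fun n => partial_sum (fun m => u m n) M) N.
Proof.
  induction M as [|M IH].
  - simpl. symmetry. induction N as [|N IHN]; [reflexivity|].
    rewrite partial_sum_S, IHN. ring.
  - rewrite partial_sum_S, IH, <- partial_sum_plus. apply partial_sum_ext.
    intros n _. now rewrite partial_sum_S.
Qed.

Lemma Cmod_partial_sum (u : nat -> C) (N : nat) (K : R) :
  (forall n, (n < N)%nat -> Cmod (u n) <= K) -> Cmod (partial_sum u N) <= INR N * K.
Proof.
  induction N as [|N IH]; intros h; [simpl; rewrite Cmod_0; lra|].
  rewrite partial_sum_S, S_INR. eapply Rle_trans; [apply Cmod_triangle|].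
  generalize (IH (fun n hn => h n ltac:(lia))) (h N ltac:(lia)). lra.
Qed.

Section Expansions.

Variables (S0 : R -> Prop) (w : R -> C) (W : R).
Hypotheses (hW0 : 0 <= W) (hw : forall s, S0 s -> Cmod (w s) <= W /\ w s <> 0).

(* [f = u_0 + ... + u_(N-1) w^(N-1) + O(w^N)] on [S0], by successive division by [w]. *)
Fixpoint expands (N : nat) (f : R -> C) (u : nat -> C) : Prop :=
  match N with
  | O => exists K, 0 <= K /\ forall s, S0 s -> Cmod (f s) <= K
  | S N' => exists f1, (forall s, S0 s -> f s = u 0%nat + w s * f1 s)%C /\
              expands N' f1 (fun n => u (S n))
  end.

Lemma expands_ext (N : nat) : forall f g u v,
  (forall s, S0 s -> f s = g s) -> (forall n, u n = v n) -> expands N f u -> expands N g v.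
Proof.
  induction N as [|N IH]; intros f g u v hf hu; simpl.
  - intros [K [hK H]]. exists K. split; trivial. intros s hs. rewrite <- hf; auto.
  - intros [f1 [H H1]]. exists f1. split.
    + intros s hs. now rewrite <- hf, <- hu, H.
    + revert H1. apply IH; auto.
Qed.

Lemma expands_weaken (N : nat) : forall f u, expands (S N) f u -> expands N f u.
Proof.
  induction N as [|N IH]; intros f u [f1 [H H1]].
  - destruct H1 as [K [hK H1]]. exists (Cmod (u 0%nat) + W * K). split.
    + apply Rplus_le_le_0_compat; [apply Cmod_ge_0|now apply Rmult_le_pos].
    + intros s hs. rewrite H by trivial. eapply Rle_trans; [apply Cmod_triangle|].
      apply Rplus_le_compat_l. rewrite Cmod_mult. destruct (hw s hs).
      apply Rmult_le_compat; auto; apply Cmod_ge_0.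
  - exists f1. split; trivial. now apply IH.
Qed.

Lemma expands_bounded (N : nat) (f : R -> C) (u : nat -> C) : expands N f u ->
  exists K, 0 <= K /\ forall s, S0 s -> Cmod (f s) <= K.
Proof.
  induction N as [|N IH]; intros H; [exact H|]. now apply IH, expands_weaken.
Qed.

Lemma expands_plus (N : nat) : forall f g u v, expands N f u -> expands N g v ->
  expands N (fun s => f s + g s)%C (fun n => u n + v n)%C.
Proof.
  induction N as [|N IH]; intros f g u v; simpl.
  - intros [K [hK H]] [L [hL H']]. exists (K + L). split; [lra|]. intros s hs.
    eapply Rle_trans; [apply Cmod_triangle|]. now apply Rplus_le_compat; auto.
  - intros [f1 [H H1]] [g1 [H' H1']]. exists (fun s => f1 s + g1 s)%C. split.
    + intros s hs. rewrite H, H' by trivial. ring.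
    + now apply (IH f1 g1 (fun n => u (S n)) (fun n => v (S n))).
Qed.

Lemma expands_scal (c : C) (N : nat) : forall f u, expands N f u ->
  expands N (fun s => c * f s)%C (fun n => c * u n)%C.
Proof.
  induction N as [|N IH]; intros f u; simpl.
  - intros [K [hK H]]. exists (Cmod c * K). split; [apply Rmult_le_pos; trivial; apply Cmod_ge_0|].
    intros s hs. rewrite Cmod_mult. apply Rmult_le_compat_l; [apply Cmod_ge_0|auto].
  - intros [f1 [H H1]]. exists (fun s => c * f1 s)%C. split.
    + intros s hs. rewrite H by trivial. ring.
    + now apply (IH f1 (fun n => u (S n))).
Qed.

(** With f = u_0 + w f1 and g = v_0 + w g1 the product is u_0 v_0 + w (u_0 g1 + f1 g). Leaving the
    last [g] whole gives the bracket the coefficients of [fps_mul u v] shifted by one. *)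
Lemma expands_mult (N : nat) : forall f g u v, expands N f u -> expands N g v ->
  expands N (fun s => f s * g s)%C (fps_mul u v).
Proof.
  induction N as [|N IH]; intros f g u v hf hg.
  - destruct hf as [K [hK H]]. destruct hg as [L [hL H']].
    exists (K * L). split; [now apply Rmult_le_pos|]. intros s hs.
    rewrite Cmod_mult. apply Rmult_le_compat; auto; apply Cmod_ge_0.
  - assert (hg' := expands_weaken N g v hg).
    destruct hf as [f1 [H H1]]. destruct hg as [g1 [H' H1']].
    exists (fun s => u 0%nat * g1 s + f1 s * g s)%C. split.
    + intros s hs. rewrite fps_mul_0, H, H' by trivial. ring.
    + apply (expands_ext N (fun s => u 0%nat * g1 s + f1 s * g s)%C _
        (fun n => u 0%nat * v (S n) + fps_mul (fun k => u (S k)) v n)%C).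
      * reflexivity.
      * intros n. rewrite !fps_mul_sum, sum_C_shift. reflexivity.
      * apply expands_plus; [now apply (expands_scal (u 0%nat) N g1 (fun n => v (S n)))|].
        now apply IH.
Qed.

Lemma expands_const (c : C) (N : nat) (u : nat -> C) :
  u 0%nat = c -> (forall n, u (S n) = 0) -> expands N (fun _ => c) u.
Proof.
  revert c u. induction N as [|N IH]; intros c u h0 h.
  - exists (Cmod c). split; [apply Cmod_ge_0|]. intros; lra.
  - exists (fun _ => RtoC 0). split; [intros s _; rewrite h0; ring|].
    apply IH; auto.
Qed.

Lemma expands_pow (N m : nat) (f : R -> C) (u : nat -> C) : expands N f u ->
  expands N (fun s => f s ^ m)%C (fps_pow u m).
Proof.
  intros H. induction m as [|m IH].
  - now apply (expands_const (RtoC 1)).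
  - apply (expands_mult N f _ u _ H IH).
Qed.

(** The recursive form suits products and powers; the bound is what [Lagrange_bound] provides and
    what the estimates use. Passing from the bound to the recursive form divides by [w], which
    vanishes nowhere on [S0]. *)
Lemma expands_bound (N : nat) : forall f u, expands N f u <->
  exists K, 0 <= K /\ forall s, S0 s ->
    Cmod (f s - partial_sum (fun n => u n * w s ^ n) N)%C <= K * Cmod (w s) ^ N.
Proof.
  induction N as [|N IH]; intros f u.
  - simpl. split; intros [K [hK H]]; exists K; (split; [trivial|]); intros s hs;
      specialize (H s hs); revert H; replace (f s - 0)%C with (f s) by ring;
      now rewrite Rmult_1_r.
  - assert (X : forall s, partial_sum (fun n => u n * w s ^ n)%C (S N) =
      (u 0%nat + w s * partial_sum (fun n => u (S n) * w s ^ n) N)%C).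
    { intros s. rewrite partial_sum_shift, <- partial_sum_scal.
      replace (u 0%nat * w s ^ 0)%C with (u 0%nat) by (simpl; ring). f_equal.
      apply partial_sum_ext. intros n _. simpl. ring. }
    split.
    + intros [f1 [H H1]]. apply IH in H1. destruct H1 as [K [hK H1]].
      exists K. split; trivial. intros s hs. rewrite X, H by trivial.
      replace (_ - _)%C with (w s * (f1 s - partial_sum (fun n => u (S n) * w s ^ n) N))%C
        by ring.
      rewrite Cmod_mult. simpl. specialize (H1 s hs).
      replace (K * (Cmod (w s) * Cmod (w s) ^ N)) with (Cmod (w s) * (K * Cmod (w s) ^ N)) by ring.
      apply Rmult_le_compat_l; trivial. apply Cmod_ge_0.
    + intros [K [hK H]]. exists (fun s => (f s - u 0%nat) / w s)%C. split.
      * intros s hs. destruct (hw s hs). field. trivial.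
      * apply IH. exists K. split; trivial. intros s hs. specialize (H s hs).
        destruct (hw s hs) as [h1 h2]. rewrite X in H.
        assert (h0 : 0 < Cmod (w s)) by now apply Cmod_gt_0.
        apply Rmult_le_reg_l with (Cmod (w s)); trivial.
        rewrite <- Cmod_mult.
        replace (w s * ((f s - u 0%nat) / w s - partial_sum (fun n => u (S n) * w s ^ n) N))%C
          with (f s - (u 0%nat + w s * partial_sum (fun n => u (S n) * w s ^ n) N))%C
          by (field; trivial).
        simpl in H. lra.
Qed.

End Expansions.

(** Along the segment from 0 to [y] the remainder of order N + 1 has as derivative [y] times the
    remainder of order N. *)
Lemma Cexp_remainder (N : nat) : forall y : C,
  Cmod (Cexp y - partial_sum (fun m => y ^ m / INR (fact m)) N)%C <= Cmod y ^ N * exp (Cmod y).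
Proof.
  induction N as [|N IH]; intros y.
  - simpl. replace (Cexp y - 0)%C with (Cexp y) by ring. rewrite Cmod_Cexp, Rmult_1_l.
    apply exp_monotone. generalize (re_le_Cmod y) (Rle_abs (Re y)). lra.
  - set (T := fun (N : nat) (y : C) => partial_sum (fun m => y ^ m / INR (fact m))%C N).
    assert (hfact : forall m, RtoC (INR (fact m)) <> 0).
    { intros m. apply RtoC_neq_0, not_0_INR, fact_neq_0. }
    assert (hT : forall N s, is_deriv_curve (fun s : R => T (S N) (0 + s * y)%C) s
      (y * T N (0 + s * y))%C).
    { clear N IH. intros N s.
      assert (hpow : forall m, is_deriv_curve (fun s : R => (0 + s * y) ^ S m)%C s
        (INR (S m) * (0 + s * y) ^ m * y)%C).
      { induction m as [|m IHm].
        - eapply is_deriv_curve_eq; [apply is_deriv_curve_mult;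
            [apply is_deriv_curve_line|apply is_deriv_curve_const]|].
          simpl. ring.
        - eapply is_deriv_curve_eq;
            [apply (is_deriv_curve_mult (fun s : R => (0 + s * y)%C)
              (fun s : R => (0 + s * y) ^ S m)%C);
            [apply is_deriv_curve_line|apply IHm]|].
          rewrite (S_INR (S m)), RtoC_plus. cbv beta. rewrite !(Cpow_S _ m). ring. }
      induction N as [|N IH].
      - apply is_derive_ext with (fun _ : R => (1 / 1)%C); [intros t; unfold T; rewrite partial_sum_S; simpl; Cring|].
        eapply is_deriv_curve_eq; [apply is_deriv_curve_const|]. unfold T. simpl. ring.
      - apply is_derive_ext with
          (fun s : R => T (S N) (0 + s * y) + / INR (fact (S N)) * (0 + s * y) ^ S N)%C.
        { intros t. unfold T. rewrite (partial_sum_S _ (S N)). unfold Cdiv.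
          rewrite (Cmult_comm (/ _)). reflexivity. }
        eapply is_deriv_curve_eq; [apply is_deriv_curve_plus;
          [apply IH|apply is_deriv_curve_scal, hpow]|].
        unfold T. rewrite (partial_sum_S _ N), fact_simpl, mult_INR, RtoC_mult.
        assert (a := hfact N).
        assert (b : RtoC (INR (S N)) <> 0) by (apply RtoC_neq_0, not_0_INR; lia).
        field. auto. }
    generalize (curve_mean_value (fun s : R => Cexp (0 + s * y) - T (S N) (0 + s * y))%C
      (fun s : R => y * (Cexp (0 + s * y) - T N (0 + s * y)))%C
      (fun s => (Cmod y ^ S N * exp (Cmod y)) * s) (fun _ => Cmod y ^ S N * exp (Cmod y)) 0 1).
    intros E. cbv beta in E.
    replace (0 + 1 * y)%C with y in E by ring.
    replace (0 + 0 * y)%C with (RtoC 0) in E by ring.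
    assert (e0 : T (S N) 0 = RtoC 1).
    { unfold T. rewrite partial_sum_shift.
      rewrite (partial_sum_ext _ (fun n => 0 * 1)%C).
      - rewrite partial_sum_scal. simpl. field.
      - intros n _. unfold Cdiv. simpl. ring. }
    rewrite Cexp_0, e0 in E. unfold T in E.
    replace (Cexp y - partial_sum (fun m => y ^ m / INR (fact m)) (S N) - (1 - 1))%C
      with (Cexp y - partial_sum (fun m => y ^ m / INR (fact m)) (S N))%C in E by ring.
    eapply Rle_trans; [apply E; clear E|right; ring].
    + lra.
    + intros s _. eapply is_deriv_curve_eq; [apply is_deriv_curve_minus|].
      * apply is_deriv_curve_Cexp, is_deriv_curve_line.
      * apply hT.
      * unfold T. ring.
    + intros s _. apply is_derive_scal_id.
    + intros s hs. rewrite Cplus_0_l, Cmod_mult. simpl pow. rewrite Rmult_assoc.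
      apply Rmult_le_compat_l; [apply Cmod_ge_0|].
      eapply Rle_trans; [apply IH|].
      assert (hk : Cmod (s * y) <= Cmod y).
      { rewrite Cmod_mult, Cmod_R_pos by lra. generalize (Cmod_ge_0 y). nra. }
      apply Rmult_le_compat; [apply pow_le, Cmod_ge_0|left; apply exp_pos| |now apply exp_monotone].
      apply pow_incr. split; [apply Cmod_ge_0|trivial].
Qed.

(** Lets the powers of [Cmod E] that occur in the exponential expansion be absorbed in a single
    factor [exp (L * Cmod E)]. *)
Lemma pow_le_exp (x : R) (n : nat) : 0 <= x -> x ^ n <= exp (INR n * x).
Proof.
  intros hx. induction n as [|n IH].
  - simpl. rewrite Rmult_0_l, exp_0. lra.
  - rewrite S_INR, Rmult_plus_distr_r, Rmult_1_l, exp_plus, Rmult_comm. simpl.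
    assert (x <= exp x) by (generalize (exp_ineq1_le x); lra).
    rewrite (Rmult_comm (exp _)). rewrite Rmult_comm.
    apply Rmult_le_compat; trivial. now apply pow_le.
Qed.

Lemma fps_mul_low (u v : nat -> C) (m n : nat) :
  (forall j, (j < m)%nat -> v j = 0) -> (n < m)%nat -> fps_mul u v n = 0.
Proof.
  intros h hn. rewrite fps_mul_sum.
  rewrite (sum_C_ext _ (fun k => 0 * u k)%C).
  - rewrite sum_C_scal. ring.
  - intros k hk. rewrite h by lia. ring.
Qed.

Lemma fps_mul_comm (u v : nat -> C) (n : nat) : fps_mul u v n = fps_mul v u n.
Proof.
  revert u v. induction n as [|n IH]; intros u v.
  - rewrite !fps_mul_0. ring.
  - rewrite (fps_mul_sum u), sum_C_shift.
    change (sum_C (fun k => u (S k) * v (S n - S k)%nat)%C n) with (fps_mul (fun k => u (S k)) v n).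
    rewrite IH, fps_mul_sum, (fps_mul_sum v), sum_C_S, Nat.sub_diag, Nat.sub_0_r, Cplus_comm.
    rewrite (Cmult_comm (u _)). f_equal. apply sum_C_ext. intros k hk.
    replace (S n - k)%nat with (S (n - k)) by lia. reflexivity.
Qed.

Lemma Bell_low (c : nat -> C) (m : nat) : forall n, (n < m)%nat -> Bell n m c = 0.
Proof.
  unfold Bell. set (u := fun j => match j with O => RtoC 0 | S _ => c j end).
  induction m as [|m IH]; intros n hn; [lia|].
  change (fps_mul u (fps_pow u m) n = 0). destruct n as [|n].
  - rewrite fps_mul_0. unfold u at 1. ring.
  - rewrite fps_mul_sum, sum_C_shift.
    change (0 * fps_pow u m (S n - 0)%nat + fps_mul (fun k => u (S k)) (fps_pow u m) n = 0)%C.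
    rewrite (fps_mul_low _ _ m) by (trivial; lia). ring.
Qed.

Lemma sum_n_m_C_low (u : nat -> C) (m n : nat) : (m <= n)%nat ->
  (forall j, (j < m)%nat -> u j = 0) -> @sum_n_m C_NormedModule u m n = sum_C u n.
Proof.
  intros hmn h. destruct m as [|m]; [reflexivity|].
  assert (e := sum_n_m_Chasles (G := C_NormedModule) u 0 m n ltac:(lia) ltac:(lia)).
  symmetry. refine (eq_trans e _).
  assert (e0 : sum_C u m = RtoC 0).
  { rewrite (sum_C_ext u (fun _ => 0 * 0)%C m).
    - rewrite sum_C_scal. Cring.
    - intros k hk. rewrite h by lia. ring. }
  change (sum_C u m + @sum_n_m C_NormedModule u (S m) n = @sum_n_m C_NormedModule u (S m) n)%C.
  rewrite e0. apply Cplus_0_l.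
Qed.

(** [Bell_low] extends the inner sum down to j = 0, which makes it a coefficient of a product of
    formal series. For [n < m] both sides are 0. *)
Lemma f_coef_fps (p_ q_ r_ : nat -> C) (mu nu : R) (lambda : C) (varpi0 : R) (n m : nat) :
  f_coef p_ q_ r_ mu nu lambda varpi0 n m =
    (/ INR (fact m) * fps_mul (b_coef p_ q_ mu lambda varpi0)
       (fun j => Bell j m (c_coef p_ r_ mu nu varpi0)) n)%C.
Proof.
  unfold f_coef. f_equal.
  set (b := b_coef _ _ _ _ _). set (c := c_coef _ _ _ _ _).
  rewrite fps_mul_comm, fps_mul_sum.
  destruct (Nat.le_gt_cases m n) as [h|h].
  - etransitivity; [apply (sum_n_m_C_low _ m n h)|].
    + intros j hj. rewrite Bell_low by trivial. ring.
    + apply sum_C_ext. intros k _. ring.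
  - rewrite <- fps_mul_sum.
    rewrite fps_mul_comm, (fps_mul_low _ _ m) by (trivial; intros; now apply Bell_low).
    apply (sum_n_m_zero (G := C_NormedModule)). exact h.
Qed.

(* [E] stands for [z^(nu/mu) w^nu]. *)
Lemma exponential_expansion (S0 : R -> Prop) (w Bf X : R -> C) (W : R) (b c : nat -> C) (N : nat) :
  0 <= W -> (forall s, S0 s -> Cmod (w s) <= W /\ w s <> 0) ->
  expands S0 w N Bf b -> expands S0 w (S N) X c -> c 0%nat = 0 ->
  exists K L, 0 <= K /\ 0 <= L /\ forall s E, S0 s ->
    Cmod (Bf s * Cexp (E * X s) - partial_sum (fun n => w s ^ n *
       sum_C (fun m => E ^ m * (/ INR (fact m) * fps_mul b (fun j => Bell j m c) n)) n) N)%C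
      <= K * Cmod (w s) ^ N * exp (L * Cmod E).
Proof.
  intros hW hw hB hX hc0.
  (* [X] is expanded to one order more than [Bf]: a single division by [w] then gives X = O(w) also
     for [N = 0]. *)
  assert (hX1 : exists K1, 0 <= K1 /\ forall s, S0 s -> Cmod (X s) <= K1 * Cmod (w s)).
  { destruct hX as [X1 [h1 h2]]. apply (expands_bounded S0 w W hW hw) in h2.
    destruct h2 as [K1 [hK1 h2]]. exists K1. split; trivial. intros s hs.
    rewrite h1, hc0, Cplus_0_l, Cmod_mult, Rmult_comm by trivial.
    apply Rmult_le_compat_r; [apply Cmod_ge_0|auto]. }
  apply (expands_weaken S0 w W hW hw) in hX.
  destruct hX1 as [K1 [hK1 hX1]].
  destruct (expands_bounded S0 w W hW hw N Bf b hB) as [K2 [hK2 hB2]].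
  assert (hm : forall m, exists K, 0 <= K /\ forall s, S0 s ->
    Cmod (Bf s * X s ^ m - partial_sum (fun n => fps_mul b (fun j => Bell j m c) n * w s ^ n) N)%C
      <= K * Cmod (w s) ^ N).
  { intros m. apply (expands_bound S0 w W hw N (fun s => Bf s * X s ^ m)%C).
    apply (expands_mult S0 w W hW hw); trivial.
    (* [Bell] ignores [c 0] while [fps_pow] does not; they agree because [c 0 = 0]. *)
    assert (e : forall j, fps_pow c m j = Bell j m c).
    { unfold Bell. intros j. set (u := fun j => match j with O => RtoC 0 | S _ => c j end).
      assert (eu : forall j, c j = u j) by (intros [|i]; [exact hc0|reflexivity]).
      revert j. induction m as [|m IH]; [reflexivity|]. intros j.
      change (fps_mul c (fps_pow c m) j = fps_mul u (fps_pow u m) j).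
      rewrite !fps_mul_sum. apply sum_C_ext. intros k _. now rewrite eu, IH. }
    apply (expands_ext S0 w N (fun s => X s ^ m)%C _ (fps_pow c m)); auto.
    now apply (expands_pow S0 w W hW hw). }
  assert (hm' : exists K3, 0 <= K3 /\ forall m, (m < N)%nat -> forall s, S0 s ->
    Cmod (Bf s * X s ^ m - partial_sum (fun n => fps_mul b (fun j => Bell j m c) n * w s ^ n) N)%C
      <= K3 * Cmod (w s) ^ N).
  { assert (Y : forall M, exists K3, 0 <= K3 /\ forall m, (m < M)%nat -> forall s, S0 s ->
      Cmod (Bf s * X s ^ m - partial_sum (fun n => fps_mul b (fun j => Bell j m c) n * w s ^ n) N)%C
      <= K3 * Cmod (w s) ^ N); [|apply Y].
    induction M as [|M [K3 [h1 h2]]]; [exists 0; split; [lra|intros; lia]|].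
    destruct (hm M) as [K4 [h3 h4]]. exists (K3 + K4). split; [lra|].
    intros m hmM s hs. assert (hwp : 0 <= Cmod (w s) ^ N) by apply pow_le, Cmod_ge_0.
    rewrite Rmult_plus_distr_r.
    assert (0 <= K3 * Cmod (w s) ^ N) by now apply Rmult_le_pos.
    assert (0 <= K4 * Cmod (w s) ^ N) by now apply Rmult_le_pos.
    destruct (Nat.eq_dec m M) as [->|hne]; [specialize (h4 s hs); lra|].
    specialize (h2 m ltac:(lia) s hs). lra. }
  destruct hm' as [K3 [hK3 h3]].
  (* The first summand pays for cutting the exponential series after [N] terms, the second for the
     [N] expansions of [Bf * X ^ m]. In the rate, [INR N] absorbs the powers of [E], and [K1 * W]
     bounds [X]. *)
  exists (K2 * K1 ^ N + INR N * K3), (INR N + K1 * W).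
  assert (hN := pos_INR N).
  assert (hK1W : 0 <= K1 * W) by now apply Rmult_le_pos.
  split; [|split; [lra|]].
  { apply Rplus_le_le_0_compat; apply Rmult_le_pos; trivial. now apply pow_le. }
  intros s E hs. destruct (hw s hs) as [hws hws0].
  assert (hE := Cmod_ge_0 E). assert (hwp : 0 <= Cmod (w s) ^ N) by apply pow_le, Cmod_ge_0.
  set (T := partial_sum (fun m => (E * X s) ^ m / INR (fact m))%C N).
  assert (e : partial_sum (fun n => w s ^ n *
       sum_C (fun m => E ^ m * (/ INR (fact m) * fps_mul b (fun j => Bell j m c) n)) n)%C N
    = partial_sum (fun m => (E ^ m / INR (fact m)) *
        partial_sum (fun n => fps_mul b (fun j => Bell j m c) n * w s ^ n) N)%C N).
  { rewrite (partial_sum_ext (fun m => (E ^ m / INR (fact m)) *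
        partial_sum (fun n => fps_mul b (fun j => Bell j m c) n * w s ^ n) N)%C
      (fun m => partial_sum (fun n => (E ^ m / INR (fact m)) *
        (fps_mul b (fun j => Bell j m c) n * w s ^ n))%C N))
      by (intros m _; now rewrite partial_sum_scal).
    rewrite partial_sum_exchange. apply partial_sum_ext. intros n hn.
    (* By [Bell_low] the terms with [m > n] vanish, so the sum over m may stop at [n]. *)
    assert (Y : forall M, (n < M)%nat ->
      partial_sum (fun m => (E ^ m / INR (fact m)) *
        (fps_mul b (fun j => Bell j m c) n * w s ^ n))%C M =
      (w s ^ n * sum_C (fun m => E ^ m * (/ INR (fact m) * fps_mul b (fun j => Bell j m c) n)) n)%C).
    { intros M hM. induction M as [|M IH]; [lia|].
      destruct (Nat.eq_dec n M) as [->|hne].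
      - change (sum_C (fun m => (E ^ m / INR (fact m)) *
          (fps_mul b (fun j => Bell j m c) M * w s ^ M))%C M =
          (w s ^ M * sum_C (fun m => E ^ m * (/ INR (fact m) * fps_mul b (fun j => Bell j m c) M)) M)%C).
        rewrite <- sum_C_scal. apply sum_C_ext. intros m _. unfold Cdiv. ring.
      - rewrite partial_sum_S, IH by lia.
        rewrite (fps_mul_low _ _ M n); [ring| |lia]. intros j hj. now apply Bell_low. }
    symmetry. apply Y. exact hn. }
  rewrite e. clear e.
  replace (_ - _)%C with (Bf s * (Cexp (E * X s) - T) +
    partial_sum (fun m => (E ^ m / INR (fact m)) * (Bf s * X s ^ m -
      partial_sum (fun n => fps_mul b (fun j => Bell j m c) n * w s ^ n) N)) N)%C.
  2:{ rewrite (partial_sum_ext _ (fun m => Bf s * ((E * X s) ^ m / INR (fact m)) +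
        (-1) * ((E ^ m / INR (fact m)) *
        partial_sum (fun n => fps_mul b (fun j => Bell j m c) n * w s ^ n) N))%C N)
        by (intros m _; rewrite Cpow_mult_l; unfold Cdiv; ring).
      rewrite partial_sum_plus, !partial_sum_scal. fold T. ring. }
  assert (h1 : Cmod (Bf s * (Cexp (E * X s) - T)) <=
    K2 * K1 ^ N * Cmod (w s) ^ N * exp ((INR N + K1 * W) * Cmod E)).
  { rewrite Cmod_mult.
    assert (hEX : Cmod (E * X s) <= Cmod E * (K1 * Cmod (w s))).
    { rewrite Cmod_mult. now apply Rmult_le_compat_l; auto. }
    assert (hEX2 : Cmod (E * X s) <= K1 * W * Cmod E).
    { eapply Rle_trans; [exact hEX|]. rewrite Rmult_comm.
      apply Rmult_le_compat_r; trivial. now apply Rmult_le_compat_l. }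
    replace (K2 * K1 ^ N * Cmod (w s) ^ N * exp ((INR N + K1 * W) * Cmod E))
      with (K2 * ((K1 * Cmod (w s)) ^ N * exp ((INR N + K1 * W) * Cmod E)))
      by (rewrite Rpow_mult_distr; ring).
    apply Rmult_le_compat; auto; try apply Cmod_ge_0.
    eapply Rle_trans; [apply Cexp_remainder|].
    apply Rle_trans with ((Cmod E * (K1 * Cmod (w s))) ^ N * exp (K1 * W * Cmod E)).
    - apply Rmult_le_compat; [apply pow_le, Cmod_ge_0|left; apply exp_pos| |now apply exp_monotone].
      apply pow_incr. split; [apply Cmod_ge_0|trivial].
    - rewrite Rpow_mult_distr, Rmult_plus_distr_r, exp_plus.
      replace (Cmod E ^ N * (K1 * Cmod (w s)) ^ N * exp (K1 * W * Cmod E)) with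
        ((K1 * Cmod (w s)) ^ N * (Cmod E ^ N * exp (K1 * W * Cmod E))) by ring.
      apply Rmult_le_compat_l.
      + apply pow_le, Rmult_le_pos; trivial. apply Cmod_ge_0.
      + apply Rmult_le_compat_r; [left; apply exp_pos|]. now apply pow_le_exp. }
  assert (h2 : Cmod (partial_sum (fun m => (E ^ m / INR (fact m)) * (Bf s * X s ^ m -
      partial_sum (fun n => fps_mul b (fun j => Bell j m c) n * w s ^ n) N))%C N) <=
    INR N * (K3 * Cmod (w s) ^ N * exp ((INR N + K1 * W) * Cmod E))).
  { apply Cmod_partial_sum. intros m hmN. rewrite Cmod_mult, Rmult_comm.
    apply Rmult_le_compat; try apply Cmod_ge_0; [now apply h3|].
    assert (hf : 1 <= INR (fact m)).
    { change 1 with (INR 1). apply le_INR. generalize (lt_O_fact m). lia. }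
    rewrite Cmod_div, Cmod_pow, Cmod_R_pos by (try apply RtoC_neq_0; lra).
    apply Rle_trans with (Cmod E ^ m).
    - assert (hEm : 0 <= Cmod E ^ m) by now apply pow_le.
      apply Rmult_le_reg_r with (INR (fact m)); [lra|].
      unfold Rdiv. rewrite Rmult_assoc, Rinv_l by lra. nra.
    - eapply Rle_trans; [now apply pow_le_exp|]. apply exp_monotone.
      apply Rmult_le_compat_r; trivial. assert (INR m <= INR N) by (apply le_INR; lia). lra. }
  eapply Rle_trans; [apply Cmod_triangle|]. lra.
Qed.

(** * Limits of curves and improper integrals *)

Notation filterlim_C f F l := (@filterlim _ C f F (@locally C_R_NormedModule l)).

Lemma filterlim_C_eps {T : Type} (F : (T -> Prop) -> Prop) {FF : Filter F} (f : T -> C) (l : C) :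
  filterlim_C f F l <-> forall eps, 0 < eps -> F (fun x => Cmod (f x - l)%C < eps).
Proof.
  split.
  - intros H eps heps.
    assert (h := proj1 (filterlim_locally_ball_norm (K := R_AbsRing) (U := C_R_NormedModule)
      f l) H (mkposreal eps heps)).
    eapply filter_imp; [|exact h]. intros x hx.
    unfold ball_norm in hx. now rewrite Cmod_norm_R in hx.
  - intros H.
    apply (filterlim_locally_ball_norm (K := R_AbsRing) (U := C_R_NormedModule) f l).
    intros eps. eapply filter_imp; [|exact (H eps (cond_pos eps))]. intros x hx.
    unfold ball_norm. now rewrite Cmod_norm_R.
Qed.

Lemma filterlim_R_eps {T : Type} (F : (T -> Prop) -> Prop) {FF : Filter F} (f : T -> R) (l : R) :
  filterlim f F (locally l) <-> forall eps, 0 < eps -> F (fun x => Rabs (f x - l) < eps).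
Proof.
  split.
  - intros H eps heps.
    exact (proj1 (filterlim_locally (U := R_UniformSpace) f l) H (mkposreal eps heps)).
  - intros H. apply (filterlim_locally (U := R_UniformSpace) f l).
    intros eps. exact (H eps (cond_pos eps)).
Qed.

(** Increments dominated by those of a real function with a limit satisfy the Cauchy criterion; the
    last clause bounds what is still missing from the limit. Convergence at both ends of the contour
    and at both ends of the Faxen integral is obtained this way. *)
Lemma dominated_limit {T : Type} (F : (T -> Prop) -> Prop) {FF : ProperFilter F}
    (f : T -> C) (G : T -> R) (P : T -> Prop) (g : R) :
  F P -> (forall x y, P x -> P y -> Cmod (f y - f x)%C <= Rabs (G y - G x)) ->
  filterlim G F (locally g) ->
  exists l : C, filterlim_C f F l /\ forall x, P x -> Cmod (l - f x)%C <= Rabs (g - G x).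
Proof.
  intros HP hle HG.
  assert (HG' := proj1 (filterlim_R_eps F G g) HG).
  destruct (proj1 (filterlim_locally_cauchy (U := C_R_CompleteNormedModule) (F := F) f))
    as [l hl].
  - intros eps. exists (fun x => P x /\ Rabs (G x - g) < eps / 2). split.
    + apply filter_and; trivial. apply HG'. generalize (cond_pos eps). lra.
    + intros u v [hu hu'] [hv hv'].
      apply (norm_compat1 (V := C_R_NormedModule)). rewrite Cmod_norm_R.
      eapply Rle_lt_trans; [exact (hle u v hu hv)|].
      replace (G v - G u) with ((G v - g) - (G u - g)) by ring.
      eapply Rle_lt_trans; [apply Rabs_triang|]. rewrite Rabs_Ropp. lra.
  - exists l. split; [exact hl|]. intros x hx. apply le_epsilon. intros eps heps.
    assert (h1 := proj1 (filterlim_C_eps F f l) hl (eps / 2) ltac:(lra)).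
    assert (h2 := HG' (eps / 2) ltac:(lra)).
    destruct (filter_ex _ (filter_and _ _ HP (filter_and _ _ h1 h2))) as [y [hy [a1 a2]]].
    replace (l - f x)%C with ((f y - f x) - (f y - l))%C by ring.
    eapply Rle_trans; [apply Cmod_triangle_minus|].
    assert (a3 := hle x y hx hy).
    replace (G y - G x) with ((G y - g) + (g - G x)) in a3 by ring.
    assert (a4 := Rabs_triang (G y - g) (g - G x)). lra.
Qed.

(** [P] is only required to give the integrals over compact pieces; it need not be differentiable,
    so break points of the contour do no harm. *)
Lemma is_RInt_gen_primitive (Fa Fb : (R -> Prop) -> Prop) {FFa : Filter Fa} {FFb : Filter Fb}
    (f P : R -> C) (la lb : C) :
  filter_prod Fa Fb (fun ab => is_RInt (V := C_R_NormedModule) f (fst ab) (snd ab)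
    (P (snd ab) - P (fst ab))%C) ->
  filterlim_C P Fa la -> filterlim_C P Fb lb ->
  is_RInt_gen (V := C_R_NormedModule) f Fa Fb (lb - la)%C.
Proof.
  intros H Ha Hb Q [eps hQ].
  assert (ha := proj1 (filterlim_C_eps Fa P la) Ha (eps / 2) ltac:(generalize (cond_pos eps); lra)).
  assert (hb := proj1 (filterlim_C_eps Fb P lb) Hb (eps / 2) ltac:(generalize (cond_pos eps); lra)).
  assert (X : filter_prod Fa Fb (fun ab => Cmod (P (fst ab) - la)%C < eps / 2 /\
    Cmod (P (snd ab) - lb)%C < eps / 2)) by (econstructor; [exact ha|exact hb|]; auto).
  unfold filtermapi. eapply filter_imp; [|apply (filter_and _ _ H X)].
  intros [x y] [h1 [h2 h3]]. simpl in *.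
  exists (P y - P x)%C. split; [exact h1|]. apply hQ.
  apply (norm_compat1 (V := C_R_NormedModule)). rewrite Cmod_norm_R.
  change (Cmod ((P y - P x) - (lb - la))%C < eps).
  replace ((P y - P x) - (lb - la))%C with ((P y - lb) - (P x - la))%C by ring.
  eapply Rle_lt_trans; [apply Cmod_triangle_minus|]. lra.
Qed.

(** * The Faxen integral *)

(** The tangent of the exponential, taken at [ln (b / eps)] where [eps * exp] has slope [b]. *)
Lemma linear_le_exp (b eps : R) : 0 < eps ->
  exists K, forall x, 0 <= x -> b * x <= eps * exp x + K.
Proof.
  intros he. destruct (Rle_lt_dec b 0) as [hb|hb].
  - exists 0. intros x hx. assert (h := exp_pos x). nra.
  - exists (b * (ln (b / eps) - 1)). intros x _.
    assert (h := exp_ineq1_le (x - ln (b / eps))).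
    assert (hq : 0 < b / eps) by now apply Rdiv_lt_0_compat.
    assert (e : eps * exp x = b * exp (x - ln (b / eps))).
    { unfold Rminus. rewrite exp_plus, exp_Ropp, exp_ln by trivial. field. lra. }
    rewrite e. nra.
Qed.

(** This is what nu < mu is for. Beyond [x0] the quotient of the two exponentials is at most
    [eps / A]; up to [x0] the left side is bounded by its value there. *)
Lemma exp_sublinear (A kappa eps : R) : 0 <= A -> 0 <= kappa < 1 -> 0 < eps ->
  exists K, 0 <= K /\ forall x, A * exp (kappa * x) <= eps * exp x + K.
Proof.
  intros hA hk he. destruct (Req_dec A 0) as [->|hA0].
  { exists 0. split; [lra|]. intros x. generalize (exp_pos x). nra. }
  set (x0 := ln (A / eps) / (1 - kappa)).
  exists (A * exp (kappa * x0)). split.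
  { apply Rmult_le_pos; trivial. left; apply exp_pos. }
  intros x. assert (hx := exp_pos x). destruct (Rle_lt_dec x x0) as [h|h].
  - assert (exp (kappa * x) <= exp (kappa * x0)).
    { apply exp_monotone. apply Rmult_le_compat_l; lra. }
    assert (A * exp (kappa * x) <= A * exp (kappa * x0)) by now apply Rmult_le_compat_l.
    assert (0 < eps * exp x) by now apply Rmult_lt_0_compat. lra.
  - assert (hq : 0 < A / eps) by (apply Rdiv_lt_0_compat; lra).
    assert (h1 : exp (kappa * x) <= exp x * (eps / A)).
    { replace (kappa * x) with (x + - ((1 - kappa) * x)) by ring. rewrite exp_plus.
      apply Rmult_le_compat_l; [lra|].
      replace (eps / A) with (exp (- ln (A / eps))).
      - apply exp_monotone. apply Ropp_le_contravar.
        replace (ln (A / eps)) with ((1 - kappa) * x0) by (unfold x0; field; lra).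
        apply Rmult_le_compat_l; lra.
      - rewrite exp_Ropp, exp_ln by trivial. field. lra. }
    assert (A * exp (kappa * x) <= A * (exp x * (eps / A))) by now apply Rmult_le_compat_l.
    replace (A * (exp x * (eps / A))) with (eps * exp x) in H by (field; trivial).
    assert (0 <= A * exp (kappa * x0)) by (apply Rmult_le_pos; trivial; left; apply exp_pos).
    lra.
Qed.

Lemma cos_ge_sin (delta y : R) : 0 < delta -> Rabs y <= PI / 2 - delta -> sin delta <= cos y.
Proof.
  intros hd hy. assert (h := Rabs_pos y). assert (hpi := PI_RGT_0).
  replace (cos y) with (cos (Rabs y)).
  - rewrite <- cos_shift. apply cos_decr_1; lra.
  - unfold Rabs. destruct (Rcase_abs y); [apply cos_neg|reflexivity].
Qed.

Section Faxen.

Variables (kappa delta : R) (beta c0 : C).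
Hypotheses (hkappa : 0 <= kappa < 1) (hdelta : 0 < delta <= PI / 2) (hbeta : 0 < Re beta).

(* The integrand of [Faxen kappa beta c0] with the variable [exp xi]; it is entire in [xi]. *)
Definition faxen_log (xi : C) : C :=
  Cexp (- Cexp xi + c0 * Cexp (kappa * xi) + beta * xi).

Lemma sin_delta_pos : 0 < sin delta.
Proof. apply sin_gt_0; generalize PI_RGT_0; lra. Qed.

Lemma faxen_log_Qdiff : exists h', Qdiff faxen_log h'.
Proof.
  assert (lin : forall c, Qdiff (fun z => c * z)%C (fun _ => c)).
  { intros c. apply (Qdiff_ext (fun z => c * z + 0)%C); [intros z; ring|].
    apply Qdiff_affine. }
  eexists. apply (Qdiff_comp Cexp Cexp); [apply Qdiff_Cexp|].
  apply (Qdiff_plus (fun xi => - Cexp xi + c0 * Cexp (kappa * xi))%C);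
    [|apply (lin beta)].
  apply (Qdiff_plus (fun xi => - Cexp xi)%C).
  - apply (Qdiff_ext (fun z => -1 * Cexp z)%C); [intros z; ring|].
    apply (Qdiff_comp _ _ _ _ (lin (RtoC (-1))) Qdiff_Cexp).
  - apply (Qdiff_comp (fun z => c0 * z)%C (fun _ => c0) (fun z => Cexp (kappa * z)));
      [apply lin|].
    apply (Qdiff_comp Cexp Cexp (fun z => kappa * z)%C); [apply Qdiff_Cexp|apply lin].
Qed.

Let eta := sin delta / 2.

(** In the strip the cosine is at least [sin delta]. Half of this decay pays for the term in [c0],
    which leaves [eta = sin delta / 2]; the imaginary part of [beta] costs only a constant because
    [Im xi] is bounded. *)
Lemma faxen_log_bound : exists K, 0 <= K /\ forall xi, Rabs (Im xi) <= PI / 2 - delta ->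
  Cmod (faxen_log xi) <= K * exp (Re beta * Re xi - eta * exp (Re xi)).
Proof.
  assert (hs := sin_delta_pos).
  destruct (exp_sublinear (Cmod c0) kappa eta (Cmod_ge_0 c0) hkappa) as [K1 [hK1 H1]].
  { unfold eta; lra. }
  exists (exp (K1 + Rabs (Im beta) * (PI / 2))). split; [left; apply exp_pos|].
  intros xi hxi. unfold faxen_log. rewrite Cmod_Cexp, <- exp_plus. apply exp_monotone.
  set (x := Re xi) in *.
  assert (e1 : Re (- Cexp xi) <= - (sin delta * exp x)).
  { change (- (exp x * cos (Im xi)) <= - (sin delta * exp x)).
    apply Ropp_le_contravar. rewrite Rmult_comm. apply Rmult_le_compat_l.
    - left; apply exp_pos.
    - apply cos_ge_sin; lra. }
  assert (e2 : Re (c0 * Cexp (kappa * xi)) <= eta * exp x + K1).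
  { eapply Rle_trans; [apply Rle_abs|]. eapply Rle_trans; [apply re_le_Cmod|].
    rewrite Cmod_mult, Cmod_Cexp.
    replace (Re (kappa * xi)) with (kappa * x) by (unfold x; simpl; unfold Re; ring).
    apply H1. }
  assert (e3 : Re (beta * xi) <= Re beta * x + Rabs (Im beta) * (PI / 2)).
  { change (Re (beta * xi)) with (Re beta * x - Im beta * Im xi).
    assert (- (Im beta * Im xi) <= Rabs (Im beta) * (PI / 2)).
    { eapply Rle_trans; [apply Rle_abs|]. rewrite Rabs_Ropp, Rabs_mult.
      apply Rmult_le_compat_l; [apply Rabs_pos|]. lra. }
    lra. }
  change (Re (- Cexp xi + c0 * Cexp (kappa * xi) + beta * xi)) with
    (Re (- Cexp xi) + Re (c0 * Cexp (kappa * xi)) + Re (beta * xi)).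
  unfold eta in *. lra.
Qed.

Lemma is_deriv_curve_horizontal (y x : R) : is_deriv_curve (fun u => (u, y) : C) x (RtoC 1).
Proof.
  apply is_derive_ext with (fun u : R => ((0, y) : C) + u * 1)%C.
  - intros u. unfold Cplus, Cmult; simpl. apply injective_projections; simpl; ring.
  - apply is_deriv_curve_line.
Qed.

Lemma is_deriv_curve_vertical (x y : R) : is_deriv_curve (fun u => (x, u) : C) y Ci.
Proof.
  apply is_derive_ext with (fun u : R => ((x, 0) : C) + u * Ci)%C.
  - intros u. unfold Cplus, Cmult, Ci; simpl. apply injective_projections; simpl; ring.
  - apply is_deriv_curve_line.
Qed.

(** Normalised to vanish at the left end of the strip, the primitive is the Faxen integral up to the
    given point, along whatever path. It is controlled on the real axis by explicit real majorants,
    and off the axis by a vertical segment shorter than [PI / 2]. *)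
Lemma faxen_primitive : exists (H : C -> C) (K : R), 0 <= K /\
  (forall xi, Cdiff H xi (faxen_log xi)) /\
  (forall xi, Rabs (Im xi) <= PI / 2 - delta ->
    Cmod (H xi) <= K * exp (Re beta * Re xi)) /\
  (forall xi, Rabs (Im xi) <= PI / 2 - delta -> 0 <= Re xi ->
    Cmod (H xi - Faxen kappa beta c0)%C <= K * exp (- (eta / 2) * exp (Re xi))).
Proof.
  assert (hs := sin_delta_pos). assert (heta : 0 < eta) by (unfold eta; lra).
  destruct faxen_log_Qdiff as [h' hQ].
  destruct (entire_primitive _ _ hQ) as [H hH].
  destruct faxen_log_bound as [K [hK hb]].
  set (b := Re beta) in *.
  assert (hreal : forall x, Cmod (faxen_log (RtoC x)) <= K * exp (b * x - eta * exp x)).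
  { intros x. apply hb. simpl. rewrite Rabs_R0. lra. }
  assert (dH : forall x : R, is_deriv_curve (fun u => H (RtoC u)) x (faxen_log x)).
  { intros x. eapply is_deriv_curve_eq.
    - eapply (Cdiff_curve H (fun u => RtoC u)); [apply hH|]. apply is_deriv_curve_horizontal.
    - simpl. ring. }
  assert (hvert : forall xi, Rabs (Im xi) <= PI / 2 - delta ->
    Cmod (H xi - H (RtoC (Re xi)))%C <= PI / 2 * (K * exp (b * Re xi - eta * exp (Re xi)))).
  { intros [x y] hy. simpl in hy |- *.
    set (k := K * exp (b * x - eta * exp x)).
    assert (hk : 0 <= k) by (apply Rmult_le_pos; trivial; left; apply exp_pos).
    assert (X : forall s t, s <= t -> - (PI / 2 - delta) <= s -> t <= PI / 2 - delta ->
      Cmod (H ((x, t) : C) - H ((x, s) : C))%C <= k * t - k * s).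
    { intros s t hst h1 h2.
      apply (curve_mean_value (fun u : R => H ((x, u) : C)) (fun u => faxen_log ((x, u) : C) * Ci)%C
        (fun u => k * u) (fun _ => k)); trivial.
      - intros u hu. eapply (Cdiff_curve H (fun u => (x, u) : C)); [apply hH|].
        apply is_deriv_curve_vertical.
      - intros u _. apply is_derive_scal_id.
      - intros u hu. rewrite Cmod_mult, Cmod_Ci, Rmult_1_r. apply (hb ((x, u) : C)).
        simpl. apply Rabs_le. lra. }
    apply Rabs_le_between in hy. destruct hy as [hy1 hy2].
    change (RtoC x) with ((x, 0) : C).
    destruct (Rle_lt_dec 0 y) as [h0|h0].
    - eapply Rle_trans; [apply X; lra|]. nra.
    - rewrite Cmod_minus_sym. eapply Rle_trans; [apply X; lra|]. nra. }
  assert (hleft : forall x y, x <= y ->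
    Cmod (H (RtoC y) - H (RtoC x))%C <= K / b * exp (b * y) - K / b * exp (b * x)).
  { intros x y hxy.
    apply (curve_mean_value (fun u : R => H (RtoC u)) (fun u => faxen_log (RtoC u))
      (fun u => K / b * exp (b * u)) (fun u => K * exp (b * u))); [exact hxy| | |].
    - intros u _. apply dH.
    - intros u _. auto_derive; trivial. field. lra.
    - intros u _. eapply Rle_trans; [apply hreal|]. apply Rmult_le_compat_l; trivial.
      apply exp_monotone. assert (h := exp_pos u). nra. }
  assert (hGm : filterlim (fun x => K / b * exp (b * x)) (Rbar_locally m_infty) (locally 0)).
  { replace 0 with (K / b * 0) by ring.
    apply (is_lim_scal_l (fun x => exp (b * x)) (K / b) m_infty 0).
    apply (is_lim_comp exp (fun x => b * x) m_infty 0 m_infty).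
    - apply is_lim_exp_m.
    - assert (e : Rbar_mult b m_infty = m_infty).
      { simpl. destruct (Rle_dec 0 b) as [h|h]; [|lra].
        destruct (Rle_lt_or_eq_dec 0 b h); [reflexivity|lra]. }
      generalize (is_lim_scal_l (fun x => x) b m_infty m_infty (is_lim_id _)).
      now rewrite e.
    - exists 0. intros x _. discriminate. }
  destruct (dominated_limit (Rbar_locally m_infty) (fun x : R => H (RtoC x))
    (fun x => K / b * exp (b * x)) (fun _ => True) 0) as [Lm [hLm hLmb]].
  { apply filter_true. }
  { intros x y _ _. destruct (Rle_lt_dec x y) as [h|h].
    - eapply Rle_trans; [now apply hleft|apply Rle_abs].
    - rewrite Cmod_minus_sym, Rabs_minus_sym.
      eapply Rle_trans; [apply hleft; lra|apply Rle_abs]. }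
  { exact hGm. }
  (* Half of the decay turns the factor [exp (b * x)] into a constant. The second instance keeps one
     unit of [b], because the derivative of [exp (- (eta / 2) * exp u)] brings a factor [exp u]. *)
  destruct (linear_le_exp b (eta / 2)) as [K2 hK2]; [lra|].
  destruct (linear_le_exp (b - 1) (eta / 2)) as [K3 hK3]; [lra|].
  set (K4 := K * exp K3 * (2 / eta)).
  assert (hK4 : 0 <= K4).
  { assert (0 < 2 / eta) by (apply Rdiv_lt_0_compat; lra).
    apply Rmult_le_pos; [|lra]. apply Rmult_le_pos; trivial. left; apply exp_pos. }
  assert (hright : forall x y, 0 <= x <= y ->
    Cmod (H (RtoC y) - H (RtoC x))%C <=
      - K4 * exp (- (eta / 2) * exp y) - - K4 * exp (- (eta / 2) * exp x)).
  { intros x y hxy.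
    apply (curve_mean_value (fun u : R => H (RtoC u)) (fun u => faxen_log (RtoC u))
      (fun u => - K4 * exp (- (eta / 2) * exp u))
      (fun u => K * exp K3 * (exp u * exp (- (eta / 2) * exp u)))); [lra| | |].
    - intros u _. apply dH.
    - intros u _. auto_derive; trivial. unfold K4. field. lra.
    - intros u hu. eapply Rle_trans; [apply hreal|].
      rewrite Rmult_assoc. apply Rmult_le_compat_l; trivial.
      rewrite <- !exp_plus. apply exp_monotone. specialize (hK3 u ltac:(lra)). lra. }
  assert (hGp : filterlim (fun x => - K4 * exp (- (eta / 2) * exp x)) (Rbar_locally p_infty)
    (locally 0)).
  { replace 0 with (- K4 * 0) by ring.
    apply (is_lim_scal_l (fun x => exp (- (eta / 2) * exp x)) (- K4) p_infty 0).
    apply (is_lim_comp exp (fun x => - (eta / 2) * exp x) p_infty 0 m_infty).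
    - apply is_lim_exp_m.
    - assert (e : Rbar_mult (- (eta / 2)) p_infty = m_infty).
      { simpl. destruct (Rle_dec 0 (- (eta / 2))) as [h|h]; [exfalso; lra|reflexivity]. }
      generalize (is_lim_scal_l exp (- (eta / 2)) p_infty p_infty is_lim_exp_p).
      now rewrite e.
    - exists 0. intros x _. discriminate. }
  destruct (dominated_limit (Rbar_locally p_infty) (fun x : R => H (RtoC x))
    (fun x => - K4 * exp (- (eta / 2) * exp x)) (fun x => 0 <= x) 0) as [Lp [hLp hLpb]].
  { exists 0. intros x hx; lra. }
  { intros x y hx hy. destruct (Rle_lt_dec x y) as [h|h].
    - eapply Rle_trans; [apply hright; lra|apply Rle_abs].
    - rewrite Cmod_minus_sym, Rabs_minus_sym.
      eapply Rle_trans; [apply hright; lra|apply Rle_abs]. }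
  { exact hGp. }
  (* The substitution t = exp x: [H (ln t)] is a primitive of the Faxen integrand, and dx = dt / t
     lowers the exponent [beta] to [beta - 1]. *)
  assert (hF : Faxen kappa beta c0 = (Lp - Lm)%C).
  { unfold Faxen.
    apply (is_RInt_gen_unique (V := C_R_CompleteNormedModule)).
    apply (is_RInt_gen_primitive _ _ _ (fun t => H (RtoC (ln t)))).
    - exists (fun x => 0 < x) (fun y => 0 < y).
      + exists (mkposreal 1 Rlt_0_1). intros y _ hy. exact hy.
      + exists 0. trivial.
      + intros x y hx hy. simpl.
        assert (dln : forall t, 0 < t -> is_deriv_curve (fun t => RtoC (ln t)) t (RtoC (/ t))).
        { intros t ht. apply is_deriv_curve_pair; simpl.
          - auto_derive; trivial. field. lra.
          - apply (is_derive_const (V := R_NormedModule)). }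
        assert (pos : forall t, Rmin x y <= t <= Rmax x y -> 0 < t).
        { intros t ht. assert (0 < Rmin x y) by now apply Rmin_pos. lra. }
        assert (e : forall t, 0 < t ->
          (Cexp (- t + c0 * Rpower t kappa) * polar_pow t 0 (beta - 1))%C
            = (faxen_log (RtoC (ln t)) * RtoC (/ t))%C).
        { intros t ht. unfold faxen_log, polar_pow, Rpower.
          generalize (eq_sym (exp_ln t ht)). generalize (ln t). intros u ->.
          change ((u, 0) : C) with (RtoC u).
          rewrite RtoC_inv by (apply Rgt_not_eq, exp_pos).
          rewrite <- !Cexp_RtoC, RtoC_mult, <- Cexp_opp, <- !Cexp_plus.
          f_equal. ring. }
        apply is_RInt_ext with (fun t => (faxen_log (RtoC (ln t)) * RtoC (/ t))%C).
        { intros t ht. symmetry. apply e, pos. lra. }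
        apply (is_RInt_derive (V := C_R_CompleteNormedModule) (fun t => H (RtoC (ln t)))).
        * intros t ht. eapply (Cdiff_curve H (fun t => RtoC (ln t))); [apply hH|].
          apply dln, pos, ht.
        * intros t ht. specialize (pos t ht). eapply is_deriv_curve_continuous.
          apply is_deriv_curve_mult.
          -- apply (Cdiff_curve faxen_log (fun t => RtoC (ln t)));
               [apply Qdiff_Cdiff, hQ|now apply dln].
          -- apply is_deriv_curve_pair; simpl.
             ++ instantiate (1 := RtoC (- / (t * t))). simpl. auto_derive; [lra|]. field. lra.
             ++ apply (is_derive_const (V := R_NormedModule)).
    - apply (filterlim_comp _ _ _ ln (fun x => H (RtoC x)) _ (Rbar_locally m_infty)); trivial.
      apply is_lim_ln_0.
    - apply (filterlim_comp _ _ _ ln (fun x => H (RtoC x)) _ (Rbar_locally p_infty)); trivial.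
      apply is_lim_ln_p. }
  exists (fun xi => H xi - Lm)%C, (PI / 2 * K + K / b + PI / 2 * (K * exp K2) + K4).
  assert (hpi := PI_RGT_0).
  assert (p1 : 0 <= PI / 2 * K) by (apply Rmult_le_pos; lra).
  assert (p2 : 0 <= K / b) by (apply Rdiv_le_0_compat; lra).
  assert (p3 : 0 <= PI / 2 * (K * exp K2)).
  { apply Rmult_le_pos; [lra|]. apply Rmult_le_pos; trivial. left; apply exp_pos. }
  split; [lra|]. split; [|split].
  - intros xi eps heps. destruct (hH xi eps heps) as [d [hd X]]. exists d. split; trivial.
    intros k hk. specialize (X k hk).
    replace (H (xi + k)%C - Lm - (H xi - Lm) - faxen_log xi * k)%C
      with (H (xi + k)%C - H xi - faxen_log xi * k)%C by ring. exact X.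
  - intros xi hxi.
    replace (H xi - Lm)%C with ((H xi - H (RtoC (Re xi))) - (Lm - H (RtoC (Re xi))))%C by ring.
    eapply Rle_trans; [apply Cmod_triangle_minus|].
    assert (a1 := hvert xi hxi). assert (a2 := hLmb (Re xi) I).
    assert (hE := exp_pos (b * Re xi)).
    rewrite Rminus_0_l, Rabs_Ropp, Rabs_pos_eq in a2 by (apply Rmult_le_pos; lra).
    assert (a3 : exp (b * Re xi - eta * exp (Re xi)) <= exp (b * Re xi)).
    { apply exp_monotone. assert (h := exp_pos (Re xi)). nra. }
    assert (a4 : PI / 2 * (K * exp (b * Re xi - eta * exp (Re xi))) <= PI / 2 * K * exp (b * Re xi)).
    { rewrite Rmult_assoc. apply Rmult_le_compat_l; [lra|]. now apply Rmult_le_compat_l. }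
    assert (0 <= (PI / 2 * (K * exp K2) + K4) * exp (b * Re xi))
      by (apply Rmult_le_pos; lra).
    lra.
  - intros xi hxi hx. rewrite hF.
    replace (H xi - Lm - (Lp - Lm))%C with ((H xi - H (RtoC (Re xi))) - (Lp - H (RtoC (Re xi))))%C
      by ring.
    eapply Rle_trans; [apply Cmod_triangle_minus|].
    assert (a1 := hvert xi hxi). assert (a2 := hLpb (Re xi) hx).
    set (E := exp (- (eta / 2) * exp (Re xi))) in *.
    assert (hE : 0 < E) by apply exp_pos.
    replace (0 - - K4 * E) with (K4 * E) in a2 by ring.
    rewrite Rabs_pos_eq in a2 by (apply Rmult_le_pos; lra).
    assert (a3 : exp (b * Re xi - eta * exp (Re xi)) <= exp K2 * E).
    { unfold E. rewrite <- exp_plus. apply exp_monotone. specialize (hK2 (Re xi) hx). lra. }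
    assert (a4 : PI / 2 * (K * exp (b * Re xi - eta * exp (Re xi))) <= PI / 2 * (K * exp K2) * E).
    { replace (PI / 2 * (K * exp K2) * E) with (PI / 2 * (K * (exp K2 * E))) by ring.
      apply Rmult_le_compat_l; [lra|]. now apply Rmult_le_compat_l. }
    assert (0 <= (PI / 2 * K + K / b) * E) by (apply Rmult_le_pos; lra).
    lra.
Qed.

End Faxen.

(** * The contour: continuity, integrability and its behaviour at the start *)

Notation continuous_C f s := (@continuous R_UniformSpace C_UniformSpace f s).

Lemma chain_lt (gamma : R -> C) (x y : R) : smooth_chain gamma x y -> x < y.
Proof. induction 1; lra. Qed.

Lemma chain_first_arc (gamma : R -> C) (x z : R) : smooth_chain gamma x z ->
  exists y, x < y <= z /\ smooth_arc gamma x y.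
Proof.
  induction 1 as [x y hxy harc | x y z h1 [t [ht harc]] h2 _].
  - exists y. split; [lra|trivial].
  - exists t. assert (h := chain_lt _ _ _ h2). split; [lra|trivial].
Qed.

Lemma chain_continuous_within (gamma : R -> C) (x y : R) : smooth_chain gamma x y ->
  forall s, x <= s <= y ->
    filterlim gamma (within (fun u => x <= u <= y) (locally s)) (locally (gamma s)).
Proof.
  induction 1 as [x y hxy [h _] | x y z c1 h1 c2 h2].
  - exact h.
  - intros s hs P hP. assert (l1 := chain_lt _ _ _ c1). assert (l2 := chain_lt _ _ _ c2).
    assert (e1 : locally s (fun u => x <= u <= y -> P (gamma u))).
    { destruct (Rle_lt_dec s y) as [hsy|hsy].
      - exact (h1 s ltac:(lra) P hP).
      - exists (mkposreal (s - y) ltac:(lra)). intros u hu hu'.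
        assert (hb : Rabs (u - s) < s - y) by exact hu. apply Rabs_def2 in hb. lra. }
    assert (e2 : locally s (fun u => y <= u <= z -> P (gamma u))).
    { destruct (Rle_lt_dec y s) as [hsy|hsy].
      - exact (h2 s ltac:(lra) P hP).
      - exists (mkposreal (y - s) ltac:(lra)). intros u hu hu'.
        assert (hb : Rabs (u - s) < y - s) by exact hu. apply Rabs_def2 in hb. lra. }
    change (locally s (fun u => x <= u <= z -> P (gamma u))).
    eapply filter_imp; [|apply (filter_and _ _ e1 e2)].
    intros u [a1 a2] hu. destruct (Rle_lt_dec u y); [apply a1|apply a2]; lra.
Qed.

Lemma chain_continuous (gamma : R -> C) (x y s : R) : smooth_chain gamma x y ->
  x < s < y -> continuous_C gamma s.
Proof.
  intros h hs P hP.
  assert (H := chain_continuous_within _ _ _ h s ltac:(lra) P hP).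
  assert (E : locally s (fun u => x < u < y)).
  { exists (mkposreal (Rmin (s - x) (y - s)) ltac:(apply Rmin_pos; lra)). intros u hu.
    assert (hb : Rabs (u - s) < Rmin (s - x) (y - s)) by exact hu.
    assert (a1 := Rmin_l (s - x) (y - s)). assert (a2 := Rmin_r (s - x) (y - s)).
    apply Rabs_def2 in hb. lra. }
  change (locally s (fun u => x <= u <= y -> P (gamma u))) in H.
  change (locally s (fun u => P (gamma u))).
  eapply filter_imp; [|apply (filter_and _ _ H E)]. intros u [b1 b2]. apply b1. lra.
Qed.

Lemma continuous_C_eps (f : R -> C) (s : R) : continuous_C f s <->
  forall eps, 0 < eps -> exists d, 0 < d /\ forall u, Rabs (u - s) < d ->
    Cmod (f u - f s)%C < eps.
Proof.
  split.
  - intros H eps heps.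
    destruct (proj1 (filterlim_C_eps (locally s) f (f s)) H eps heps) as [d hd].
    exists d. split; [apply cond_pos|]. exact hd.
  - intros H. apply (proj2 (filterlim_C_eps (locally s) f (f s))). intros eps heps.
    destruct (H eps heps) as [d [hd0 hd]]. exists (mkposreal d hd0). exact hd.
Qed.

Lemma continuous_C_const (c : C) (s : R) : continuous_C (fun _ => c) s.
Proof. apply continuous_const. Qed.

Lemma continuous_C_plus (f g : R -> C) (s : R) :
  continuous_C f s -> continuous_C g s -> continuous_C (fun u => f u + g u)%C s.
Proof. apply (continuous_plus (V := C_R_NormedModule)). Qed.

Lemma continuous_C_mult (f g : R -> C) (s : R) :
  continuous_C f s -> continuous_C g s -> continuous_C (fun u => f u * g u)%C s.
Proof.
  rewrite !continuous_C_eps. intros Hf Hg eps heps.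
  set (A := Cmod (f s) + 1). set (B := Cmod (g s) + 1).
  assert (hA : 0 < A) by (unfold A; generalize (Cmod_ge_0 (f s)); lra).
  assert (hB : 0 < B) by (unfold B; generalize (Cmod_ge_0 (g s)); lra).
  destruct (Hf (Rmin 1 (eps / (2 * B)))) as [d1 [hd1 h1]].
  { apply Rmin_pos; [lra|]. apply Rdiv_lt_0_compat; lra. }
  destruct (Hg (eps / (2 * A))) as [d2 [hd2 h2]]; [apply Rdiv_lt_0_compat; lra|].
  exists (Rmin d1 d2). split; [now apply Rmin_pos|]. intros u hu.
  assert (k1 := h1 u (Rlt_le_trans _ _ _ hu (Rmin_l _ _))).
  assert (k2 := h2 u (Rlt_le_trans _ _ _ hu (Rmin_r _ _))).
  assert (k3 := Rlt_le_trans _ _ _ k1 (Rmin_l _ _)).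
  assert (k4 := Rlt_le_trans _ _ _ k1 (Rmin_r _ _)).
  replace (f u * g u - f s * g s)%C with (f u * (g u - g s) + (f u - f s) * g s)%C by ring.
  eapply Rle_lt_trans; [apply Cmod_triangle|]. rewrite !Cmod_mult.
  assert (hfu : Cmod (f u) <= A).
  { replace (f u) with ((f u - f s) + f s)%C by ring.
    eapply Rle_trans; [apply Cmod_triangle|]. unfold A. lra. }
  assert (e1 : Cmod (f u) * Cmod (g u - g s) <= A * Cmod (g u - g s))
    by (apply Rmult_le_compat_r; trivial; apply Cmod_ge_0).
  assert (e2 : A * Cmod (g u - g s) < A * (eps / (2 * A))) by now apply Rmult_lt_compat_l.
  assert (e3 : Cmod (f u - f s) * Cmod (g s) <= eps / (2 * B) * B).
  { apply Rmult_le_compat; try apply Cmod_ge_0; [lra|]. unfold B. lra. }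
  replace (A * (eps / (2 * A))) with (eps / 2) in e2 by (field; lra).
  replace (eps / (2 * B) * B) with (eps / 2) in e3 by (field; lra). lra.
Qed.

Lemma Cdiff_continuous (F : C -> C) (g : R -> C) (s : R) (l : C) :
  Cdiff F (g s) l -> continuous_C g s -> continuous_C (fun u => F (g u)) s.
Proof.
  rewrite !continuous_C_eps. intros HF Hg eps heps.
  destruct (HF 1 Rlt_0_1) as [d [hd H]].
  assert (hl := Cmod_ge_0 l).
  destruct (Hg (Rmin d (eps / (Cmod l + 1)))) as [e [he H1]].
  { apply Rmin_pos; trivial. apply Rdiv_lt_0_compat; lra. }
  exists e. split; trivial. intros u hu. specialize (H1 u hu).
  assert (a1 := Rlt_le_trans _ _ _ H1 (Rmin_l _ _)).
  assert (a2 := Rlt_le_trans _ _ _ H1 (Rmin_r _ _)).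
  specialize (H (g u - g s)%C a1). replace (g s + (g u - g s))%C with (g u) in H by ring.
  replace (F (g u) - F (g s))%C with
    ((F (g u) - F (g s) - l * (g u - g s)) + l * (g u - g s))%C by ring.
  eapply Rle_lt_trans; [apply Cmod_triangle|]. rewrite Cmod_mult.
  apply Rle_lt_trans with (Cmod (g u - g s) * (Cmod l + 1)); [lra|].
  apply Rlt_le_trans with (eps / (Cmod l + 1) * (Cmod l + 1)); [|right; field; lra].
  apply Rmult_lt_compat_r; lra.
Qed.

Lemma continuous_C_Cexp (f : R -> C) (s : R) :
  continuous_C f s -> continuous_C (fun u => Cexp (f u)) s.
Proof. apply (Cdiff_continuous Cexp f s _ (Qdiff_Cdiff _ _ _ Qdiff_Cexp)). Qed.

Lemma continuous_Cmod (f : R -> C) (s : R) :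
  continuous_C f s -> continuous (fun u => Cmod (f u)) s.
Proof.
  intros H. apply continuous_ext with (fun u => @norm R_AbsRing C_R_NormedModule (f u)).
  - intros u. apply Cmod_norm_R.
  - apply (continuous_comp f (@norm R_AbsRing C_R_NormedModule) s); trivial.
    apply (filterlim_norm (V := C_R_NormedModule)).
Qed.

(** [Phi] is the identity for the integral itself and [Cmod] for its absolute convergence.
    [derivRC gamma] need agree with the continuous derivative of an arc only in the interior; its
    values at break points do not affect integrability. *)
Lemma chain_ex_RInt {V : CompleteNormedModule R_AbsRing} (Phi : C -> V) (gamma g : R -> C)
    (x y : R) :
  (forall z, @continuous C_UniformSpace V Phi z) ->
  smooth_chain gamma x y ->
  (forall s, 0 < s < 1 -> continuous_C g s) ->
  forall c d, 0 < c -> d < 1 -> x <= c -> c <= d -> d <= y ->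
    ex_RInt (fun s => Phi (g s * derivRC gamma s)%C) c d.
Proof.
  intros hPhi H hg. induction H as [x y hxy [_ [dg [h1 h2]]] | x y z c1 IH1 c2 IH2];
    intros c d hc hd hxc hcd hdy.
  - apply ex_RInt_ext with (fun s => Phi (g s * dg s)%C).
    + intros s hs. rewrite Rmin_left, Rmax_right in hs by trivial.
      now rewrite (derivRC_correct gamma s (dg s)) by (apply h2; lra).
    + apply (ex_RInt_continuous (V := V)). intros s hs.
      rewrite Rmin_left, Rmax_right in hs by trivial.
      apply (continuous_comp (fun s => (g s * dg s)%C) Phi s); [|apply hPhi].
      apply continuous_C_mult; [apply hg; lra|]. apply h1; lra.
  - destruct (Rle_lt_dec d y) as [hdy'|hdy']; [apply IH1; lra|].
    destruct (Rle_lt_dec y c) as [hyc|hyc]; [apply IH2; lra|].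
    apply (ex_RInt_Chasles _ c y d); [apply IH1|apply IH2]; lra.
Qed.

(** Close to 0 the derivative is within half of [Cmod v] from [v], its value at 0, whence the
    factors 1/2 and 3/2. The curve is differentiable only on the open interval, so the mean value
    estimate runs from some [e > 0] to [s], and [e] tends to 0 by one-sided continuity. *)
Lemma arc_start (gamma : R -> C) (y : R) : 0 < y -> smooth_arc gamma 0 y ->
  exists (dg : R -> C) (k c1 c2 : R), 0 < k <= y /\ 0 < c1 /\ 0 < c2 /\ forall s, 0 < s < k ->
      is_deriv_curve gamma s (dg s) /\ continuous_C dg s /\ Cmod (dg s) <= c2 /\ c1 * s <= Cmod (gamma s - gamma 0)%C <= c2 * s.
Proof.
  intros hy [hcont [dg [h1 h2]]].
  destruct (h1 0 ltac:(lra)) as [hc0 hn0].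
  set (v := dg 0) in *. assert (hv : 0 < Cmod v) by now apply Cmod_gt_0.
  destruct (proj1 (continuous_C_eps dg 0) hc0 (Cmod v / 2)) as [d [hd0 hd]]; [lra|].
  exists dg, (Rmin y d), (Cmod v / 2), (Cmod v * 3 / 2).
  split; [split; [now apply Rmin_pos|apply Rmin_l]|]. split; [lra|]. split; [lra|].
  intros s hs. assert (m1 := Rmin_l y d). assert (m2 := Rmin_r y d).
  split; [apply h2; lra|]. split; [apply h1; lra|].
  assert (hdv : forall t, 0 < t < Rmin y d -> Cmod (dg t - v)%C < Cmod v / 2).
  { intros t ht. apply hd. rewrite Rminus_0_r, Rabs_pos_eq; lra. }
  split.
  { replace (dg s) with ((dg s - v) + v)%C by ring.
    eapply Rle_trans; [apply Cmod_triangle|]. specialize (hdv s hs). lra. }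
  assert (X : forall e, 0 < e <= s ->
    Cmod ((gamma s - gamma e) - (s - e) * v)%C <= Cmod v / 2 * (s - e)).
  { intros e he.
    generalize (curve_mean_value (fun t : R => gamma t - (0 + t * v))%C
      (fun t => dg t - v)%C (fun t => Cmod v / 2 * t) (fun _ => Cmod v / 2) e s).
    intros Y. cbv beta in Y.
    replace (gamma s - (0 + s * v) - (gamma e - (0 + e * v)))%C
      with (gamma s - gamma e - (s - e) * v)%C in Y by ring.
    eapply Rle_trans; [apply Y; clear Y|right; ring].
    - lra.
    - intros t ht. apply is_deriv_curve_minus; [apply h2; lra|apply is_deriv_curve_line].
    - intros t _. apply is_derive_scal_id.
    - intros t ht. left. apply hdv. lra. }
  assert (Y : Cmod ((gamma s - gamma 0%R) - s * v)%C <= Cmod v / 2 * s).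
  { apply le_epsilon. intros eps heps.
    assert (hg := hcont 0 ltac:(lra)).
    assert (hg' := proj1 (filterlim_C_eps _ gamma (gamma 0)) hg (eps / 2) ltac:(lra)).
    destruct hg' as [d1 hd1].
    set (e := Rmin (Rmin s (d1 / 2)) (eps / (2 * Cmod v))).
    assert (hd1p := cond_pos d1).
    assert (he0 : 0 < e).
    { unfold e. repeat apply Rmin_pos; try lra. apply Rdiv_lt_0_compat; lra. }
    assert (he1 : e <= Rmin s (d1 / 2)) by apply Rmin_l.
    assert (he2 : e <= s) by (eapply Rle_trans; [exact he1|apply Rmin_l]).
    assert (he3 : e <= d1 / 2) by (eapply Rle_trans; [exact he1|apply Rmin_r]).
    assert (he4 : e * Cmod v <= eps / 2).
    { replace (eps / 2) with (eps / (2 * Cmod v) * Cmod v) by (field; lra).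
      apply Rmult_le_compat_r; [lra|apply Rmin_r]. }
    assert (hb : Cmod (gamma e - gamma 0%R)%C < eps / 2).
    { apply hd1; [|lra]. change (Rabs (e - 0) < d1). rewrite Rminus_0_r, Rabs_pos_eq; lra. }
    specialize (X e ltac:(lra)).
    replace ((gamma s - gamma 0%R) - s * v)%C with
      (((gamma s - gamma e) - (s - e) * v) + (gamma e - gamma 0%R) - e * v)%C by ring.
    eapply Rle_trans; [apply Cmod_triangle_minus|].
    eapply Rle_trans; [apply Rplus_le_compat_r, Cmod_triangle|].
    rewrite Cmod_mult, Cmod_R_pos by lra.
    assert (0 <= Cmod v / 2 * e) by (apply Rmult_le_pos; lra). lra. }
  assert (hsv : Cmod (s * v) = s * Cmod v) by (rewrite Cmod_mult, Cmod_R_pos by lra; reflexivity).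
  split.
  - assert (a := Cmod_triangle_inv (s * v) (gamma s - gamma 0%R)).
    rewrite (Cmod_minus_sym (s * v)) in a. lra.
  - replace (gamma s - gamma 0%R)%C with (((gamma s - gamma 0%R) - s * v) + s * v)%C by ring.
    eapply Rle_trans; [apply Cmod_triangle|]. lra.
Qed.

Lemma at_right_0_iff (P : R -> Prop) :
  at_right 0 P <-> exists k, 0 < k /\ forall s, 0 < s < k -> P s.
Proof.
  split.
  - intros [k H]. exists k. split; [apply cond_pos|]. intros s hs. apply H; [|lra].
    change (Rabs (s - 0) < k). rewrite Rminus_0_r, Rabs_pos_eq; lra.
  - intros [k [hk H]]. exists (mkposreal k hk). intros s hs h0. apply H.
    assert (hb : Rabs (s - 0) < k) by exact hs.
    rewrite Rminus_0_r, Rabs_pos_eq in hb; lra.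
Qed.

Lemma at_left_1_iff (P : R -> Prop) :
  at_left 1 P <-> exists x, x < 1 /\ forall s, x < s < 1 -> P s.
Proof.
  split.
  - intros [k H]. exists (1 - k). split; [generalize (cond_pos k); lra|]. intros s hs.
    apply H; [|lra]. change (Rabs (s - 1) < k). rewrite Rabs_left; lra.
  - intros [x [hx H]]. exists (mkposreal (1 - x) ltac:(lra)). intros s hs h0. apply H.
    assert (hb : Rabs (s - 1) < 1 - x) by exact hs. apply Rabs_def2 in hb. lra.
Qed.

Lemma Cexp_imag (theta : R) : Cexp ((0, theta) : C) = polar 1 theta.
Proof. rewrite polar_Cexp by lra. now rewrite ln_1. Qed.

Lemma Cexp_ln (rho theta : R) : 0 < rho -> Cexp ((ln rho, theta) : C) = polar rho theta.
Proof. intros h. now rewrite polar_Cexp. Qed.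

Lemma has_ps_near_1 (F : C -> C) (l : nat -> C) : has_ps F l -> l 0%nat = 1 ->
  near0 (fun t => / 2 <= Cmod (F t) <= 2).
Proof.
  intros H h0. destruct (has_ps_unshift _ _ H) as [H1 E].
  destruct (has_ps_bounded _ _ H1) as [B [hB0 hB]].
  assert (hr : 0 < / (2 * (B + 1))) by (apply Rinv_0_lt_compat; lra).
  eapply near0_imp; [|apply (near0_and _ _ (near0_and _ _ E hB) (near0_lt _ hr))].
  intros t [[a1 a2] a3]. cbv beta in a1, a2, a3. rewrite a1, h0.
  set (y := cps _ t) in *.
  assert (a4 : Cmod (t * y) <= / 2).
  { rewrite Cmod_mult. apply Rle_trans with (/ (2 * (B + 1)) * (B + 1)).
    - apply Rmult_le_compat; try apply Cmod_ge_0; lra.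
    - right. field. lra. }
  split.
  - assert (a5 := Cmod_triangle_inv 1 (- (t * y))).
    rewrite Cmod_opp, Cmod_1 in a5.
    replace (1 - - (t * y))%C with (1 + t * y)%C in a5 by ring. lra.
  - eapply Rle_trans; [apply Cmod_triangle|]. rewrite Cmod_1. lra.
Qed.

Lemma Im_plog_small (F : C -> C) (l : nat -> C) (eps : R) : has_ps F l -> l 0%nat = 1 ->
  0 < eps -> near0 (fun t => Rabs (Im (plog (F t))) <= eps).
Proof.
  intros H h0 heps.
  destruct (derivable_continuous_pt atan 0 (derivable_pt_atan 0) eps heps) as [d [hd X]].
  destruct (has_ps_unshift _ _ H) as [H1 E].
  destruct (has_ps_bounded _ _ H1) as [B [hB0 hB]].
  assert (hr : 0 < Rmin (/ 2) (d / 3) / (B + 1)).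
  { apply Rdiv_lt_0_compat; [|lra]. apply Rmin_pos; lra. }
  eapply near0_imp; [|apply (near0_and _ _ (near0_and _ _ E hB) (near0_lt _ hr))].
  intros t [[a1 a2] a3]. cbv beta in a1, a2, a3.
  assert (m1 := Rmin_l (/ 2) (d / 3)). assert (m2 := Rmin_r (/ 2) (d / 3)).
  assert (a4 : Cmod (F t - 1) <= Rmin (/ 2) (d / 3)).
  { rewrite a1, h0. set (y := cps _ t) in *.
    replace (1 + t * y - 1)%C with (t * y)%C by ring. rewrite Cmod_mult.
    apply Rle_trans with (Rmin (/ 2) (d / 3) / (B + 1) * (B + 1)).
    - apply Rmult_le_compat; try apply Cmod_ge_0; lra.
    - right. field. lra. }
  assert (a5 := Rle_trans _ _ _ (re_le_Cmod (F t - 1)) a4).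
  assert (a6 := Rle_trans _ _ _ (im_le_Cmod (F t - 1)) a4).
  change (Re (F t - 1)) with (Re (F t) - 1) in a5.
  replace (Im (F t - 1)) with (Im (F t)) in a6 by (simpl; unfold Im; ring).
  apply Rabs_le_between in a5.
  assert (hRe : / 2 <= Re (F t)) by lra.
  assert (hq : Rabs (Im (F t) / Re (F t)) < d).
  { unfold Rdiv. rewrite Rabs_mult, Rabs_inv, (Rabs_pos_eq (Re (F t))) by lra.
    apply Rmult_lt_reg_r with (Re (F t)); [lra|].
    rewrite Rmult_assoc, Rinv_l by lra. nra. }
  unfold plog; simpl. set (z := Im (F t) / Re (F t)) in *.
  destruct (Req_dec z 0) as [->|hz]; [rewrite atan_0, Rabs_R0; lra|].
  assert (Y : Rabs (atan z - atan 0) < eps).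
  { apply X. split; [split; [exact I|auto]|]. simpl. unfold Rdist. now rewrite Rminus_0_r. }
  rewrite atan_0, Rminus_0_r in Y. lra.
Qed.

(** One point of the contour yields a disc of convergence through [ps_point_bound]. From then on the
    series is an ordinary germ in t - a, and the branch sits in a single power. *)
Lemma expands_along_cps (gamma : R -> C) (a : C) (phi : R -> R) (f : C -> C) (u : nat -> C) (e : C) :
  at_right 0 (fun s => is_arg (gamma s - a)%C (phi s)) ->
  expands_along gamma a phi f u e ->
  has_ps (cps u) u /\ at_right 0 (fun s =>
    f (gamma s) = polar_pow (Cmod (gamma s - a)) (phi s) e * cps u (gamma s - a))%C.
Proof.
  intros H1 H2.
  assert (X : at_right 0 (fun s => 0 < Cmod (gamma s - a)%C /\
    is_series_C (fun n => u n * (gamma s - a) ^ n)%C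
      (f (gamma s) / polar_pow (Cmod (gamma s - a)) (phi s) e)%C)).
  { eapply filter_imp; [|apply (filter_and _ _ H1 H2)]. intros s [[hn e1] hs].
    assert (h0 : 0 < Cmod (gamma s - a)%C) by now apply Cmod_gt_0.
    split; trivial.
    eapply is_series_C_ext; [|replace (f (gamma s) / _)%C with
      (/ polar_pow (Cmod (gamma s - a)) (phi s) e * f (gamma s))%C by (unfold Cdiv; ring);
      apply is_series_C_scal, hs].
    intros n. cbv beta. rewrite polar_pow_plus, polar_pow_nat, <- e1 by trivial.
    field. apply polar_pow_neq_0. }
  split.
  - destruct (filter_ex _ X) as [s [h0 hs]].
    destruct (ps_point_bound _ _ _ _ h0 eq_refl hs) as [Q [K [hQ [_ hK]]]].
    now apply (geom_has_ps u Q K).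
  - eapply filter_imp; [|exact X]. intros s [h0 hs].
    unfold cps. rewrite (CSeries_correct _ _ hs). field. apply polar_pow_neq_0.
Qed.

Lemma Bell_ext (n m : nat) (x y : nat -> C) :
  (forall j, x (S j) = y (S j)) -> Bell n m x = Bell n m y.
Proof.
  intros h. unfold Bell. revert n. induction m as [|m IH]; intros n; [reflexivity|].
  simpl. rewrite !fps_mul_sum. apply sum_C_ext. intros k _. rewrite IH. f_equal.
  destruct k; [reflexivity|apply h].
Qed.

(** Up to the factor [b], the quotient on the right is the derivative of - 1 / (1 + exp (b y)), a
    function of total variation 1. It gives the error term an elementary primitive, bounded
    independently of the modulus of z. *)
Lemma exp_le_bump (b eta : R) : 0 < b -> 0 < eta ->
  exists K, 0 <= K /\ forall y,
    exp (b * y - eta * exp y) <= K * (exp (b * y) / (1 + exp (b * y)) ^ 2).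
Proof.
  intros hb he. destruct (linear_le_exp (2 * b) eta he) as [K0 hK0].
  (* For [y >= 0] the square is at most 4 exp (2 b y), and [K0] absorbs this exponential; for
     [y < 0] the square is at most 4. *)
  exists (4 * (1 + exp K0)). assert (h0 := exp_pos K0). split; [lra|]. intros y.
  assert (h1 := exp_pos (b * y)). assert (h2 := exp_pos (- (eta * exp y))).
  unfold Rminus. rewrite exp_plus.
  assert (hd : 0 < (1 + exp (b * y)) ^ 2) by (apply pow_lt; lra).
  apply Rmult_le_reg_r with ((1 + exp (b * y)) ^ 2); trivial.
  replace (4 * (1 + exp K0) * (exp (b * y) / (1 + exp (b * y)) ^ 2) * (1 + exp (b * y)) ^ 2)
    with (exp (b * y) * (4 * (1 + exp K0))) by (field; lra).
  rewrite Rmult_assoc. apply Rmult_le_compat_l; [lra|].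
  assert (h3 := exp_pos y).
  destruct (Rle_lt_dec 0 y) as [hy|hy].
  - assert (h4 : 1 <= exp (b * y)) by (rewrite <- exp_0; apply exp_monotone; nra).
    assert (h5 : exp (- (eta * exp y)) * (exp (b * y) * exp (b * y)) <= exp K0).
    { rewrite <- !exp_plus. apply exp_monotone. specialize (hK0 y hy). lra. }
    assert (h6 : (1 + exp (b * y)) ^ 2 <= 4 * (exp (b * y) * exp (b * y))) by nra.
    assert (exp (- (eta * exp y)) * (1 + exp (b * y)) ^ 2 <=
      exp (- (eta * exp y)) * (4 * (exp (b * y) * exp (b * y))))
      by (apply Rmult_le_compat_l; lra).
    lra.
  - assert (h4 : exp (b * y) <= 1) by (rewrite <- exp_0; apply exp_monotone; nra).
    assert (h5 : exp (- (eta * exp y)) <= 1) by (rewrite <- exp_0; apply exp_monotone; nra).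
    assert (h6 : (1 + exp (b * y)) ^ 2 <= 4) by nra.
    assert (exp (- (eta * exp y)) * (1 + exp (b * y)) ^ 2 <= 1 * 4)
      by (apply Rmult_le_compat; lra).
    lra.
Qed.

(** Half of the remaining decay is spent on the factor [exp (L * Cmod E)] of
    [exponential_expansion], in which E has modulus [exp (kappa * Re xi)]; this leaves
    [sin delta / 4]. *)
Lemma faxen_log_bound_exp (kappa delta : R) (beta c0 : C) (L : R) :
  0 <= kappa < 1 -> 0 < delta <= PI / 2 -> 0 <= L ->
  exists K, 0 <= K /\ forall xi, Rabs (Im xi) <= PI / 2 - delta ->
    Cmod (faxen_log kappa beta c0 xi) * exp (L * exp (kappa * Re xi))
      <= K * exp (Re beta * Re xi - sin delta / 4 * exp (Re xi)).
Proof.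
  intros hk hd hL. assert (hs := sin_delta_pos delta hd).
  destruct (faxen_log_bound kappa delta beta c0 hk hd) as [K1 [hK1 H1]].
  destruct (exp_sublinear L kappa (sin delta / 4) hL hk ltac:(lra)) as [K2 [hK2 H2]].
  exists (K1 * exp K2). split; [apply Rmult_le_pos; trivial; left; apply exp_pos|].
  intros xi hxi.
  apply Rle_trans with (K1 * exp (Re beta * Re xi - sin delta / 2 * exp (Re xi))
    * exp (sin delta / 4 * exp (Re xi) + K2)).
  - apply Rmult_le_compat; [apply Cmod_ge_0|left; apply exp_pos|now apply H1|].
    apply exp_monotone, H2.
  - right. rewrite !Rmult_assoc. f_equal. rewrite <- !exp_plus. f_equal. field.
Qed.

(** * The logarithm of the phase along the contour *)

Section Phase.

Variables (p : C -> C) (gamma : R -> C) (a : C) (theta1 theta2 delta : R).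
Hypotheses (htheta : theta1 <= theta2) (htheta_pi : theta2 - theta1 < PI)
  (hdelta : 0 < delta)
  (hsec : forall theta s, theta1 <= theta <= theta2 -> 0 < s < 1 -> exists alpha,
     is_arg (polar 1 theta * p (gamma s) - polar 1 theta * p a)%C alpha /\
     Rabs alpha <= PI / 2 - delta).

Definition phase (s : R) : C := (p (gamma s) - p a)%C.

(** Rotation by [theta1] brings the phase into the right half-plane, where [plog] is a smooth
    logarithm; the rotation is then undone, so that the result is a logarithm of p(t) - p(a)
    itself. *)
Definition log_phase (s : R) : C := (plog (polar 1 theta1 * phase s) - ((0, theta1) : C))%C.

Lemma delta_le : delta <= PI / 2.
Proof.
  destruct (hsec theta1 (/ 2) ltac:(lra) ltac:(lra)) as [al [_ h]].
  generalize (Rabs_pos al). lra.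
Qed.

Lemma phase_sector (theta s : R) : theta1 <= theta <= theta2 -> 0 < s < 1 ->
  0 < Cmod (phase s) /\ sin delta * Cmod (phase s) <= Re (polar 1 theta * phase s).
Proof.
  intros ht hs. destruct (hsec theta s ht hs) as [al [[hn e] h]].
  replace (polar 1 theta * p (gamma s) - polar 1 theta * p a)%C
    with (polar 1 theta * phase s)%C in hn, e by (unfold phase; ring).
  assert (h0 : 0 < Cmod (polar 1 theta * phase s)) by now apply Cmod_gt_0.
  assert (em : Cmod (polar 1 theta * phase s) = Cmod (phase s))
    by (rewrite Cmod_mult, Cmod_polar by lra; ring).
  rewrite em in e, h0. split; trivial.
  rewrite e. change (Re (polar (Cmod (phase s)) al)) with (Cmod (phase s) * cos al).
  rewrite Rmult_comm. apply Rmult_le_compat_l; [lra|]. now apply cos_ge_sin.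
Qed.

Lemma Re_phase_pos (theta s : R) : theta1 <= theta <= theta2 -> 0 < s < 1 ->
  0 < Re (polar 1 theta * phase s).
Proof.
  intros ht hs. destruct (phase_sector theta s ht hs) as [h1 h2].
  assert (h3 := sin_delta_pos delta (conj hdelta delta_le)).
  assert (0 < sin delta * Cmod (phase s)) by now apply Rmult_lt_0_compat. lra.
Qed.

Lemma Cexp_log_phase (s : R) : 0 < s < 1 -> Cexp (log_phase s) = phase s.
Proof.
  intros hs. unfold log_phase.
  rewrite Cexp_minus, Cexp_plog by (apply Re_phase_pos; lra).
  rewrite Cexp_imag. field. apply polar_neq_0; lra.
Qed.

(** The given argument and the one obtained from [log_phase] differ by less than PI/2 + PI/2 + PI,
    so they coincide. Here [theta2 - theta1 < PI] enters, and it makes one logarithm serve the whole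
    sector. *)
Lemma log_phase_strip (theta s : R) : theta1 <= theta <= theta2 -> 0 < s < 1 ->
  Rabs (theta + Im (log_phase s)) <= PI / 2 - delta.
Proof.
  intros ht hs. destruct (hsec theta s ht hs) as [al [[hn e] h]].
  replace (polar 1 theta * p (gamma s) - polar 1 theta * p a)%C
    with (polar 1 theta * phase s)%C in hn, e by (unfold phase; ring).
  assert (h0 : 0 < Cmod (polar 1 theta * phase s)) by now apply Cmod_gt_0.
  assert (X : ((ln (Cmod (polar 1 theta * phase s)), al) : C)
    = (((0, theta) : C) + log_phase s)%C).
  { apply Cexp_inj.
    - rewrite Cexp_ln, <- e, Cexp_plus, Cexp_imag, Cexp_log_phase by trivial. reflexivity.
    - assert (b := Im_plog (polar 1 theta1 * phase s)).
      change (Im ((ln (Cmod (polar 1 theta * phase s)), al) : C)) with al.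
      change (Im (((0, theta) : C) + log_phase s))
        with (theta + (Im (plog (polar 1 theta1 * phase s)) + - theta1)).
      apply Rabs_le_between in h. apply Rabs_def1; lra. }
  apply (f_equal Im) in X. change (al = theta + Im (log_phase s)) in X. now rewrite <- X.
Qed.

Lemma log_phase_deriv (s : R) (v l : C) : 0 < s < 1 ->
  is_deriv_curve gamma s v -> Cdiff p (gamma s) l ->
  is_deriv_curve log_phase s (l * v / phase s)%C.
Proof.
  intros hs hv hl. assert (hpos := Re_phase_pos theta1 s ltac:(lra) hs).
  assert (hn : phase s <> 0).
  { apply Cmod_gt_0. apply (phase_sector theta1 s); lra. }
  eapply is_deriv_curve_eq.
  - apply is_deriv_curve_minus; [|apply is_deriv_curve_const].
    apply is_deriv_curve_plog; [|exact hpos].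
    apply is_deriv_curve_scal, is_deriv_curve_minus; [|apply is_deriv_curve_const].
    apply (Cdiff_curve p gamma s l v hl hv).
  - cbv beta. change (p (gamma s) - p a)%C with (phase s). field.
    split; trivial. apply polar_neq_0; lra.
Qed.

End Phase.

Lemma is_deriv_curve_unique (f : R -> C) (s : R) (l l' : C) :
  is_deriv_curve f s l -> is_deriv_curve f s l' -> l = l'.
Proof. intros h h'. now rewrite <- (derivRC_correct _ _ _ h), (derivRC_correct _ _ _ h'). Qed.

Lemma locally_pos_interval (k s : R) (P : R -> Prop) :
  0 < s < k -> (forall t, 0 < t < k -> P t) -> locally s P.
Proof.
  intros hs h. exists (mkposreal (Rmin s (k - s)) ltac:(apply Rmin_pos; lra)). intros t ht.
  assert (hb : Rabs (t - s) < Rmin s (k - s)) by exact ht.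
  assert (a1 := Rmin_l s (k - s)). assert (a2 := Rmin_r s (k - s)).
  apply Rabs_def2 in hb. apply h. lra.
Qed.

Lemma right_small (k : R) : 0 < k -> at_right 0 (fun s => 0 < s < k).
Proof. intros hk. apply at_right_0_iff. now exists k. Qed.

(** * The local parameter along the contour near [a] *)

Section Local.

Variables (p q r : C -> C) (gamma : R -> C) (a : C) (phi : R -> R) (varpi varpi0 : R)
  (mu nu : R) (lambda : C) (p_ q_ r_ : nat -> C) (theta1 theta2 delta : R)
  (dg : R -> C) (k1 c1 c2 : R).
Hypotheses (htheta : theta1 <= theta2) (htheta_pi : theta2 - theta1 < PI)
  (hdelta : 0 < delta)
  (hsec : forall theta s, theta1 <= theta <= theta2 -> 0 < s < 1 -> exists alpha,
     is_arg (polar 1 theta * p (gamma s) - polar 1 theta * p a)%C alpha /\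
     Rabs alpha <= PI / 2 - delta)
  (hpdiff : forall s, 0 < s < 1 -> exists l, Cdiff p (gamma s) l)
  (hphi : at_right 0 (fun s => is_arg (gamma s - a)%C (phi s)))
  (hphilim : filterlim phi (at_right 0) (locally varpi))
  (hmu : 0 < mu) (hp0 : p_ 0%nat <> 0)
  (hp : has_ps (cps p_) p_) (hq : has_ps (cps q_) q_) (hr : has_ps (cps r_) r_)
  (hpe : at_right 0 (fun s =>
     p (gamma s) - p a = polar_pow (Cmod (gamma s - a)) (phi s) mu * cps p_ (gamma s - a))%C)
  (hqe : at_right 0 (fun s =>
     q (gamma s) = polar_pow (Cmod (gamma s - a)) (phi s) (lambda - 1) * cps q_ (gamma s - a))%C)
  (hre : at_right 0 (fun s =>
     r (gamma s) = polar_pow (Cmod (gamma s - a)) (phi s) nu * cps r_ (gamma s - a))%C)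
  (hk1 : 0 < k1 <= 1) (hc1 : 0 < c1) (hc2 : 0 < c2)
  (harc : forall s, 0 < s < k1 ->
      is_deriv_curve gamma s (dg s) /\ continuous_C dg s /\ Cmod (dg s) <= c2 /\
      c1 * s <= Cmod (gamma s - a)%C <= c2 * s).

Let tau (s : R) : C := (gamma s - a)%C.
Let ell (s : R) : C := (ln (Cmod (tau s)), phi s).
Let U := unit_part p_.
Let L := log_phase p gamma a theta1.
Let D := log_deriv U (unit_coef p_) mu.

Lemma near0_along (Q : C -> Prop) : near0 Q -> at_right 0 (fun s => Q (tau s)).
Proof.
  intros [e [he H]]. apply at_right_0_iff. exists (Rmin k1 (e / c2)).
  split; [apply Rmin_pos; [lra|now apply Rdiv_lt_0_compat]|]. intros s hs.
  assert (a1 := Rmin_l k1 (e / c2)). assert (a2 := Rmin_r k1 (e / c2)).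
  destruct (harc s ltac:(lra)) as [_ [_ [_ h]]]. apply H.
  apply Rle_lt_trans with (1 := proj2 h).
  apply Rlt_le_trans with (c2 * (e / c2)); [apply Rmult_lt_compat_l; lra|right; field; lra].
Qed.

Lemma near_U : near0 (fun t => 0 < Re (U t)).
Proof. apply (Re_F_near _ _ (unit_part_has_ps p_ hp0 hp) (unit_coef_0 p_ hp0)). Qed.

Lemma phi_close : at_right 0 (fun s => mu * Rabs (phi s - varpi) <= delta / 2).
Proof.
  assert (h := proj1 (filterlim_R_eps _ phi varpi) hphilim (delta / (2 * mu))
    ltac:(apply Rdiv_lt_0_compat; lra)).
  eapply filter_imp; [|exact h]. intros s hs.
  apply Rle_trans with (mu * (delta / (2 * mu))); [|right; field; lra].
  apply Rmult_le_compat_l; lra.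
Qed.

Lemma tau_Cexp : at_right 0 (fun s => tau s <> 0 /\ Cexp (ell s) = tau s).
Proof.
  eapply filter_imp; [|exact hphi]. intros s [hn e]. split; [exact hn|].
  unfold ell. rewrite Cexp_ln; [now symmetry|now apply Cmod_gt_0].
Qed.

Lemma phase_factor : at_right 0 (fun s =>
  phase p gamma a s = (Cexp (mu * ell s) * (p_ 0%nat * U (tau s)))%C).
Proof.
  eapply filter_imp; [|apply (filter_and _ _ hpe (near0_along _ (unit_part_eq p_ hp0 hp)))].
  intros s [e1 e2]. unfold phase. rewrite e1. fold (tau s). rewrite e2. reflexivity.
Qed.

(** The argument of p_0 is read off at a single point close to [a]: from that of p - p(a) subtract
    those of (t - a)^mu and of [U]. The bound PI/2 - delta at that point, plus delta/2 for replacing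
    [phi] by [varpi] and delta/2 for [U], gives PI/2. *)
Lemma arg_p0_candidate : exists v : R, p_ 0%nat = polar (Cmod (p_ 0%nat)) v /\
  forall theta, theta1 <= theta <= theta2 -> Rabs (v + theta + mu * varpi) <= PI / 2.
Proof.
  assert (hsm := Im_plog_small _ _ (delta / 2) (unit_part_has_ps p_ hp0 hp)
    (unit_coef_0 p_ hp0) ltac:(lra)).
  destruct (filter_ex _ (filter_and _ _ (filter_and _ _ phase_factor (right_small 1 Rlt_0_1))
    (filter_and _ _ phi_close (near0_along _ (near0_and _ _ near_U hsm)))))
    as [s [[e1 hs] [e2 [e3 e4]]]].
  fold U in e4.
  set (v := Im (L s) - mu * phi s - Im (plog (U (tau s)))).
  exists v. split.
  - assert (X : p_ 0%nat = Cexp (L s - mu * ell s - plog (U (tau s)))).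
    { rewrite !Cexp_minus, Cexp_plog by trivial. unfold L.
      rewrite (Cexp_log_phase p gamma a theta1 theta2 delta) by trivial. rewrite e1.
      field. split; [apply Cexp_neq_0|apply Re_gt_0_neq_0; trivial]. }
    set (z := (L s - mu * ell s - plog (U (tau s)))%C) in *.
    assert (hv : v = Im z).
    { unfold v, z. simpl. unfold Im. ring. }
    rewrite X at 1. rewrite X, Cmod_Cexp. unfold polar, Cexp. now rewrite hv.
  - intros theta ht.
    assert (h := log_phase_strip p gamma a theta1 theta2 delta htheta htheta_pi hdelta
      hsec theta s ht hs).
    fold L in h. apply Rabs_le_between in h. apply Rabs_le_between in e4.
    assert (h2 : Rabs (mu * (phi s - varpi)) <= delta / 2)
      by (rewrite Rabs_mult, (Rabs_pos_eq mu) by lra; trivial).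
    apply Rabs_le_between in h2. apply Rabs_le. unfold v. lra.
Qed.

Hypotheses (hvarpi0 : p_ 0%nat = polar (Cmod (p_ 0%nat)) varpi0)
  (hvarpi0_bound : forall theta, theta1 <= theta <= theta2 ->
     Rabs (varpi0 + theta + mu * varpi) <= PI / 2).

Let lp : C := (ln (Cmod (p_ 0%nat)), varpi0).
Let p0_pow := polar_pow (Cmod (p_ 0%nat)) varpi0.
Let omega := p0_pow (/ mu)%C.
Let W := parameter U mu omega.

Lemma Cexp_lp : Cexp lp = p_ 0%nat.
Proof. unfold lp. rewrite Cexp_ln; [now symmetry|now apply Cmod_gt_0]. Qed.

(** Here the prescribed value [varpi0] is tied to [log_phase]: both sides have the same exponential,
    and the bounds on the four angles keep their imaginary parts less than 3 PI / 2 apart. *)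
Lemma log_phase_local : at_right 0 (fun s =>
  L s = lp + mu * ell s + plog (U (tau s)))%C.
Proof.
  eapply filter_imp; [|apply (filter_and _ _ (filter_and _ _ phase_factor (right_small 1 Rlt_0_1))
    (filter_and _ _ phi_close (near0_along _ near_U)))].
  intros s [[e1 hs] [e2 e3]]. apply Cexp_inj.
  - unfold L. rewrite (Cexp_log_phase p gamma a theta1 theta2 delta) by trivial.
    rewrite e1, !Cexp_plus, Cexp_lp, Cexp_plog by trivial. ring.
  - assert (h := log_phase_strip p gamma a theta1 theta2 delta htheta htheta_pi hdelta
      hsec theta1 s ltac:(lra) hs).
    fold L in h. apply Rabs_le_between in h.
    assert (h2 : Rabs (mu * (phi s - varpi)) <= delta / 2)
      by (rewrite Rabs_mult, (Rabs_pos_eq mu) by lra; trivial).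
    apply Rabs_le_between in h2.
    assert (h3 := hvarpi0_bound theta1 ltac:(lra)). apply Rabs_le_between in h3.
    assert (h4 := Im_plog (U (tau s))).
    replace (Im (lp + mu * ell s + plog (U (tau s))))
      with (varpi0 + mu * phi s + Im (plog (U (tau s)))) by (simpl; unfold Im; simpl; ring).
    apply Rabs_def1; lra.
Qed.

Lemma mu_neq_0 : RtoC mu <> 0.
Proof. apply RtoC_neq_0; lra. Qed.

Lemma Cexp_log_phase_pow (sg : C) : at_right 0 (fun s =>
  Cexp (sg / mu * L s) = p0_pow (sg / mu) * Cexp (sg * ell s)
    * principal_pow (U (tau s)) (sg / mu))%C.
Proof.
  eapply filter_imp; [|exact log_phase_local]. intros s e. rewrite e.
  rewrite principal_pow_plog. unfold p0_pow, polar_pow. fold lp.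
  rewrite <- !Cexp_plus. f_equal. field. apply mu_neq_0.
Qed.

Lemma parameter_local : at_right 0 (fun s => Cexp (/ mu * L s) = W (tau s))%C.
Proof.
  eapply filter_imp; [|apply (filter_and _ _ (Cexp_log_phase_pow 1) tau_Cexp)].
  intros s [e [_ e2]].
  replace (/ mu * L s)%C with (1 / mu * L s)%C by (field; apply mu_neq_0).
  rewrite e, Cmult_1_l, e2. unfold W, parameter, omega.
  replace (1 / mu)%C with (/ mu)%C by (field; apply mu_neq_0). ring.
Qed.

(** [phi] is not assumed differentiable. But [log_phase] is, hence so is [ell], which
    [log_phase_local] expresses through [log_phase] and the logarithm of [U]; then Cexp ell = tau
    forces the derivative of [ell] to be dg / tau. *)
Lemma log_phase_deriv_local : at_right 0 (fun s =>
  is_deriv_curve L s (mu * D (tau s) * dg s / tau s)%C).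
Proof.
  destruct (has_ps_deriv _ _ (unit_part_has_ps p_ hp0 hp)) as [_ DU].
  destruct (proj1 (at_right_0_iff _) (filter_and _ _ (filter_and _ _ log_phase_local tau_Cexp)
    (near0_along _ (near0_and _ _ near_U DU)))) as [k [hk X]].
  apply at_right_0_iff. exists (Rmin k k1). split; [apply Rmin_pos; lra|]. intros s hs.
  assert (a1 := Rmin_l k k1). assert (a2 := Rmin_r k k1).
  destruct (X s ltac:(lra)) as [[e1 [hn e2]] [hU dU]].
  destruct (harc s ltac:(lra)) as [dgam _].
  destruct (hpdiff s ltac:(lra)) as [l hl].
  assert (dL := log_phase_deriv p gamma a theta1 theta2 delta htheta hdelta hsec
    s (dg s) l ltac:(lra) dgam hl).
  fold L in dL. set (L' := (l * dg s / phase p gamma a s)%C) in *.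
  assert (dtau : is_deriv_curve tau s (dg s)).
  { eapply is_deriv_curve_eq; [apply is_deriv_curve_minus;
      [exact dgam|apply is_deriv_curve_const]|]. ring. }
  set (U' := cps (deriv_coef (unit_coef p_)) (tau s)) in *.
  assert (dPU : is_deriv_curve (fun u => plog (U (tau u))) s (U' * dg s / U (tau s))%C).
  { apply is_deriv_curve_plog; [|exact hU]. exact (Cdiff_curve U tau s U' (dg s) dU dtau). }
  assert (dell : is_deriv_curve ell s (/ mu * (L' - 0 - U' * dg s / U (tau s)))%C).
  { eapply is_derive_ext_loc with (f := fun u => (/ mu * (L u - lp - plog (U (tau u))))%C).
    - apply (locally_pos_interval (Rmin k k1)); trivial. intros t ht.
      destruct (X t ltac:(lra)) as [[e _] _]. rewrite e.
      Cfield. apply mu_neq_0.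
    - apply is_deriv_curve_scal, is_deriv_curve_minus; [|exact dPU].
      apply is_deriv_curve_minus; [exact dL|apply is_deriv_curve_const]. }
  assert (e3 : dg s = (tau s * (/ mu * (L' - 0 - U' * dg s / U (tau s))))%C).
  { rewrite <- e2 at 1. apply (is_deriv_curve_unique tau s); [exact dtau|].
    eapply is_derive_ext_loc; [|apply is_deriv_curve_Cexp, dell].
    apply (locally_pos_interval (Rmin k k1)); trivial. intros t ht.
    destruct (X t ltac:(lra)) as [[_ [_ e]] _]. exact e. }
  eapply is_deriv_curve_eq; [exact dL|].
  assert (hn2 := Re_gt_0_neq_0 _ hU). assert (hm := mu_neq_0).
  unfold D, log_deriv. fold U'.
  replace L' with (mu * (tau s * (/ mu * (L' - 0 - U' * dg s / U (tau s)))) / tau s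
    + U' * dg s / U (tau s))%C by (field; auto).
  rewrite <- e3. field. auto.
Qed.

Lemma log_deriv_near : near0 (fun t => / 2 <= Cmod (D t) <= 2).
Proof.
  destruct (log_deriv_has_ps _ _ mu (unit_part_has_ps p_ hp0 hp) (unit_coef_0 p_ hp0))
    as [d [Hd [d0 _]]].
  exact (has_ps_near_1 _ _ Hd d0).
Qed.

Lemma near_neq_0 (F : C -> C) (t : C) : / 2 <= Cmod (F t) <= 2 -> F t <> 0.
Proof. intros h. apply Cmod_gt_0. lra. Qed.

(** The last factor is the derivative of [L], so this is q dt = w^lambda (q_local / D) dL, the
    differential in the variable in which the Faxen integrand is entire. *)
Lemma q_factor : at_right 0 (fun s => q (gamma s) * dg s =
  Cexp (lambda / mu * L s) * (q_local p_ q_ mu lambda varpi0 (tau s) / D (tau s))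
   * (mu * D (tau s) * dg s / tau s))%C.
Proof.
  eapply filter_imp; [|apply (filter_and _ _ (filter_and _ _ hqe (Cexp_log_phase_pow lambda))
    (filter_and _ _ tau_Cexp (near0_along _ log_deriv_near)))].
  intros s [[e1 e2] [[hn e3] hD]]. apply near_neq_0 in hD.
  rewrite e1, e2. fold (tau s). unfold q_local. fold U p0_pow.
  assert (e4 : polar_pow (Cmod (tau s)) (phi s) (lambda - 1) = (Cexp (lambda * ell s) / tau s)%C).
  { transitivity (Cexp ((lambda - 1) * ell s)); [reflexivity|].
    replace ((lambda - 1) * ell s)%C with (lambda * ell s - ell s)%C by ring.
    now rewrite Cexp_minus, e3. }
  rewrite e4.
  assert (e5 : p0_pow (- (lambda / mu)) = (/ p0_pow (lambda / mu))%C)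
    by apply p0_pow_opp.
  assert (e6 : principal_pow (U (tau s)) (- (lambda / mu)) =
    (/ principal_pow (U (tau s)) (lambda / mu))%C)
    by (rewrite !principal_pow_plog, <- Cexp_opp; f_equal; ring).
  rewrite e5, e6.
  assert (n1 := p0_pow_neq_0 p_ varpi0 (lambda / mu)%C).
  change (p0_pow (lambda / mu) <> 0) in n1.
  assert (n2 := principal_pow_neq_0 (U (tau s)) (lambda / mu)).
  assert (n3 := mu_neq_0).
  set (z1 := p0_pow _) in *. set (z2 := principal_pow _ _) in *.
  set (z3 := Cexp _). field. auto.
Qed.

Lemma r_factor : at_right 0 (fun s =>
  r (gamma s) = Cexp (nu / mu * L s) * r_local p_ r_ mu nu varpi0 (tau s))%C.
Proof.
  eapply filter_imp; [|apply (filter_and _ _ hre (Cexp_log_phase_pow nu))].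
  intros s [e1 e2].
  rewrite e1, e2. fold (tau s). unfold r_local. fold U p0_pow.
  change (polar_pow (Cmod (tau s)) (phi s) nu) with (Cexp (nu * ell s)).
  assert (e5 : p0_pow (- (nu / mu)) = (/ p0_pow (nu / mu))%C)
    by apply p0_pow_opp.
  assert (e6 : principal_pow (U (tau s)) (- (nu / mu)) =
    (/ principal_pow (U (tau s)) (nu / mu))%C)
    by (rewrite !principal_pow_plog, <- Cexp_opp; f_equal; ring).
  rewrite e5, e6.
  assert (n1 := p0_pow_neq_0 p_ varpi0 (nu / mu)%C).
  change (p0_pow (nu / mu) <> 0) in n1.
  assert (n2 := principal_pow_neq_0 (U (tau s)) (nu / mu)).
  set (z1 := p0_pow _) in *. set (z2 := principal_pow _ _) in *. field. auto.
Qed.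

Lemma W_near : near0 (fun t => Cmod omega / 2 * Cmod t <= Cmod (W t) <= Cmod omega * 2 * Cmod t).
Proof.
  destruct (principal_pow_has_ps _ _ (/ mu) (unit_part_has_ps p_ hp0 hp) (unit_coef_0 p_ hp0))
    as [e [He [e0 _]]].
  eapply near0_imp; [|exact (has_ps_near_1 _ _ He e0)]. intros t [h1 h2]. cbv beta in h1, h2.
  unfold W, parameter. rewrite !Cmod_mult. fold U in h1, h2.
  set (z := Cmod (principal_pow _ _)) in *.
  assert (h : 0 <= Cmod omega * Cmod t) by (apply Rmult_le_pos; apply Cmod_ge_0).
  split; nra.
Qed.

Lemma omega_pos : 0 < Cmod omega.
Proof. apply Cmod_gt_0, polar_pow_neq_0. Qed.

(** Allows later bounds to be stated in [ln s]: the modulus of t - a is comparable to [s], and that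
    of [U] lies between 1/2 and 2. *)
Lemma Re_log_phase : exists K, at_right 0 (fun s => Rabs (Re (L s) - mu * ln s) <= K).
Proof.
  exists (Rabs (ln (Cmod (p_ 0%nat))) + mu * (Rabs (ln c1) + Rabs (ln c2)) + Rabs (ln (/ 2)) + Rabs (ln 2)).
  eapply filter_imp; [|apply (filter_and _ _ (filter_and _ _ log_phase_local (right_small k1 (proj1 hk1)))
    (near0_along _ (near0_and _ _ near_U
      (has_ps_near_1 _ _ (unit_part_has_ps p_ hp0 hp) (unit_coef_0 p_ hp0)))))].
  intros s [[e hs] [_ [h1 h2]]]. fold U in h1, h2. rewrite e.
  destruct (harc s hs) as [_ [_ [_ [g1 g2]]]]. fold (tau s) in g1, g2.
  replace (Re (lp + mu * ell s + plog (U (tau s)))) with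
    (ln (Cmod (p_ 0%nat)) + mu * ln (Cmod (tau s)) + ln (Cmod (U (tau s))))
    by (simpl; unfold Re; simpl; ring).
  assert (hcs : 0 < c1 * s) by (apply Rmult_lt_0_compat; lra).
  assert (b1 : ln c1 <= ln (Cmod (tau s)) - ln s <= ln c2).
  { assert (ln (c1 * s) <= ln (Cmod (tau s))) by (apply ln_le; lra).
    assert (ln (Cmod (tau s)) <= ln (c2 * s)) by (apply ln_le; lra).
    rewrite !ln_mult in * by lra. lra. }
  assert (b2 : ln (/ 2) <= ln (Cmod (U (tau s))) <= ln 2) by (split; apply ln_le; lra).
  replace (_ - mu * ln s) with (ln (Cmod (p_ 0%nat)) + mu * (ln (Cmod (tau s)) - ln s)
    + ln (Cmod (U (tau s)))) by ring.
  assert (between : forall x u v, u <= x <= v -> Rabs x <= Rabs u + Rabs v).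
  { intros x u v hx. apply Rabs_le.
    generalize (Rle_abs v) (Rle_abs (- u)) (Rabs_pos u) (Rabs_pos v). rewrite Rabs_Ropp. lra. }
  eapply Rle_trans; [apply Rabs_triang|].
  assert (b3 := between _ _ _ b2).
  eapply Rle_trans; [apply Rplus_le_compat; [apply Rabs_triang|exact b3]|].
  rewrite Rabs_mult, (Rabs_pos_eq mu) by lra.
  assert (b4 := between _ _ _ b1).
  assert (mu * Rabs (ln (Cmod (tau s)) - ln s) <= mu * (Rabs (ln c1) + Rabs (ln c2)))
    by (apply Rmult_le_compat_l; lra).
  lra.
Qed.

Lemma log_phase_deriv_bound : at_right 0 (fun s =>
  Cmod (mu * D (tau s) * dg s / tau s)%C <= 2 * mu * c2 / c1 / s).
Proof.
  eapply filter_imp; [|apply (filter_and _ _ (right_small k1 (proj1 hk1))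
    (near0_along _ log_deriv_near))].
  intros s [hs [_ h2]]. destruct (harc s hs) as [_ [_ [g0 [g1 _]]]]. fold (tau s) in g1.
  assert (hcs : 0 < c1 * s) by (apply Rmult_lt_0_compat; lra).
  assert (hn : tau s <> 0) by (apply Cmod_gt_0; lra).
  rewrite Cmod_div, !Cmod_mult, Cmod_R_pos by (trivial; lra).
  replace (2 * mu * c2 / c1 / s) with ((mu * 2 * c2) * / (c1 * s)) by (field; lra).
  apply Rmult_le_compat.
  - repeat apply Rmult_le_pos; try apply Cmod_ge_0; lra.
  - left. apply Rinv_0_lt_compat. lra.
  - apply Rmult_le_compat; try apply Cmod_ge_0; trivial.
    + apply Rmult_le_pos; [lra|apply Cmod_ge_0].
    + apply Rmult_le_compat_l; lra.
  - apply Rinv_le_contravar; lra.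
Qed.

Let w (s : R) : C := Cexp (/ mu * L s).
Let b := b_coef p_ q_ mu lambda varpi0.
Let c := c_coef p_ r_ mu nu varpi0.

(** [Lagrange_bound] measures the error in powers of t - a and carries the factor [D]. Since
    [Cmod D] is at least 1/2 and [Cmod tau] at most [2 / Cmod omega * Cmod w], it becomes a bound in
    powers of [w] for the quotients by [D]. *)
Lemma local_expansions (N : nat) : exists k Wb, 0 < k <= k1 /\ 0 <= Wb /\
  (forall s, 0 < s < k -> Cmod (w s) <= Wb /\ w s <> 0) /\
  expands (fun s => 0 < s < k) w N
    (fun s => q_local p_ q_ mu lambda varpi0 (tau s) / D (tau s))%C b /\
  expands (fun s => 0 < s < k) w N (fun s => r_local p_ r_ mu nu varpi0 (tau s)) c.
Proof.
  destruct (q_local_has_ps p_ q_ mu lambda varpi0 hp0 hp hq) as [mq Hq].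
  destruct (r_local_has_ps p_ r_ mu nu varpi0 hp0 hp hr) as [mr Hr].
  assert (HU := unit_part_has_ps p_ hp0 hp). assert (U0 := unit_coef_0 p_ hp0).
  destruct (log_deriv_has_ps _ _ mu HU U0) as [d [Hd _]].
  destruct (Lagrange_bound U (unit_coef p_) mu omega HU U0 hmu _ mq b Hq
    (q_local_coef p_ q_ mu lambda varpi0 hmu hp0 hp hq) N) as [K1 [hK1 E1]].
  destruct (Lagrange_bound U (unit_coef p_) mu omega HU U0 hmu
    (fun t => D t * r_local p_ r_ mu nu varpi0 t)%C _ c (has_ps_mult _ _ _ _ Hd Hr)
    (r_local_coef p_ r_ mu nu varpi0 hmu hp0 hp hr hvarpi0) N) as [K2 [hK2 E2]].
  destruct (proj1 (at_right_0_iff _) (filter_and _ _ (filter_and _ _ parameter_local tau_Cexp)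
    (near0_along _ (near0_and _ _ (near0_and _ _ E1 E2) (near0_and _ _ log_deriv_near W_near)))))
    as [k [hk X]].
  exists (Rmin k k1), (Cmod omega * 2 * c2 * k1).
  assert (a1 := Rmin_l k k1). assert (a2 := Rmin_r k k1). assert (ho := omega_pos).
  split; [split; [apply Rmin_pos; lra|trivial]|]. split.
  { repeat apply Rmult_le_pos; lra. }
  assert (hw : forall s, 0 < s < Rmin k k1 -> Cmod (w s) <= Cmod omega * 2 * c2 * k1 /\ w s <> 0).
  { intros s hs. split; [|apply Cexp_neq_0].
    destruct (X s ltac:(lra)) as [[e _] [_ [_ [_ g]]]]. unfold w. rewrite e.
    eapply Rle_trans; [exact g|]. rewrite (Rmult_assoc _ c2).
    apply Rmult_le_compat_l; [lra|].
    destruct (harc s ltac:(lra)) as [_ [_ [_ [_ g2]]]]. fold (tau s) in g2.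
    apply Rle_trans with (1 := g2). apply Rmult_le_compat_l; lra. }
  split; [exact hw|].
  assert (Y : forall s (f g : C) K, 0 < s < Rmin k k1 -> 0 <= K ->
    Cmod (D (tau s) * f - D (tau s) * g)%C <= K * Cmod (tau s) ^ N ->
    Cmod (f - g)%C <= 2 * K * (2 / Cmod omega) ^ N * Cmod (w s) ^ N).
  { intros s f g K hs hK h. destruct (X s ltac:(lra)) as [[e _] [_ [[hD1 _] [g1 _]]]].
    rewrite Rmult_assoc, <- Rpow_mult_distr.
    assert (ht : Cmod (tau s) <= 2 / Cmod omega * Cmod (w s)).
    { unfold w. rewrite e. apply Rmult_le_reg_l with (Cmod omega / 2); [lra|].
      replace (Cmod omega / 2 * (2 / Cmod omega * Cmod (W (tau s)))) with (Cmod (W (tau s)))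
        by (field; lra). exact g1. }
    assert (hp' : Cmod (tau s) ^ N <= (2 / Cmod omega * Cmod (w s)) ^ N)
      by (apply pow_incr; split; [apply Cmod_ge_0|trivial]).
    assert (hp'' : K * Cmod (tau s) ^ N <= K * (2 / Cmod omega * Cmod (w s)) ^ N)
      by now apply Rmult_le_compat_l.
    replace (D (tau s) * f - D (tau s) * g)%C with (D (tau s) * (f - g))%C in h by ring.
    rewrite Cmod_mult in h. assert (h0 := Cmod_ge_0 (f - g)).
    assert (/ 2 * Cmod (f - g) <= Cmod (D (tau s)) * Cmod (f - g))
      by (apply Rmult_le_compat_r; lra).
    lra. }
  assert (hcst : forall K, 0 <= K -> 0 <= 2 * K * (2 / Cmod omega) ^ N).
  { intros K hK. apply Rmult_le_pos; [lra|]. apply pow_le. left. apply Rdiv_lt_0_compat; lra. }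
  split.
  - apply (expands_bound _ w _ hw). exists (2 * K1 * (2 / Cmod omega) ^ N).
    split; [now apply hcst|]. intros s hs. apply (Y s _ _ K1 hs hK1).
    destruct (X s ltac:(lra)) as [[e _] [[x1 _] [hD _]]]. apply near_neq_0 in hD.
    replace (D (tau s) * (q_local p_ q_ mu lambda varpi0 (tau s) / D (tau s)))%C
      with (q_local p_ q_ mu lambda varpi0 (tau s)) by (field; trivial).
    unfold w. rewrite e. exact x1.
  - apply (expands_bound _ w _ hw). exists (2 * K2 * (2 / Cmod omega) ^ N).
    split; [now apply hcst|]. intros s hs. apply (Y s _ _ K2 hs hK2).
    destruct (X s ltac:(lra)) as [[e _] [[_ x2] _]].
    unfold w. rewrite e. exact x2.
Qed.

End Local.

Lemma exp_decay_le_power (eta B : R) : 0 < eta ->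
  exists K, 0 <= K /\ forall rho, 1 <= rho -> exp (- (eta * rho)) <= K * exp (- (B * ln rho)).
Proof.
  intros he. destruct (linear_le_exp B eta he) as [K hK].
  exists (exp K). split; [left; apply exp_pos|]. intros rho hrho.
  rewrite <- exp_plus. apply exp_monotone.
  assert (h0 : 0 <= ln rho) by (rewrite <- ln_1; apply ln_le; lra).
  specialize (hK (ln rho) h0). rewrite exp_ln in hK by lra. lra.
Qed.

(** * The integral over the initial piece of the contour *)

Section LocalEstimate.

Variables (kappa delta mu k k2 theta1 theta2 KL CP Wb : R) (lambda : C)
  (L L' Bf Rl : R -> C) (b c : nat -> C).
Hypotheses (hkappa : 0 <= kappa < 1) (hdelta : 0 < delta <= PI / 2) (hmu : 0 < mu)
  (hlambda : 0 < Re lambda) (hk2 : 0 < k2 < k) (hKL : 0 <= KL) (hWb : 0 <= Wb)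
  (hstrip : forall theta s, theta1 <= theta <= theta2 -> 0 < s < k ->
     Rabs (theta + Im (L s)) <= PI / 2 - delta)
  (hL : forall s, 0 < s < k -> is_deriv_curve L s (L' s))
  (hL' : forall s, 0 < s < k -> Cmod (L' s) <= KL / s)
  (hRe : forall s, 0 < s < k -> Rabs (Re (L s) - mu * ln s) <= CP).

Let Lam (rho theta s : R) : C := (((ln rho, theta) : C) + L s)%C.

(** The integral of [T] from the start to the cut [k2] is [V] up to an exponentially small error,
    uniformly in theta. Stated through a primitive [Psi] that vanishes at the start, the property is
    additive and involves no integrability. *)
Let good (T : R -> R -> R -> C) (V : R -> R -> C) : Prop :=
  exists (Psi : R -> R -> R -> C) (K eta rho0 : R), 0 <= K /\ 0 < eta /\
    forall rho theta, 1 <= rho -> rho0 <= rho -> theta1 <= theta <= theta2 ->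
      (forall s, 0 < s < k -> is_deriv_curve (Psi rho theta) s (T rho theta s)) /\
      filterlim_C (Psi rho theta) (at_right 0) (RtoC 0) /\
      Cmod (Psi rho theta k2 - V rho theta)%C <= K * exp (- (eta * rho)).

Lemma good_ext (T T' : R -> R -> R -> C) (V V' : R -> R -> C) :
  (forall rho theta s, T rho theta s = T' rho theta s) ->
  (forall rho theta, V rho theta = V' rho theta) -> good T V -> good T' V'.
Proof.
  intros hT hV [Psi [K [eta [rho0 [hK [heta X]]]]]].
  exists Psi, K, eta, rho0. split; [trivial|split; [trivial|]].
  intros rho theta h1 h2 h3. destruct (X rho theta h1 h2 h3) as [x1 [x2 x3]].
  split; [|split; [trivial|now rewrite <- hV]].
  intros s hs. rewrite <- hT. now apply x1.
Qed.

Lemma filterlim_C_scal (F : (R -> Prop) -> Prop) {FF : Filter F} (f : R -> C) (l c0 : C) :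
  filterlim_C f F l -> filterlim_C (fun s => c0 * f s)%C F (c0 * l)%C.
Proof.
  intros H. apply (filterlim_C_eps F). intros eps heps.
  assert (hc := Cmod_ge_0 c0).
  assert (h := proj1 (filterlim_C_eps F f l) H (eps / (Cmod c0 + 1))
    ltac:(apply Rdiv_lt_0_compat; lra)).
  eapply filter_imp; [|exact h]. intros x hx.
  replace (c0 * f x - c0 * l)%C with (c0 * (f x - l))%C by ring. rewrite Cmod_mult.
  assert (h0 := Cmod_ge_0 (f x - l)).
  apply Rle_lt_trans with ((Cmod c0 + 1) * Cmod (f x - l)); [nra|].
  replace eps with ((Cmod c0 + 1) * (eps / (Cmod c0 + 1))) by (field; lra).
  apply Rmult_lt_compat_l; lra.
Qed.

Lemma filterlim_C_plus (F : (R -> Prop) -> Prop) {FF : Filter F} (f g : R -> C) (l m : C) :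
  filterlim_C f F l -> filterlim_C g F m -> filterlim_C (fun s => f s + g s)%C F (l + m)%C.
Proof.
  intros Hf Hg. apply (filterlim_C_eps F). intros eps heps.
  assert (hf := proj1 (filterlim_C_eps F f l) Hf (eps / 2) ltac:(lra)).
  assert (hg := proj1 (filterlim_C_eps F g m) Hg (eps / 2) ltac:(lra)).
  eapply filter_imp; [|apply (filter_and _ _ hf hg)]. intros x [h1 h2].
  replace (f x + g x - (l + m))%C with ((f x - l) + (g x - m))%C by ring.
  eapply Rle_lt_trans; [apply Cmod_triangle|]. lra.
Qed.

Lemma good_plus (T T' : R -> R -> R -> C) (V V' : R -> R -> C) : good T V -> good T' V' ->
  good (fun rho theta s => T rho theta s + T' rho theta s)%C
    (fun rho theta => V rho theta + V' rho theta)%C.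
Proof.
  intros [Psi [K [eta [rho0 [hK [heta X]]]]]] [Psi' [K' [eta' [rho0' [hK' [heta' X']]]]]].
  exists (fun rho theta s => Psi rho theta s + Psi' rho theta s)%C, (K + K'),
    (Rmin eta eta'), (Rmax rho0 rho0').
  assert (a1 := Rmin_l eta eta'). assert (a2 := Rmin_r eta eta').
  assert (a3 := Rmax_l rho0 rho0'). assert (a4 := Rmax_r rho0 rho0').
  split; [lra|]. split; [now apply Rmin_pos|].
  intros rho theta h1 h2 h3.
  destruct (X rho theta h1 ltac:(lra) h3) as [x1 [x2 x3]].
  destruct (X' rho theta h1 ltac:(lra) h3) as [y1 [y2 y3]].
  split; [|split].
  - intros s hs. apply is_deriv_curve_plus; auto.
  - replace (RtoC 0) with (0 + 0)%C by ring. now apply filterlim_C_plus; [typeclasses eauto|..].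
  - replace (_ - _)%C with ((Psi rho theta k2 - V rho theta) + (Psi' rho theta k2 - V' rho theta))%C
      by ring.
    eapply Rle_trans; [apply Cmod_triangle|]. rewrite Rmult_plus_distr_r.
    apply Rplus_le_compat; (eapply Rle_trans; [eassumption|]); apply Rmult_le_compat_l; trivial;
      apply exp_monotone, Ropp_le_contravar, Rmult_le_compat_r; lra.
Qed.

Lemma good_scal (sg : R -> R -> C) (Ks : R) (T : R -> R -> R -> C) (V : R -> R -> C) :
  (forall rho theta, 1 <= rho -> theta1 <= theta <= theta2 -> Cmod (sg rho theta) <= Ks) ->
  good T V ->
  good (fun rho theta s => sg rho theta * T rho theta s)%C
    (fun rho theta => sg rho theta * V rho theta)%C.
Proof.
  intros hsg [Psi [K [eta [rho0 [hK [heta X]]]]]].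
  exists (fun rho theta s => sg rho theta * Psi rho theta s)%C, (Rabs Ks * K), eta, rho0.
  split; [apply Rmult_le_pos; trivial; apply Rabs_pos|]. split; [trivial|].
  intros rho theta h1 h2 h3. destruct (X rho theta h1 h2 h3) as [x1 [x2 x3]].
  split; [|split].
  - intros s hs. now apply is_deriv_curve_scal, x1.
  - replace (RtoC 0) with (sg rho theta * 0)%C by ring.
    now apply filterlim_C_scal; [typeclasses eauto|].
  - replace (_ - _)%C with (sg rho theta * (Psi rho theta k2 - V rho theta))%C by ring.
    rewrite Cmod_mult, Rmult_assoc. apply Rmult_le_compat; try apply Cmod_ge_0; trivial.
    eapply Rle_trans; [now apply hsg|apply Rle_abs].
Qed.

Lemma good_zero : good (fun _ _ _ => RtoC 0) (fun _ _ => RtoC 0).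
Proof.
  exists (fun _ _ _ => RtoC 0), 0, 1, 0. split; [lra|]. split; [lra|].
  intros rho theta h1 h2 h3. split; [|split].
  - intros s hs. apply is_deriv_curve_const.
  - apply filterlim_const.
  - replace (0 - 0)%C with (RtoC 0) by ring. rewrite Cmod_0. lra.
Qed.

Lemma good_partial_sum (T : nat -> R -> R -> R -> C) (V : nat -> R -> R -> C) (N : nat) :
  (forall n, good (T n) (V n)) ->
  good (fun rho theta s => partial_sum (fun n => T n rho theta s) N)
    (fun rho theta => partial_sum (fun n => V n rho theta) N).
Proof.
  intros h. induction N as [|N IH]; [apply good_zero|].
  eapply good_ext; [| |apply (good_plus _ _ _ _ IH (h N))].
  - intros rho theta s. now rewrite partial_sum_S.
  - intros rho theta. now rewrite partial_sum_S.
Qed.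

Lemma good_sum (T : nat -> R -> R -> R -> C) (V : nat -> R -> R -> C) (n : nat) :
  (forall m, good (T m) (V m)) ->
  good (fun rho theta s => sum_C (fun m => T m rho theta s) n)
    (fun rho theta => sum_C (fun m => V m rho theta) n).
Proof. intros h. exact (good_partial_sum T V (S n) h). Qed.

Lemma Re_Lam (rho theta s : R) : Re (Lam rho theta s) = ln rho + Re (L s).
Proof. reflexivity. Qed.

Lemma Im_Lam (rho theta s : R) : Im (Lam rho theta s) = theta + Im (L s).
Proof. reflexivity. Qed.

Lemma Lam_deriv (rho theta s : R) : 0 < s < k -> is_deriv_curve (Lam rho theta) s (L' s).
Proof.
  intros hs. eapply is_deriv_curve_eq;
    [apply is_deriv_curve_plus; [apply is_deriv_curve_const|now apply hL]|]. ring.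
Qed.

Lemma filterlim_ln_scaled (y B : R) : 0 < B ->
  filterlim (fun s => exp (B * (y + mu * ln s))) (at_right 0) (locally 0).
Proof.
  intros hB. apply (filterlim_comp _ _ _ ln (fun x => exp (B * (y + mu * x))) _ (Rbar_locally m_infty));
    [apply is_lim_ln_0|].
  change (is_lim (fun x => exp (B * (y + mu * x))) m_infty 0).
  apply (is_lim_ext (fun x => exp (B * y) * exp ((B * mu) * x))).
  { intros x. rewrite <- exp_plus. f_equal. ring. }
  assert (hBm : 0 < B * mu) by now apply Rmult_lt_0_compat.
  replace (Finite 0) with (Rbar_mult (exp (B * y)) 0) by (simpl; f_equal; ring).
  apply is_lim_scal_l. apply (is_lim_comp exp (fun x => B * mu * x) m_infty 0 m_infty).
  - apply is_lim_exp_m.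
  - assert (e : Rbar_mult (B * mu) m_infty = m_infty).
    { simpl. destruct (Rle_dec 0 (B * mu)) as [h|h]; [|exfalso; lra].
      destruct (Rle_lt_or_eq_dec 0 (B * mu) h); [reflexivity|exfalso; lra]. }
    generalize (is_lim_scal_l (fun x => x) (B * mu) m_infty m_infty (is_lim_id _)).
    now rewrite e.
  - exists 0. intros x _. discriminate.
Qed.

(** The primitive of the Faxen integrand composed with [Lam], a logarithm of z w^mu that stays in
    the strip. Its real part tends to minus infinity at the start, where the primitive vanishes, and
    is large at [k2], where the primitive is close to the full Faxen integral. *)
Lemma good_faxen (beta c0 : C) : 0 < Re beta ->
  good (fun rho theta s => faxen_log kappa beta c0 (Lam rho theta s) * L' s)%C
    (fun _ _ => Faxen kappa beta c0).
Proof.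
  intros hbeta. assert (hs := sin_delta_pos delta hdelta).
  destruct (faxen_primitive kappa delta beta c0 hkappa hdelta hbeta)
    as [H [K [hK [dH [h0 hinf]]]]].
  (* At [k2] the exponential of the real part of [Lam] is [rho * exp (Re (L k2))], whence the rate;
     the threshold on [rho] makes that real part nonnegative. *)
  exists (fun rho theta s => H (Lam rho theta s)), K, (sin delta / 2 / 2 * exp (Re (L k2))),
    (exp (- Re (L k2))).
  split; [trivial|]. split; [apply Rmult_lt_0_compat; [lra|apply exp_pos]|].
  intros rho theta h1 h2 h3. split; [|split].
  - intros s hs'. apply (Cdiff_curve H (Lam rho theta) s _ _ (dH _)). now apply Lam_deriv.
  - apply (filterlim_C_eps (at_right 0)). intros eps heps.
    set (B := Re beta) in *.
    assert (hlim := filterlim_ln_scaled (ln rho + CP) B hbeta).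
    assert (hlim' := proj1 (filterlim_R_eps (at_right 0) _ 0) hlim (eps / (K + 1))
      ltac:(apply Rdiv_lt_0_compat; lra)).
    eapply filter_imp; [|apply (filter_and _ _ hlim' (right_small k ltac:(lra)))].
    intros s [x1 hs']. replace (H (Lam rho theta s) - 0)%C with (H (Lam rho theta s)) by ring.
    rewrite Rminus_0_r, Rabs_pos_eq in x1 by (left; apply exp_pos).
    eapply Rle_lt_trans; [apply h0; rewrite Im_Lam; now apply hstrip|].
    rewrite Re_Lam. assert (g := hRe s hs'). apply Rabs_le_between in g.
    assert (x2 : exp (B * (ln rho + Re (L s))) <= exp (B * (ln rho + CP + mu * ln s))).
    { apply exp_monotone. apply Rmult_le_compat_l; lra. }
    assert (x3 := exp_pos (B * (ln rho + Re (L s)))).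
    apply Rle_lt_trans with ((K + 1) * exp (B * (ln rho + CP + mu * ln s))); [nra|].
    replace eps with ((K + 1) * (eps / (K + 1))) by (field; lra).
    apply Rmult_lt_compat_l; lra.
  - assert (e : exp (Re (Lam rho theta k2)) = exp (Re (L k2)) * rho).
    { rewrite Re_Lam, exp_plus, exp_ln by lra. ring. }
    eapply Rle_trans; [apply hinf|].
    + rewrite Im_Lam. now apply hstrip.
    + rewrite Re_Lam. apply ln_le in h2; [|apply exp_pos]. rewrite ln_exp in h2. lra.
    + rewrite e. right. f_equal. f_equal. ring.
Qed.

Let w (s : R) : C := Cexp (/ mu * L s).
Let f (n m : nat) : C := (/ INR (fact m) * fps_mul b (fun j => Bell j m c) n)%C.
Let beta (n m : nat) : C := ((INR n + lambda + INR m * (kappa * mu)) / mu)%C.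

Lemma mu_C : RtoC mu <> 0.
Proof. apply RtoC_neq_0; lra. Qed.

Lemma Re_div_mu (z : C) : Re (z / mu) = Re z / mu.
Proof.
  unfold Cdiv. rewrite <- RtoC_inv by lra. unfold Rdiv. simpl. unfold Re, Im. ring.
Qed.

Lemma Im_div_mu (z : C) : Im (z / mu) = Im z / mu.
Proof.
  unfold Cdiv. rewrite <- RtoC_inv by lra. unfold Rdiv. simpl. unfold Re, Im. ring.
Qed.

Lemma Re_beta_pos (n m : nat) : 0 < Re (beta n m).
Proof.
  unfold beta. rewrite Re_div_mu. apply Rdiv_lt_0_compat; trivial.
  replace (Re (INR n + lambda + INR m * (kappa * mu))) with (INR n + Re lambda + INR m * (kappa * mu))
    by (simpl; unfold Re; ring).
  assert (0 <= INR n) by apply pos_INR.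
  assert (0 <= INR m * (kappa * mu)) by (repeat apply Rmult_le_pos; try apply pos_INR; lra). lra.
Qed.

(** [T] is left open because it stands both for the Faxen integrals and for their integrands, which
    gives the two sums the same shape. *)
Definition term (n : nat) (rho theta : R) (T : nat -> C) : C :=
  (/ polar_pow rho theta ((INR n + lambda) / mu) * sum_C (fun m => f n m * T m) n)%C.

Lemma good_main (c0 : C) (N : nat) :
  good (fun rho theta s => partial_sum (fun n => term n rho theta
          (fun m => faxen_log kappa (beta n m) c0 (Lam rho theta s) * L' s)) N)%C
    (fun rho theta => partial_sum (fun n => term n rho theta
          (fun m => Faxen kappa (beta n m) c0)) N).
Proof.
  apply (good_partial_sum (fun n rho theta s => term n rho theta
          (fun m => faxen_log kappa (beta n m) c0 (Lam rho theta s) * L' s)%C)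
    (fun n rho theta => term n rho theta (fun m => Faxen kappa (beta n m) c0))).
  intros n. unfold term.
  (* For [rho >= 1] the power of [rho] is at most 1 in modulus; the constant bounds the contribution
     of theta, which comes from the imaginary part of lambda. *)
  apply (good_scal (fun rho theta => / polar_pow rho theta ((INR n + lambda) / mu))%C
    (exp (Rabs (Im lambda / mu) * (Rabs theta1 + Rabs theta2)))).
  - intros rho theta h1 h2. rewrite Cmod_inv by apply polar_pow_neq_0.
    rewrite Cmod_polar_pow, Re_div_mu, Im_div_mu, <- exp_Ropp. apply exp_monotone.
    replace (Re (INR n + lambda)) with (INR n + Re lambda) by (simpl; unfold Re; ring).
    replace (Im (INR n + lambda)) with (Im lambda) by (simpl; unfold Im; ring).
    assert (0 <= ln rho) by (rewrite <- ln_1; apply ln_le; lra).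
    assert (0 <= (INR n + Re lambda) / mu).
    { apply Rdiv_le_0_compat; trivial. generalize (pos_INR n); lra. }
    assert (0 <= (INR n + Re lambda) / mu * ln rho) by now apply Rmult_le_pos.
    assert (Im lambda / mu * theta <= Rabs (Im lambda / mu) * (Rabs theta1 + Rabs theta2)).
    { eapply Rle_trans; [apply Rle_abs|]. rewrite Rabs_mult.
      apply Rmult_le_compat_l; [apply Rabs_pos|]. apply Rabs_le.
      generalize (Rle_abs theta2) (Rle_abs (- theta1)) (Rabs_pos theta1) (Rabs_pos theta2).
      rewrite Rabs_Ropp. lra. }
    lra.
  - apply (good_sum (fun m rho theta s =>
      f n m * (faxen_log kappa (beta n m) c0 (Lam rho theta s) * L' s))%C
      (fun m rho theta => f n m * Faxen kappa (beta n m) c0)%C).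
    intros m. apply (good_scal (fun _ _ => f n m) (Cmod (f n m))).
    + intros; lra.
    + apply good_faxen, Re_beta_pos.
Qed.

Variable N : nat.
Hypotheses (hw : forall s, 0 < s < k -> Cmod (w s) <= Wb /\ w s <> 0)
  (hBf : expands (fun s => 0 < s < k) w N Bf b)
  (hRl : expands (fun s => 0 < s < k) w (S N) Rl c).

Let c0 : C := c 0%nat.
Let BN : R := (INR N + Re lambda) / mu.

Lemma BN_pos : 0 < BN.
Proof. apply Rdiv_lt_0_compat; trivial. generalize (pos_INR N); lra. Qed.

(** The original integrand times exp (z p(a)), in terms of [Lam]: z (p - p(a)) is [Cexp Lam], and
    w^lambda is z^(-lambda/mu) times the exponential of (lambda / mu) [Lam]. *)
Definition reduced_integrand (rho theta s : R) : C :=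
  (Cexp (- (lambda / mu * ((ln rho, theta) : C)))
   * Cexp (- Cexp (Lam rho theta s) + Cexp (kappa * Lam rho theta s) * Rl s
           + lambda / mu * Lam rho theta s) * (Bf s * L' s))%C.

(** The integrand and the sum of the terms share the Faxen integrand of exponent lambda / mu; the
    other factor is the error of [exponential_expansion]. Its w^N is rho^(-N/mu) times the
    exponential of (N / mu) Re [Lam], in modulus, and the power of rho moves to the front. *)
Lemma pointwise_estimate : exists K, 0 <= K /\ forall rho theta s,
  0 < rho -> theta1 <= theta <= theta2 -> 0 < s < k ->
  Cmod (reduced_integrand rho theta s - partial_sum (fun n => term n rho theta
          (fun m => faxen_log kappa (beta n m) c0 (Lam rho theta s) * L' s)) N)%C
  <= K * exp (- (BN * ln rho)) *
     (exp (BN * (ln rho + mu * ln s)) / (1 + exp (BN * (ln rho + mu * ln s))) ^ 2 / s).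
Proof.
  assert (hs := sin_delta_pos delta hdelta). assert (hBN := BN_pos).
  (* The constant term of [r] stays in the exponential, as the last argument of the Faxen integral;
     only the rest, which is O(w), is expanded. *)
  set (X := fun s => (Rl s + - c0)%C).
  set (cX := fun n => (c n + const_coef (- c0) n)%C).
  assert (hX : expands (fun s => 0 < s < k) w (S N) X cX).
  { apply expands_plus; [exact hRl|]. now apply expands_const. }
  assert (hcX0 : cX 0%nat = 0) by (unfold cX, c0; simpl; ring).
  destruct (exponential_expansion _ w Bf X Wb b cX N hWb hw hBf hX hcX0)
    as [K1 [L1 [hK1 [hL1 E1]]]].
  destruct (faxen_log_bound_exp kappa delta (lambda / mu) c0 L1 hkappa hdelta hL1)
    as [K2 [hK2 E2]].
  (* [Re (L s)] and [mu * ln s] differ by at most [CP]. This costs a factor [exp (- CP)] in the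
     decay and [exp (BN * CP)] in the constant. *)
  set (eta := sin delta / 4 * exp (- CP)).
  assert (heta : 0 < eta) by (apply Rmult_lt_0_compat; [lra|apply exp_pos]).
  destruct (exp_le_bump BN eta hBN heta) as [K3 [hK3 E3]].
  set (Kt := exp (Rabs (Im lambda / mu) * (Rabs theta1 + Rabs theta2))).
  assert (hKt : 0 < Kt) by apply exp_pos.
  assert (hCP := exp_pos (BN * CP)).
  exists (Kt * (K1 * K2) * (exp (BN * CP) * K3) * KL). split.
  { repeat apply Rmult_le_pos; trivial; lra. }
  intros rho theta s hrho ht hs'.
  set (lz := (ln rho, theta) : C). set (xi := Lam rho theta s).
  set (E := Cexp (kappa * xi)).
  assert (hxi : Rabs (Im xi) <= PI / 2 - delta) by (apply hstrip; trivial).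
  (* Removing [c0] changes index 0 only, which [Bell] ignores. *)
  assert (hfX : forall n m, fps_mul b (fun j => Bell j m cX) n = fps_mul b (fun j => Bell j m c) n).
  { intros n m. rewrite !fps_mul_sum. apply sum_C_ext. intros i _. f_equal.
    apply Bell_ext. intros j. unfold cX. simpl. ring. }
  set (S1 := partial_sum (fun n => w s ^ n *
       sum_C (fun m => E ^ m * (/ INR (fact m) * fps_mul b (fun j => Bell j m cX) n)) n)%C N).
  assert (e1 : partial_sum (fun n => term n rho theta
          (fun m => faxen_log kappa (beta n m) c0 xi * L' s))%C N
    = (Cexp (- (lambda / mu * lz)) * faxen_log kappa (lambda / mu) c0 xi * L' s * S1)%C).
  { unfold S1. rewrite <- partial_sum_scal. apply partial_sum_ext. intros n _.
    unfold term.
    replace (Cexp (- (lambda / mu * lz)) * faxen_log kappa (lambda / mu) c0 xi * L' s *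
      (w s ^ n * sum_C (fun m => E ^ m * (/ INR (fact m) * fps_mul b (fun j => Bell j m cX) n)) n))%C
      with ((Cexp (- (lambda / mu * lz)) * faxen_log kappa (lambda / mu) c0 xi * L' s * w s ^ n) *
        sum_C (fun m => E ^ m * (/ INR (fact m) * fps_mul b (fun j => Bell j m cX) n)) n)%C
      by ring.
    rewrite <- !sum_C_scal. apply sum_C_ext. intros m _. rewrite hfX. fold (f n m).
    unfold w, E. rewrite <- !Cexp_nat. unfold polar_pow. fold lz. rewrite <- Cexp_opp.
    unfold faxen_log.
    set (A0 := (- Cexp xi + c0 * Cexp (kappa * xi))%C).
    transitivity (f n m * L' s * (Cexp (- ((INR n + lambda) / mu * lz)) * Cexp (A0 + beta n m * xi)))%C;
      [ring|].
    transitivity (f n m * L' s * (Cexp (- (lambda / mu * lz)) * Cexp (A0 + lambda / mu * xi)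
      * Cexp (INR n * (/ mu * L s)) * Cexp (INR m * (kappa * xi))))%C; [|ring].
    rewrite <- !Cexp_plus. f_equal. f_equal. unfold beta.
    assert (exi : xi = (lz + L s)%C) by reflexivity. rewrite exi. field. apply mu_C. }
  change (Lam rho theta s) with xi. rewrite e1.
  assert (e2 : reduced_integrand rho theta s = (Cexp (- (lambda / mu * lz)) *
    faxen_log kappa (lambda / mu) c0 xi * L' s * (Bf s * Cexp (E * X s)))%C).
  { unfold reduced_integrand. fold xi lz E. unfold faxen_log. fold E.
    replace (- Cexp xi + E * Rl s + lambda / mu * xi)%C with
      ((- Cexp xi + c0 * E + lambda / mu * xi) + E * X s)%C by (unfold X; ring).
    rewrite (Cexp_plus _ (E * X s)). ring. }
  rewrite e2.
  replace (_ - _)%C with (Cexp (- (lambda / mu * lz)) * faxen_log kappa (lambda / mu) c0 xi * L' s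
    * (Bf s * Cexp (E * X s) - S1))%C by ring.
  assert (b1 := E1 s E hs'). fold S1 in b1.
  assert (hE : Cmod E = exp (kappa * Re xi)).
  { unfold E. rewrite Cmod_Cexp. f_equal. simpl. unfold Re; ring. }
  rewrite hE in b1.
  rewrite !Cmod_mult.
  assert (b2 := E2 xi hxi). rewrite Re_div_mu in b2.
  assert (b3 : Cmod (Cexp (- (lambda / mu * lz))) <= Kt * exp (- (Re lambda / mu * ln rho))).
  { rewrite Cmod_Cexp. unfold Kt. rewrite <- exp_plus. apply exp_monotone.
    replace (Re (- (lambda / mu * lz))) with (- (Re (lambda / mu) * ln rho) + Im (lambda / mu) * theta)
      by (unfold lz; simpl; unfold Re, Im; simpl; ring).
    rewrite Re_div_mu, Im_div_mu.
    assert (Im lambda / mu * theta <= Rabs (Im lambda / mu) * (Rabs theta1 + Rabs theta2)).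
    { eapply Rle_trans; [apply Rle_abs|]. rewrite Rabs_mult.
      apply Rmult_le_compat_l; [apply Rabs_pos|]. apply Rabs_le.
      generalize (Rle_abs theta2) (Rle_abs (- theta1)) (Rabs_pos theta1) (Rabs_pos theta2).
      rewrite Rabs_Ropp. lra. }
    lra. }
  set (x := Re xi) in *.
  assert (hx : x = ln rho + Re (L s)) by reflexivity.
  assert (b4 : Cmod (w s) ^ N = exp (INR N / mu * x) * exp (- (INR N / mu * ln rho))).
  { rewrite <- exp_plus. unfold w. rewrite Cmod_Cexp.
    replace (Re (/ mu * L s)) with (Re (L s) / mu)
      by (rewrite <- Re_div_mu; f_equal; field; apply mu_C).
    rewrite hx. clear. induction N as [|n IH].
    - simpl. rewrite <- exp_0. f_equal. unfold Rdiv. ring.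
    - simpl pow. rewrite IH, <- exp_plus, S_INR. f_equal. unfold Rdiv. ring. }
  assert (g := hRe s hs'). apply Rabs_le_between in g.
  set (Y := ln rho + mu * ln s).
  assert (b5 : exp (BN * x - sin delta / 4 * exp x) <= exp (BN * CP) * exp (BN * Y - eta * exp Y)).
  { rewrite <- exp_plus. apply exp_monotone.
    assert (BN * x <= BN * (CP + Y)) by (apply Rmult_le_compat_l; unfold Y; lra).
    assert (eta * exp Y <= sin delta / 4 * exp x).
    { unfold eta. rewrite Rmult_assoc, <- exp_plus. apply Rmult_le_compat_l; [lra|].
      apply exp_monotone. unfold Y. lra. }
    lra. }
  assert (b6 := E3 Y).
  assert (b7 := hL' s hs').
  set (A := Cmod (Cexp (- (lambda / mu * lz)))) in *.
  set (Fm := Cmod (faxen_log kappa (lambda / mu) c0 xi)) in *.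
  set (Rm := Cmod (Bf s * Cexp (E * X s) - S1)%C) in *.
  set (bump := exp (BN * Y) / (1 + exp (BN * Y)) ^ 2) in *.
  assert (pA : 0 <= A) by apply Cmod_ge_0. assert (pF : 0 <= Fm) by apply Cmod_ge_0.
  assert (pR : 0 <= Rm) by apply Cmod_ge_0. assert (pL : 0 <= Cmod (L' s)) by apply Cmod_ge_0.
  assert (b8 : Fm * Rm <= K1 * K2 * exp (- (INR N / mu * ln rho)) * exp (BN * x - sin delta / 4 * exp x)).
  { apply Rle_trans with (Fm * (K1 * Cmod (w s) ^ N * exp (L1 * exp (kappa * x)))).
    - now apply Rmult_le_compat_l.
    - rewrite b4.
      replace (Fm * (K1 * (exp (INR N / mu * x) * exp (- (INR N / mu * ln rho))) * exp (L1 * exp (kappa * x))))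
        with (K1 * exp (INR N / mu * x) * exp (- (INR N / mu * ln rho)) * (Fm * exp (L1 * exp (kappa * x)))) by ring.
      assert (pe : 0 <= K1 * exp (INR N / mu * x) * exp (- (INR N / mu * ln rho))).
      { repeat apply Rmult_le_pos; trivial; left; apply exp_pos. }
      eapply Rle_trans; [apply Rmult_le_compat_l; [exact pe|exact b2]|]. right.
      replace (BN * x - sin delta / 4 * exp x) with
        (INR N / mu * x + (Re lambda / mu * x - sin delta / 4 * exp x))
        by (unfold BN, Rdiv; ring).
      rewrite (exp_plus (INR N / mu * x)). ring. }
  assert (b9 : exp (- (BN * ln rho)) = exp (- (INR N / mu * ln rho)) * exp (- (Re lambda / mu * ln rho))).
  { rewrite <- exp_plus. f_equal. unfold BN, Rdiv. ring. }
  assert (q1 : exp (BN * x - sin delta / 4 * exp x) <= exp (BN * CP) * (K3 * bump)).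
  { eapply Rle_trans; [exact b5|]. apply Rmult_le_compat_l; [lra|exact b6]. }
  assert (pe1 := exp_pos (- (INR N / mu * ln rho))).
  assert (pe2 := exp_pos (- (Re lambda / mu * ln rho))).
  assert (q2 : Fm * Rm <= K1 * K2 * exp (- (INR N / mu * ln rho)) * (exp (BN * CP) * (K3 * bump))).
  { eapply Rle_trans; [exact b8|]. apply Rmult_le_compat_l; trivial.
    repeat apply Rmult_le_pos; trivial; lra. }
  replace (A * Fm * Cmod (L' s) * Rm) with (A * (Fm * Rm) * Cmod (L' s)) by ring.
  apply Rle_trans with ((Kt * exp (- (Re lambda / mu * ln rho))) *
    (K1 * K2 * exp (- (INR N / mu * ln rho)) * (exp (BN * CP) * (K3 * bump))) * (KL / s)).
  - apply Rmult_le_compat; trivial; [apply Rmult_le_pos; trivial; now apply Rmult_le_pos|].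
    apply Rmult_le_compat; trivial. now apply Rmult_le_pos.
  - right. rewrite b9. unfold Rdiv. ring.
Qed.

(** The difference between [I] and the primitive of [good_main] has increments dominated by those of
    [G], whose total variation is at most A / (BN mu); rho enters this bound only through the factor
    rho^(-BN) of [A]. This gives the limit of [I] at the start together with the error. *)
Lemma local_estimate : exists K rho0, 0 <= K /\ forall rho theta (I : R -> C),
  1 <= rho -> rho0 <= rho -> theta1 <= theta <= theta2 ->
  (forall s, 0 < s < k -> is_deriv_curve I s (reduced_integrand rho theta s)) ->
  exists I0 : C, filterlim_C I (at_right 0) I0 /\
    Cmod (I k2 - I0 - partial_sum (fun n => term n rho theta
          (fun m => Faxen kappa (beta n m) c0)) N)%C <= K * exp (- (BN * ln rho)).
Proof.
  assert (hBN := BN_pos).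
  destruct pointwise_estimate as [K1 [hK1 E1]].
  destruct (good_main c0 N) as [Psi [K2 [eta [rho0 [hK2 [heta X]]]]]].
  destruct (exp_decay_le_power eta BN heta) as [K3 [hK3 E3]].
  exists (K1 / (BN * mu) + K2 * K3), rho0.
  assert (hBm : 0 < BN * mu) by now apply Rmult_lt_0_compat.
  split. { apply Rplus_le_le_0_compat; [apply Rdiv_le_0_compat; lra|now apply Rmult_le_pos]. }
  intros rho theta I h1 h2 h3 dI.
  destruct (X rho theta h1 h2 h3) as [x1 [x2 x3]].
  set (A := K1 * exp (- (BN * ln rho))).
  assert (hA : 0 <= A) by (apply Rmult_le_pos; trivial; left; apply exp_pos).
  set (Y := fun s => exp (BN * (ln rho + mu * ln s))).
  set (G := fun s => - (A / (BN * mu)) / (1 + Y s)).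
  assert (hY : forall s, 0 < Y s) by (intros s; apply exp_pos).
  assert (dG : forall s, 0 < s -> is_derive G s (A * (Y s / (1 + Y s) ^ 2 / s))).
  { intros s hs. assert (h := hY s). unfold G, Y in *. auto_derive.
    - repeat split; trivial. lra.
    - field. repeat split; lra. }
  set (Phi := fun s => (I s - Psi rho theta s)%C).
  assert (hPhi : forall x y, 0 < x <= y -> y < k -> Cmod (Phi y - Phi x)%C <= G y - G x).
  { intros x y hxy hy.
    apply (curve_mean_value Phi (fun s => reduced_integrand rho theta s -
      partial_sum (fun n => term n rho theta
          (fun m => faxen_log kappa (beta n m) c0 (Lam rho theta s) * L' s)) N)%C
      G (fun s => A * (Y s / (1 + Y s) ^ 2 / s))); [lra| | |].
    - intros s hs. apply is_deriv_curve_minus; [apply dI; lra|apply x1; lra].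
    - intros s hs. apply dG; lra.
    - intros s hs. apply E1; trivial; lra. }
  assert (hGlim : filterlim G (at_right 0) (locally (- (A / (BN * mu)) / (1 + 0)))).
  { apply (filterlim_comp _ _ _ Y (fun y => - (A / (BN * mu)) / (1 + y)) _ (locally 0)).
    - apply filterlim_ln_scaled, hBN.
    - apply (ex_derive_continuous (fun y => - (A / (BN * mu)) / (1 + y)) 0).
      auto_derive. lra. }
  destruct (dominated_limit (at_right 0) Phi G (fun s => 0 < s < k)
    (- (A / (BN * mu)) / (1 + 0))) as [l [hl hlb]].
  { apply right_small. lra. }
  { intros x y hx hy. destruct (Rle_lt_dec x y) as [h|h].
    - eapply Rle_trans; [apply hPhi; lra|apply Rle_abs].
    - rewrite Cmod_minus_sym, Rabs_minus_sym.
      eapply Rle_trans; [apply hPhi; lra|apply Rle_abs]. }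
  { exact hGlim. }
  exists l. split.
  - replace l with (l + 0)%C by ring.
    apply filterlim_ext with (fun s => (Phi s + Psi rho theta s)%C).
    + intros s. unfold Phi. ring.
    + now apply filterlim_C_plus; [typeclasses eauto|..].
  - specialize (hlb k2 hk2).
    replace (_ - _)%C with ((Phi k2 - l) + (Psi rho theta k2 - partial_sum (fun n => term n rho theta
          (fun m => Faxen kappa (beta n m) c0)) N))%C by (unfold Phi; ring).
    eapply Rle_trans; [apply Cmod_triangle|].
    rewrite Rmult_plus_distr_r. apply Rplus_le_compat.
    + rewrite Cmod_minus_sym. eapply Rle_trans; [exact hlb|].
      unfold G. assert (h := hY k2). set (z := Y k2) in *.
      assert (hq : 0 <= A / (BN * mu)) by (apply Rdiv_le_0_compat; lra).
      replace (- (A / (BN * mu)) / (1 + 0) - - (A / (BN * mu)) / (1 + z))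
        with (- (A / (BN * mu) * (z / (1 + z)))) by (field; lra).
      rewrite Rabs_Ropp.
      assert (hz : 0 <= z / (1 + z) <= 1).
      { split; [apply Rdiv_le_0_compat; lra|]. apply Rmult_le_reg_r with (1 + z); [lra|].
        unfold Rdiv. rewrite Rmult_assoc, Rinv_l by lra. lra. }
      rewrite Rabs_pos_eq by (apply Rmult_le_pos; lra).
      apply Rle_trans with (A / (BN * mu) * 1); [apply Rmult_le_compat_l; lra|].
      right. unfold A. field. lra.
    + eapply Rle_trans; [exact x3|]. rewrite Rmult_assoc. apply Rmult_le_compat_l; trivial.
      now apply E3.
Qed.

End LocalEstimate.

Lemma RInt_gen_at_left (f : R -> R) (x0 : R) :
  ex_RInt_gen f (at_point x0) (at_left 1) ->
  exists l, filterlim (fun s => RInt f x0 s) (at_left 1) (locally l).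
Proof.
  intros [l H]. exists l. intros P hP. specialize (H P hP).
  destruct H as [Q1 Q2 h1 h2 h3].
  unfold filtermap. eapply filter_imp; [|exact h2]. intros s hs.
  destruct (h3 x0 s h1 hs) as [y [hy Py]]. simpl in hy.
  now rewrite (is_RInt_unique _ _ _ _ hy).
Qed.

Lemma continuous_continuity_pt (f : R -> R) (s : R) : continuous f s -> continuity_pt f s.
Proof. intros h. now apply continuity_pt_filterlim. Qed.

(** * The rest of the contour *)

Section Global.

Variables (p q r : C -> C) (T : C -> Prop) (gamma : R -> C) (a : C)
  (kappa theta1 theta2 delta Z : R).
Hypotheses (hp : analytic_in T p) (hq : analytic_in T q) (hr : analytic_in T r)
  (hT : forall s, 0 < s < 1 -> T (gamma s))
  (hchain : forall x, 0 < x < 1 -> smooth_chain gamma 0 x)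
  (hkappa : 0 <= kappa < 1) (htheta : theta1 <= theta2) (hdelta : 0 < delta)
  (hsec : forall theta s, theta1 <= theta <= theta2 -> 0 < s < 1 -> exists alpha,
     is_arg (polar 1 theta * p (gamma s) - polar 1 theta * p a)%C alpha /\
     Rabs alpha <= PI / 2 - delta)
  (hend : exists c, 0 < c /\ at_left 1 (fun s => forall theta, theta1 <= theta <= theta2 ->
       c <= Rabs (Re (polar 1 theta * p (gamma s) - polar 1 theta * p a)%C)))
  (hO : exists K, at_left 1 (fun s => Cmod (r (gamma s)) <= K * Cmod (p (gamma s) - p a)%C))
  (hZ : 0 < Z).

Let F (rho theta : R) : R -> C := integrand p q r gamma kappa rho theta.
Let P (s : R) : C := phase p gamma a s.

Lemma gamma_continuous (s : R) : 0 < s < 1 -> continuous_C gamma s.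
Proof.
  intros hs. apply (chain_continuous gamma 0 ((s + 1) / 2)); [apply hchain; lra|lra].
Qed.

Lemma analytic_along (f : C -> C) (s : R) : analytic_in T f -> 0 < s < 1 ->
  continuous_C (fun u => f (gamma u)) s.
Proof.
  intros hf hs. destruct (hf (gamma s) (hT s hs)) as [l hl].
  apply (Cdiff_continuous f gamma s l); [now apply is_derive_Cdiff|now apply gamma_continuous].
Qed.

Lemma factor_continuous (rho theta s : R) : 0 < s < 1 ->
  continuous_C (fun s => Cexp (- (polar rho theta * p (gamma s)) +
    polar_pow rho theta kappa * r (gamma s)) * q (gamma s))%C s.
Proof.
  intros hs. apply continuous_C_mult; [|now apply analytic_along].
  apply continuous_C_Cexp, continuous_C_plus.
  - apply (continuous_ext (fun s => (- polar rho theta * p (gamma s))%C));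
      [intros t; Cring|].
    apply continuous_C_mult; [apply continuous_C_const|now apply analytic_along].
  - apply continuous_C_mult; [apply continuous_C_const|now apply analytic_along].
Qed.

Lemma integrand_ex_RInt (rho theta c d : R) : 0 < c -> c <= d -> d < 1 ->
  ex_RInt (V := C_R_CompleteNormedModule) (F rho theta) c d.
Proof.
  intros h1 h2 h3.
  apply (chain_ex_RInt (V := C_R_CompleteNormedModule) (fun z => z) gamma _ 0 ((d + 1) / 2)
    (fun z => continuous_id z) (hchain ((d + 1) / 2) ltac:(lra)) (fun s => factor_continuous rho theta s));
    lra.
Qed.

Lemma norm_integrand_ex_RInt (rho theta c d : R) : 0 < c -> c <= d -> d < 1 ->
  ex_RInt (fun s => Cmod (F rho theta s)) c d.
Proof.
  intros h1 h2 h3.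
  apply (chain_ex_RInt (V := R_CompleteNormedModule) Cmod gamma
    (fun s => Cexp (- (polar rho theta * p (gamma s)) +
    polar_pow rho theta kappa * r (gamma s)) * q (gamma s))%C 0 ((d + 1) / 2)); try lra.
  - intros z. apply (continuous_ext (@norm R_AbsRing C_R_NormedModule)); [apply Cmod_norm_R|].
    apply (filterlim_norm (V := C_R_NormedModule)).
  - apply hchain; lra.
  - intros s hs. now apply factor_continuous.
Qed.

(** Beyond some parameter the conditions at [b] apply; up to there compactness does, the phase being
    continuous and nowhere zero. *)
Lemma phase_bounds (k2 : R) : 0 < k2 < 1 -> exists cP Kr, 0 < cP /\ 0 <= Kr /\
  forall s, k2 <= s < 1 -> cP <= Cmod (P s) /\ Cmod (r (gamma s)) <= Kr * Cmod (P s).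
Proof.
  intros hk2. destruct hend as [c [hc Hc]]. destruct hO as [K HK].
  destruct (proj1 (at_left_1_iff _) (filter_and _ _ Hc HK)) as [x [hx X]].
  (* Beyond both [k2] and [x], and still below 1. *)
  set (x1 := Rmax ((k2 + 1) / 2) ((x + 1) / 2)).
  assert (m1 : (k2 + 1) / 2 <= x1) by apply Rmax_l.
  assert (m2 : (x + 1) / 2 <= x1) by apply Rmax_r.
  assert (m3 : x1 < 1) by (apply Rmax_lub_lt; lra).
  assert (cP : forall s, 0 < s < 1 -> continuous_C P s).
  { intros s hs. apply continuous_C_eps. intros eps heps.
    destruct (proj1 (continuous_C_eps _ s) (analytic_along p s hp hs) eps heps) as [d [hd hd']].
    exists d. split; trivial. intros u hu. specialize (hd' u hu).
    unfold P, phase. replace (p (gamma u) - p a - (p (gamma s) - p a))%C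
      with (p (gamma u) - p (gamma s))%C by ring. exact hd'. }
  destruct (continuity_ab_min (fun s => Cmod (P s)) k2 x1 ltac:(lra)) as [sm [hsm1 hsm2]].
  { intros s hs. apply continuous_continuity_pt, continuous_Cmod, cP. lra. }
  destruct (continuity_ab_maj (fun s => Cmod (r (gamma s))) k2 x1 ltac:(lra)) as [sM [hsM1 hsM2]].
  { intros s hs. apply continuous_continuity_pt, continuous_Cmod, analytic_along; [exact hr|lra]. }
  set (m := Cmod (P sm)) in *. set (M := Cmod (r (gamma sM))) in *.
  assert (hm : 0 < m).
  { apply (phase_sector p gamma a theta1 theta2 delta hdelta hsec theta1 sm); lra. }
  assert (hM : 0 <= M) by apply Cmod_ge_0.
  exists (Rmin m c), (Rabs K + M / m).
  assert (hMm : 0 <= M / m) by now apply Rdiv_le_0_compat.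
  split; [now apply Rmin_pos|]. split; [generalize (Rabs_pos K); lra|].
  assert (n1 := Rmin_l m c). assert (n2 := Rmin_r m c).
  intros s hs. assert (hP0 := Cmod_ge_0 (P s)). destruct (Rle_lt_dec s x1) as [h|h].
  - assert (b1 := hsm1 s ltac:(lra)). assert (b2 := hsM1 s ltac:(lra)).
    cbv beta in b1, b2. fold m in b1. fold M in b2.
    split; [lra|].
    apply Rle_trans with (M / m * Cmod (P s)).
    + apply Rle_trans with (1 := b2). replace M with (M / m * m) at 1 by (field; lra).
      now apply Rmult_le_compat_l.
    + apply Rmult_le_compat_r; trivial. generalize (Rabs_pos K). lra.
  - destruct (X s ltac:(lra)) as [b1 b2]. specialize (b1 theta1 ltac:(lra)).
    replace (polar 1 theta1 * p (gamma s) - polar 1 theta1 * p a)%C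
      with (polar 1 theta1 * P s)%C in b1 by (unfold P, phase; ring).
    assert (b3 := re_le_Cmod (polar 1 theta1 * P s)).
    rewrite Cmod_mult, Cmod_polar in b3 by lra. split; [lra|].
    change (Cmod (r (gamma s)) <= K * Cmod (P s)) in b2.
    apply Rle_trans with (1 := b2). apply Rmult_le_compat_r; trivial.
    generalize (Rle_abs K). lra.
Qed.

Lemma Cmod_polar_pow_R (rho theta x : R) : Cmod (polar_pow rho theta (RtoC x)) = exp (x * ln rho).
Proof. rewrite Cmod_polar_pow. simpl. f_equal. ring. Qed.

(** The reference is the integrand at [Z] and [theta1]; q and the derivative of gamma are common
    factors, so only exponents are compared. The sector condition gains rho sin delta |P|. The term
    in r loses Kr rho^kappa |P|, and cancelling the reference exponent loses A |P| and a
    constant. *)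
Lemma integrand_comparison (k2 : R) : 0 < k2 < 1 -> exists K c rho0, 0 <= K /\ 0 < c /\
  forall rho theta s, 1 <= rho -> rho0 <= rho -> theta1 <= theta <= theta2 -> k2 <= s < 1 ->
    Cmod (Cexp (polar rho theta * p a) * F rho theta s)%C
      <= K * exp (- (c * rho)) * Cmod (F Z theta1 s).
Proof.
  intros hk2. destruct (phase_bounds k2 hk2) as [cP [Kr [hcP [hKr B]]]].
  assert (hs0 := sin_delta_pos delta
    (conj hdelta (delta_le p gamma a theta1 theta2 delta htheta hsec))).
  destruct (exp_sublinear Kr kappa (sin delta / 4) hKr hkappa ltac:(lra)) as [K1 [hK1 E1]].
  set (A := Z + exp (kappa * ln Z) * Kr).
  assert (hA : 0 <= A).
  { unfold A. assert (0 <= exp (kappa * ln Z) * Kr)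
      by (apply Rmult_le_pos; trivial; left; apply exp_pos). lra. }
  (* From this [rho] on, the losses in |P| are at most half of the gain, and the other half with
     [cP <= Cmod P] is the rate. The first constant accounts for p(a) in the reference integrand. *)
  exists (exp (Z * Cmod (p a))), (sin delta / 2 * cP), (4 * (K1 + A) / sin delta).
  split; [left; apply exp_pos|]. split; [apply Rmult_lt_0_compat; lra|].
  intros rho theta s h1 h2 h3 h4. destruct (B s h4) as [b1 b2].
  assert (hP0 := Cmod_ge_0 (P s)).
  destruct (phase_sector p gamma a theta1 theta2 delta hdelta hsec theta s h3 ltac:(lra)) as [_ b3].
  fold (P s) in b3.
  set (Q := (q (gamma s) * derivRC gamma s)%C).
  assert (e1 : (Cexp (polar rho theta * p a) * F rho theta s)%C =
    (Cexp (- (polar rho theta * P s) + polar_pow rho theta kappa * r (gamma s)) * Q)%C).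
  { unfold F, integrand, Q, P, phase. rewrite !Cmult_assoc, <- Cexp_plus.
    f_equal. f_equal. f_equal. ring. }
  assert (e2 : F Z theta1 s = (Cexp (- (polar Z theta1 * p a) + (- (polar Z theta1 * P s)
    + polar_pow Z theta1 kappa * r (gamma s))) * Q)%C).
  { unfold F, integrand, Q, P, phase. rewrite !Cmult_assoc. f_equal. f_equal. f_equal. ring. }
  rewrite e1, e2, !Cmod_mult, !Cmod_Cexp, <- !Rmult_assoc.
  apply Rmult_le_compat_r; [apply Cmod_ge_0|]. rewrite <- !exp_plus. apply exp_monotone.
  assert (u1 : Re (polar rho theta * P s) = rho * Re (polar 1 theta * P s)).
  { replace (polar rho theta) with (rho * polar 1 theta)%C
      by (rewrite <- polar_scale, Rmult_1_r; reflexivity).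
    simpl. unfold Re, Im. ring. }
  assert (u2 : rho * (sin delta * Cmod (P s)) <= Re (polar rho theta * P s))
    by (rewrite u1; apply Rmult_le_compat_l; lra).
  assert (hr1 : forall y, Rabs (Re y) <= Cmod y) by apply re_le_Cmod.
  assert (u3 : Re (polar_pow rho theta kappa * r (gamma s)) <= exp (kappa * ln rho) * (Kr * Cmod (P s))).
  { eapply Rle_trans; [apply Rle_abs|]. eapply Rle_trans; [apply hr1|].
    rewrite Cmod_mult, Cmod_polar_pow_R. apply Rmult_le_compat_l; trivial. left; apply exp_pos. }
  assert (u4 : Re (polar Z theta1 * p a) <= Z * Cmod (p a)).
  { eapply Rle_trans; [apply Rle_abs|]. eapply Rle_trans; [apply hr1|].
    rewrite Cmod_mult, Cmod_polar by lra. lra. }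
  assert (u5 : Re (polar Z theta1 * P s) <= Z * Cmod (P s)).
  { eapply Rle_trans; [apply Rle_abs|]. eapply Rle_trans; [apply hr1|].
    rewrite Cmod_mult, Cmod_polar by lra. lra. }
  assert (u6 : - Re (polar_pow Z theta1 kappa * r (gamma s)) <= exp (kappa * ln Z) * (Kr * Cmod (P s))).
  { eapply Rle_trans; [apply Rle_abs|]. rewrite Rabs_Ropp. eapply Rle_trans; [apply hr1|].
    rewrite Cmod_mult, Cmod_polar_pow_R. apply Rmult_le_compat_l; trivial. left; apply exp_pos. }
  assert (u7 := E1 (ln rho)). rewrite exp_ln in u7 by lra.
  assert (u8 : K1 + A <= sin delta / 4 * rho).
  { apply Rmult_le_compat_l with (r := sin delta / 4) in h2; [|lra].
    replace (sin delta / 4 * (4 * (K1 + A) / sin delta)) with (K1 + A) in h2 by (field; lra).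
    exact h2. }
  assert (u9 : (Kr * exp (kappa * ln rho) + A) * Cmod (P s) <= (sin delta / 2 * rho) * Cmod (P s))
    by (apply Rmult_le_compat_r; lra).
  assert (u10 : sin delta / 2 * rho * cP <= sin delta / 2 * rho * Cmod (P s)).
  { apply Rmult_le_compat_l; trivial. apply Rmult_le_pos; lra. }
  unfold A in u9.
  change (Re (- (polar rho theta * P s) + polar_pow rho theta kappa * r (gamma s)))
    with (- Re (polar rho theta * P s) + Re (polar_pow rho theta kappa * r (gamma s))).
  change (Re (- (polar Z theta1 * p a) + (- (polar Z theta1 * P s)
    + polar_pow Z theta1 kappa * r (gamma s))))
    with (- Re (polar Z theta1 * p a) + (- Re (polar Z theta1 * P s)
    + Re (polar_pow Z theta1 kappa * r (gamma s)))).
  lra.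
Qed.

Definition integral_from (k2 rho theta s : R) : C :=
  RInt (V := C_R_CompleteNormedModule) (integrand p q r gamma kappa rho theta) k2 s.

Lemma is_RInt_integral_from (k2 rho theta x y : R) : 0 < k2 < 1 -> 0 < x -> x <= y -> y < 1 ->
  is_RInt (V := C_R_NormedModule) (F rho theta) x y
    (integral_from k2 rho theta y - integral_from k2 rho theta x)%C.
Proof.
  intros hk2 hx hxy hy.
  assert (ex : forall u, 0 < u < 1 -> is_RInt (V := C_R_NormedModule) (F rho theta) k2 u
    (integral_from k2 rho theta u)).
  { intros u hu. apply (RInt_correct (V := C_R_CompleteNormedModule)).
    destruct (Rle_lt_dec k2 u) as [h|h].
    - apply integrand_ex_RInt; lra.
    - apply ex_RInt_swap, integrand_ex_RInt; lra. }
  assert (X := is_RInt_Chasles (V := C_R_NormedModule) (F rho theta) x k2 y _ _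
    (is_RInt_swap _ _ _ _ (ex x ltac:(lra))) (ex y ltac:(lra))).
  replace (integral_from k2 rho theta y - integral_from k2 rho theta x)%C with
    (@plus C_R_NormedModule (opp (integral_from k2 rho theta x)) (integral_from k2 rho theta y));
    [exact X|].
  change (- integral_from k2 rho theta x + integral_from k2 rho theta y
    = integral_from k2 rho theta y - integral_from k2 rho theta x)%C. ring.
Qed.

Lemma integral_from_self (k2 rho theta : R) : integral_from k2 rho theta k2 = 0.
Proof. unfold integral_from. now rewrite RInt_point. Qed.

Variable x0 : R.
Hypotheses (hx0 : 0 < x0 < 1)
  (hconv : ex_RInt_gen (fun s => Cmod (integrand p q r gamma kappa Z theta1 s))
     (at_point x0) (at_left 1)).

(** [A] is the running integral of the modulus of the reference integrand and converges at [b] by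
    hypothesis. [integrand_comparison] makes the small multiple [B * A] dominate the increments of
    the integral for large rho, so [dominated_limit] gives convergence and size at once. *)
Lemma tail_estimate (k2 : R) : 0 < k2 < 1 -> exists K c rho0, 0 <= K /\ 0 < c /\
  forall rho theta, 1 <= rho -> rho0 <= rho -> theta1 <= theta <= theta2 ->
    exists I1 : C, filterlim_C (integral_from k2 rho theta) (at_left 1) I1 /\
      Cmod (Cexp (polar rho theta * p a) * I1)%C <= K * exp (- (c * rho)).
Proof.
  intros hk2. destruct (integrand_comparison k2 hk2) as [K [c [rho0 [hK [hc X]]]]].
  destruct (RInt_gen_at_left _ _ hconv) as [l0 hl0].
  set (N0 := fun s => Cmod (F Z theta1 s)).
  assert (exN : forall x y, 0 < x < 1 -> 0 < y < 1 -> ex_RInt N0 x y).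
  { intros x y hx hy. destruct (Rle_lt_dec x y) as [h|h].
    - apply norm_integrand_ex_RInt; lra.
    - apply ex_RInt_swap, norm_integrand_ex_RInt; lra. }
  set (A := fun s => RInt N0 k2 s).
  set (gA := RInt N0 k2 x0 + l0).
  assert (hA : filterlim A (at_left 1) (locally gA)).
  { apply (filterlim_ext_loc (fun s => RInt N0 k2 x0 + RInt N0 x0 s)).
    - apply at_left_1_iff. exists 0. split; [lra|]. intros s hs.
      apply (RInt_Chasles (V := R_CompleteNormedModule) N0); apply exN; lra.
    - apply (filterlim_R_eps (at_left 1)). intros eps heps.
      assert (h := proj1 (filterlim_R_eps (at_left 1) _ l0) hl0 eps heps).
      eapply filter_imp; [|exact h]. intros s hs. unfold gA.
      replace (RInt N0 k2 x0 + RInt N0 x0 s - (RInt N0 k2 x0 + l0)) with (RInt N0 x0 s - l0) by ring.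
      exact hs. }
  exists (K * Rabs gA), c, rho0. split; [apply Rmult_le_pos; trivial; apply Rabs_pos|].
  split; trivial. intros rho theta h1 h2 h3.
  set (E := Cexp (polar rho theta * p a)).
  set (B := K * exp (- (c * rho))).
  assert (hB : 0 <= B) by (apply Rmult_le_pos; trivial; left; apply exp_pos).
  assert (inc : forall x y, k2 <= x <= y -> y < 1 ->
    Cmod (E * integral_from k2 rho theta y - E * integral_from k2 rho theta x)%C
      <= B * A y - B * A x).
  { intros x y hxy hy.
    replace (E * integral_from k2 rho theta y - E * integral_from k2 rho theta x)%C
      with (E * (integral_from k2 rho theta y - integral_from k2 rho theta x))%C by ring.
    assert (i1 := is_RInt_integral_from k2 rho theta x y hk2 ltac:(lra) ltac:(lra) hy).
    assert (i2 : is_RInt N0 x y (RInt N0 x y)) by (apply (RInt_correct (V := R_CompleteNormedModule)), exN; lra).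
    assert (hE : 0 < Cmod E) by (apply Cmod_gt_0, Cexp_neq_0).
    (* The comparison bounds the integrand multiplied by [E]; dividing by the modulus of [E] gives a
       bound for the integrand itself. *)
    assert (i3 := is_RInt_scal (V := R_NormedModule) N0 x y (B / Cmod E) _ i2).
    assert (i5 : forall s, x <= s <= y ->
      @norm R_AbsRing C_R_NormedModule (F rho theta s) <= scal (B / Cmod E) (N0 s)).
    { intros s hs. rewrite Cmod_norm_R. change (Cmod (F rho theta s) <= B / Cmod E * N0 s).
      assert (g := X rho theta s h1 h2 h3 ltac:(lra)). fold E in g. rewrite Cmod_mult in g.
      apply Rmult_le_reg_l with (Cmod E); trivial.
      replace (Cmod E * (B / Cmod E * N0 s)) with (B * N0 s) by (field; lra). exact g. }
    assert (i4 := norm_RInt_le (V := C_R_NormedModule) (F rho theta)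
      (fun s => scal (B / Cmod E) (N0 s)) x y _ _ ltac:(lra) i5 i1 i3).
    rewrite Cmod_norm_R in i4. rewrite Cmod_mult.
      assert (e : RInt N0 x y = A y - A x).
      { assert (ch := RInt_Chasles (V := R_CompleteNormedModule) N0 k2 x y
          (exN k2 x ltac:(lra) ltac:(lra)) (exN x y ltac:(lra) ltac:(lra))).
        change (A x + RInt N0 x y = A y) in ch. lra. }
      rewrite e in i4.
      apply Rmult_le_compat_l with (r := Cmod E) in i4; [|lra].
      eapply Rle_trans; [exact i4|]. right.
      change (Cmod E * (B / Cmod E * (A y - A x)) = B * A y - B * A x). field. lra. }
  destruct (dominated_limit (at_left 1) (fun s => E * integral_from k2 rho theta s)%C
    (fun s => B * A s) (fun s => k2 <= s < 1) (B * gA)) as [l [hl hlb]].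
  { apply at_left_1_iff. exists k2. split; [lra|]. intros s hs; lra. }
  { intros x y hx hy. destruct (Rle_lt_dec x y) as [h|h].
    - eapply Rle_trans; [apply inc; lra|apply Rle_abs].
    - rewrite Cmod_minus_sym, Rabs_minus_sym.
      eapply Rle_trans; [apply inc; lra|apply Rle_abs]. }
  { apply (filterlim_comp _ _ _ A (fun x => B * x) _ (locally gA)); trivial.
    apply (filterlim_scal_r (V := R_NormedModule) B gA). }
  assert (hE : E <> 0) by apply Cexp_neq_0.
  exists (l / E)%C. split.
  - apply (filterlim_ext (fun s => / E * (E * integral_from k2 rho theta s))%C).
    + intros s. Cfield. exact hE.
    + replace (l / E)%C with (/ E * l)%C by (unfold Cdiv; ring).
      now apply filterlim_C_scal; [typeclasses eauto|].
  - replace (E * (l / E))%C with l by (field; exact hE).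
    specialize (hlb k2 ltac:(lra)). rewrite integral_from_self in hlb.
    replace (l - E * 0)%C with l in hlb by ring.
    eapply Rle_trans; [exact hlb|].
    assert (A0 : A k2 = 0) by (unfold A; now rewrite RInt_point).
    rewrite A0, Rmult_0_r, Rminus_0_r, Rabs_mult, (Rabs_pos_eq B) by trivial.
    unfold B. right. ring.
Qed.

End Global.

(** * The first coefficients, the branch for p_0 and the conclusion *)

Lemma Bell_0_0 (c : nat -> C) : Bell 0 0 c = 1.
Proof. reflexivity. Qed.

Lemma Bell_1_0 (c : nat -> C) : Bell 1 0 c = 0.
Proof. reflexivity. Qed.

Lemma Bell_1_1 (c : nat -> C) : Bell 1 1 c = c 1%nat.
Proof. unfold Bell. simpl. rewrite fps_mul_1. simpl. ring. Qed.

(** Both values lie in an interval of length [PI], so they are less than a full turn apart. *)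
Lemma arg_p0_unique (p0 : C) (mu varpi theta1 theta2 v v' : R) : theta1 <= theta2 ->
  arg_p0 p0 mu varpi theta1 theta2 v -> arg_p0 p0 mu varpi theta1 theta2 v' -> v = v'.
Proof.
  intros ht [[hn e] h] [[_ e'] h'].
  assert (h0 : 0 < Cmod p0) by now apply Cmod_gt_0.
  specialize (h theta1 ltac:(lra)). specialize (h' theta1 ltac:(lra)).
  apply Rabs_le_between in h. apply Rabs_le_between in h'.
  assert (hpi := PI_RGT_0).
  assert (X : ((ln (Cmod p0), v) : C) = ((ln (Cmod p0), v') : C)).
  { apply Cexp_inj.
    - rewrite !Cexp_ln by trivial. now rewrite <- e.
    - simpl. apply Rabs_def1; lra. }
  now injection X.
Qed.

Ltac feed H := repeat match type of H with
  | ?A -> _ => match type of A with Prop => specialize (H ltac:(assumption)) end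
  end.

Theorem theorem1p1
  (p q r : C -> C) (T : C -> Prop) (gamma : R -> C) (a : C) (b : endpoint)
  (mu nu : R) (lambda : C) (p_ q_ r_ : nat -> C) (varpi : R)
  (theta1 theta2 Z delta : R)
  (hT : complex_domain T)
  (hp : analytic_in T p) (hq : analytic_in T q) (hr : analytic_in T r)
  (hcontour : contour gamma a b)
  (hcontourT : forall s, 0 < s < 1 -> T (gamma s))
  (hexp : endpoint_expansions p q r gamma a varpi mu nu lambda p_ q_ r_)
  (hp0 : p_ 0%nat <> RtoC 0)
  (hmunu : nu < mu) (hnu : 0 <= nu) (hlambda : 0 < Re lambda)
  (htheta : theta1 <= theta2) (htheta_pi : theta2 - theta1 < PI) (hZ : 0 < Z)
  (hconv : converges_abs_unif_at_end
             (integrand p q r gamma (nu / mu) Z) theta1 theta2)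
  (hdelta : 0 < delta)
  (hsector : sector_condition p gamma a theta1 theta2 delta)
  (hO : big_O_at_end p r gamma a) :
  (exists! varpi0 : R, arg_p0 (p_ 0%nat) mu varpi theta1 theta2 varpi0) /\
  forall varpi0 : R, arg_p0 (p_ 0%nat) mu varpi theta1 theta2 varpi0 ->
  let p0_pow := polar_pow (Cmod (p_ 0%nat)) varpi0 in
  let f := f_coef p_ q_ r_ mu nu lambda varpi0 in
  (forall N : nat, exists K Z0 : R,
     forall rho theta : R, Z <= rho -> Z0 <= rho -> theta1 <= theta <= theta2 ->
     ex_contour_integral p q r gamma (nu / mu) rho theta /\
     Cmod (Cexp (polar rho theta * p a) * contour_integral p q r gamma (nu / mu) rho theta
           - partial_sum (fun n =>
               / polar_pow rho theta ((INR n + lambda) / mu)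
               * sum_n (fun m =>
                   f n m * Faxen (nu / mu) ((INR n + lambda + INR m * nu) / mu)
                             (r_ 0%nat / p0_pow (nu / mu)%R)) n) N)%C
     <= K * Rpower rho (- ((INR N + Re lambda) / mu))) /\
  f 0%nat 0%nat = (q_ 0%nat / (mu * p0_pow (lambda / mu)))%C /\
  f 1%nat 0%nat =
    ((q_ 1%nat / mu - (lambda + 1) * p_ 1%nat * q_ 0%nat / (mu ^ 2 * p_ 0%nat))
     * (1 / p0_pow ((1 + lambda) / mu)))%C /\
  f 1%nat 1%nat =
    ((r_ 1%nat / mu - nu * p_ 1%nat * r_ 0%nat / (mu ^ 2 * p_ 0%nat))
     * (q_ 0%nat / p0_pow ((1 + lambda + nu) / mu)))%C.
Proof.
  assert (hmu : 0 < mu) by lra.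
  assert (hmuC : RtoC mu <> 0) by (apply RtoC_neq_0; lra).
  destruct hexp as [phi [hphi [hphilim [hep [heq her]]]]].
  destruct (expands_along_cps _ _ _ _ _ _ hphi hep) as [hps hpe].
  destruct (expands_along_cps _ _ _ _ _ _ hphi heq) as [hqs hqe].
  destruct (expands_along_cps _ _ _ _ _ _ hphi her) as [hrs hre].
  destruct hsector as [hsec hend].
  destruct hcontour as [hg0 [hchain _]].
  destruct (chain_first_arc gamma 0 (/ 2) (hchain (/ 2) ltac:(lra))) as [y [hy harc0]].
  destruct (arc_start gamma y ltac:(lra) harc0) as [dg [k1 [c1 [c2 [hk1 [hc1 [hc2 harc]]]]]]].
  rewrite hg0 in harc. assert (hk1' : 0 < k1 <= 1) by lra.
  assert (hpdiff : forall s, 0 < s < 1 -> exists l, Cdiff p (gamma s) l).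
  { intros s hs. destruct (hp (gamma s) (hcontourT s hs)) as [l hl].
    exists l. now apply is_derive_Cdiff. }
  assert (hdle := delta_le p gamma a theta1 theta2 delta htheta hsec).
  split.
  { assert (hv0 := arg_p0_candidate p gamma a phi varpi mu p_ theta1 theta2 delta dg k1 c1 c2).
    feed hv0. destruct hv0 as [v [hv1 hv2]].
    assert (hv : arg_p0 (p_ 0%nat) mu varpi theta1 theta2 v) by (repeat split; trivial).
    exists v. split; trivial. intros v' hv'. now apply (arg_p0_unique _ _ _ _ _ _ _ htheta hv). }
  intros varpi0 [[_ hv1] hv2] p0_pow f.
  split; [|split; [|split]].
  2:{ unfold f. rewrite f_coef_fps, fps_mul_0, Bell_0_0.
      rewrite b_coef_0 by trivial. simpl INR. fold p0_pow. field.
      split; trivial. apply polar_pow_neq_0. }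
  2:{ unfold f. rewrite f_coef_fps, fps_mul_1, Bell_0_0, Bell_1_0.
      rewrite b_coef_1 by trivial. simpl INR. fold p0_pow. field.
      repeat split; trivial. apply polar_pow_neq_0. }
  2:{ unfold f. rewrite f_coef_fps, fps_mul_1, Bell_1_1.
      rewrite (Bell_low _ 1 0) by lia.
      rewrite b_coef_0, c_coef_1 by trivial. simpl INR. fold p0_pow.
      replace ((1 + lambda + nu) / mu)%C with (lambda / mu + (1 + nu) / mu)%C by (field; trivial).
      unfold p0_pow at 3. rewrite polar_pow_plus. fold p0_pow. field.
      repeat split; trivial; apply polar_pow_neq_0. }
  intros N.
  set (kappa := nu / mu).
  assert (hkappa : 0 <= kappa < 1).
  { unfold kappa. split; [apply Rdiv_le_0_compat; lra|].
    apply Rmult_lt_reg_r with mu; trivial. unfold Rdiv. rewrite Rmult_assoc, Rinv_l by lra. lra. }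
  assert (ekappa : RtoC kappa = (nu / mu)%C) by (unfold kappa; now rewrite RtoC_div by lra).
  set (L := log_phase p gamma a theta1).
  set (tau := fun s => (gamma s - a)%C).
  set (U := unit_part p_). set (D := log_deriv U (unit_coef p_) mu).
  set (L' := fun s => (mu * D (tau s) * dg s / tau s)%C).
  set (Bf := fun s => (q_local p_ q_ mu lambda varpi0 (tau s) / D (tau s))%C).
  set (Rl := fun s => r_local p_ r_ mu nu varpi0 (tau s)).
  assert (hle := local_expansions p gamma a phi varpi varpi0 mu nu lambda p_ q_ r_ theta1 theta2
    delta dg k1 c1 c2). feed hle.
  (* Order [N + 1] is needed for [r]; the expansion of [q] is weakened to order [N] afterwards. *)
  destruct (hle (S N)) as [kA [Wb [hkA [hWb [hw [eB eR]]]]]].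
  apply (expands_weaken _ _ Wb hWb hw) in eB.
  assert (hRL := Re_log_phase p gamma a phi varpi varpi0 mu p_ theta1 theta2 delta dg k1 c1 c2).
  feed hRL. destruct hRL as [CP hCP].
  assert (hdL := log_phase_deriv_local p gamma a phi varpi varpi0 mu p_ theta1 theta2 delta
    dg k1 c1 c2). feed hdL.
  assert (hLb := log_phase_deriv_bound gamma a mu p_ dg k1 c1 c2). feed hLb.
  assert (hqf := q_factor p q gamma a phi varpi varpi0 mu lambda p_ q_ theta1 theta2 delta
    dg k1 c1 c2). feed hqf.
  assert (hrf := r_factor p r gamma a phi varpi varpi0 mu nu p_ r_ theta1 theta2 delta
    dg k1 c1 c2). feed hrf.
  destruct (proj1 (at_right_0_iff _) (filter_and _ _ (filter_and _ _ hCP hdL)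
    (filter_and _ _ hLb (filter_and _ _ hqf hrf)))) as [kB [hkB X]].
  set (k := Rmin kA kB).
  assert (m1 : k <= kA) by apply Rmin_l. assert (m2 : k <= kB) by apply Rmin_r.
  assert (hk : 0 < k) by (apply Rmin_pos; lra).
  (* The cut: before [k2] the local expansion holds, after it the integral is exponentially
     small. *)
  set (k2 := k / 2). assert (hk2 : 0 < k2 < k) by (unfold k2; lra).
  assert (hstrip : forall theta s, theta1 <= theta <= theta2 -> 0 < s < k ->
    Rabs (theta + Im (L s)) <= PI / 2 - delta).
  { intros theta s ht hs. apply (log_phase_strip p gamma a theta1 theta2 delta); trivial. lra. }
  assert (sub : forall M f u, expands (fun s => 0 < s < kA) (fun s => Cexp (/ mu * L s))%C M f u ->
    expands (fun s => 0 < s < k) (fun s => Cexp (/ mu * L s))%C M f u).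
  { induction M as [|M IH]; intros g u.
    - intros [K0 [h1 h2]]. exists K0. split; trivial. intros s hs. apply h2. lra.
    - intros [g1 [h1 h2]]. exists g1. split; [intros s hs; apply h1; lra|now apply IH]. }
  destruct (local_estimate kappa delta mu k k2 theta1 theta2 (2 * mu * c2 / c1) CP Wb lambda
    L L' Bf Rl (b_coef p_ q_ mu lambda varpi0) (c_coef p_ r_ mu nu varpi0)
    hkappa (conj hdelta hdle) hmu hlambda hk2) with (N := N) as [K1 [rho1 [hK1 E1]]].
  { left. repeat apply Rmult_lt_0_compat; try lra. now apply Rinv_0_lt_compat. }
  { exact hWb. }
  { exact hstrip. }
  { intros s hs. destruct (X s ltac:(lra)) as [[_ x] _]. exact x. }
  { intros s hs. destruct (X s ltac:(lra)) as [_ [x _]]. exact x. }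
  { intros s hs. destruct (X s ltac:(lra)) as [[x _] _]. exact x. }
  { intros s hs. apply hw. lra. }
  { now apply sub. }
  { now apply sub. }
  destruct hconv as [x0 [hx0 [hconv _]]].
  destruct (tail_estimate p q r T gamma a kappa theta1 theta2 delta Z hp hq hr hcontourT hchain
    hkappa htheta hdelta hsec hend hO hZ x0 hx0 (hconv theta1 ltac:(lra)) k2 ltac:(lra))
    as [K2 [cc [rho2 [hK2 [hcc E2]]]]].
  set (BN := (INR N + Re lambda) / mu).
  destruct (exp_decay_le_power cc BN hcc) as [K3 [hK3 E3]].
  (* [K1] comes from the initial piece, [K2 * K3] from the tail, whose exponential decay is weakened
     to the power rho^(-BN). *)
  exists (K1 + K2 * K3), (Rmax 1 (Rmax rho1 rho2)).
  intros rho theta hrho hrho' ht.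
  assert (n1 := Rmax_l 1 (Rmax rho1 rho2)). assert (n2 := Rmax_r 1 (Rmax rho1 rho2)).
  assert (n3 := Rmax_l rho1 rho2). assert (n4 := Rmax_r rho1 rho2).
  set (I := integral_from p q r gamma kappa k2 rho theta).
  set (E := Cexp (polar rho theta * p a)). assert (hE : E <> 0) by apply Cexp_neq_0.
  destruct (E2 rho theta ltac:(lra) ltac:(lra) ht) as [I1 [hI1 b1]]. fold I in hI1. fold E in b1.
  assert (hisI : forall x y, 0 < x -> x <= y -> y < 1 ->
    is_RInt (V := C_R_NormedModule) (integrand p q r gamma kappa rho theta) x y (I y - I x)%C).
  { intros x y' h1 h2 h3.
    apply (is_RInt_integral_from p q r T gamma kappa hp hq hr hcontourT hchain); lra. }
  (* [I] is based at [k2]; times exp (z p(a)) it is a primitive of the reduced integrand, because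
     [q_factor] and [r_factor] rewrite the original integrand in terms of [L]. *)
  assert (dI : forall s, 0 < s < k ->
    is_deriv_curve (fun s => E * I s)%C s
      (reduced_integrand kappa mu lambda L L' Bf Rl rho theta s)).
  { intros s hs. destruct (harc s ltac:(lra)) as [g1 [g2 _]].
    eapply is_deriv_curve_eq.
    - apply is_deriv_curve_scal.
      apply (is_derive_RInt (V := C_R_NormedModule) (integrand p q r gamma kappa rho theta) I k2).
      + apply (locally_pos_interval k s); trivial. intros t ht'.
        unfold I, integral_from. apply (RInt_correct (V := C_R_CompleteNormedModule)).
        destruct (Rle_lt_dec k2 t) as [h|h];
          [|apply ex_RInt_swap]; eexists; apply hisI; lra.
      + apply (continuous_ext_loc (T := R_UniformSpace) (U := C_UniformSpace) _
          (fun s => Cexp (- (polar rho theta * p (gamma s)) +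
            polar_pow rho theta kappa * r (gamma s)) * q (gamma s) * dg s)%C).
        * apply (locally_pos_interval k1 s); [lra|]. intros t ht'. unfold integrand.
          destruct (harc t ht') as [g _]. now rewrite (derivRC_correct _ _ _ g).
        * apply continuous_C_mult; [|exact g2].
          apply (factor_continuous p q r T gamma kappa hp hq hr hcontourT hchain). lra.
    - destruct (X s ltac:(lra)) as [_ [_ [x1 x2]]].
      fold L in x1, x2. fold (tau s) in x1, x2. fold U D in x1. fold (Bf s) (L' s) in x1.
      fold (Rl s) in x2.
      unfold integrand, reduced_integrand. rewrite (derivRC_correct _ _ _ g1).
      set (lz := (ln rho, theta) : C).
      assert (ez : polar rho theta = Cexp lz) by (unfold lz; now rewrite Cexp_ln by lra).
      assert (eP : (p (gamma s) - p a)%C = Cexp (L s)).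
      { unfold L. rewrite (Cexp_log_phase p gamma a theta1 theta2 delta); trivial. lra. }
      rewrite x2, <- ekappa.
      transitivity (Cexp (polar rho theta * p a) * Cexp (- (polar rho theta * p (gamma s)) +
        polar_pow rho theta kappa * (Cexp (kappa * L s) * Rl s)) * (q (gamma s) * dg s))%C;
        [unfold E; ring|].
      rewrite x1, <- Cexp_plus.
      replace (polar rho theta * p a + (- (polar rho theta * p (gamma s)) +
        polar_pow rho theta kappa * (Cexp (kappa * L s) * Rl s)))%C
        with (- (polar rho theta * (p (gamma s) - p a)) +
          polar_pow rho theta kappa * Cexp (kappa * L s) * Rl s)%C by ring.
      rewrite eP, ez. unfold polar_pow. fold lz. rewrite <- !Cexp_plus.
      replace (kappa * lz + kappa * L s)%C with (kappa * (lz + L s))%C by ring.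
      set (A := (- Cexp (lz + L s) + Cexp (kappa * (lz + L s)) * Rl s)%C).
      transitivity (Cexp A * Cexp (lambda / mu * L s) * (Bf s * L' s))%C; [ring|].
      f_equal. rewrite <- !Cexp_plus. f_equal. ring. }
  destruct (E1 rho theta (fun s => E * I s)%C ltac:(lra) ltac:(lra) ht dI) as [I0 [hI0 b0]].
  assert (hI0' : filterlim_C I (at_right 0) (I0 / E)%C).
  { apply (filterlim_ext (fun s => / E * (E * I s))%C).
    - intros s. Cfield. exact hE.
    - replace (I0 / E)%C with (/ E * I0)%C by (unfold Cdiv; ring).
      now apply filterlim_C_scal; [typeclasses eauto|]. }
  (* The limit of [I] at [b] minus its limit at [a]; the existence of the latter is a conclusion of
     [local_estimate]. *)
  assert (hgen : is_RInt_gen (V := C_R_NormedModule) (integrand p q r gamma kappa rho theta)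
    (at_right 0) (at_left 1) (I1 - I0 / E)%C).
  { apply (is_RInt_gen_primitive (at_right 0) (at_left 1) _ I); trivial.
    exists (fun x => 0 < x < / 2) (fun y => / 2 < y < 1).
    - apply right_small. lra.
    - apply at_left_1_iff. exists (/ 2). split; [lra|]. trivial.
    - intros x y' hx hy'. simpl. apply hisI; lra. }
  split; [now exists (I1 - I0 / E)%C|].
  assert (ei : contour_integral p q r gamma kappa rho theta = (I1 - I0 / E)%C).
  { apply (is_RInt_gen_unique (V := C_R_CompleteNormedModule)). exact hgen. }
  rewrite ei.
  set (Sm := partial_sum _ N).
  (* The last argument r_0 / p_0^(nu/mu) of the Faxen integrals is [c_coef] at index 0, and [nu]
     appears as [kappa * mu]. *)
  assert (eS : Sm = partial_sum (fun n => term mu lambda (b_coef p_ q_ mu lambda varpi0)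
    (c_coef p_ r_ mu nu varpi0) n rho theta (fun m => Faxen kappa
      ((INR n + lambda + INR m * (kappa * mu)) / mu)%C (c_coef p_ r_ mu nu varpi0 0))) N).
  { apply partial_sum_ext. intros n _. unfold term. f_equal. apply sum_C_ext. intros m _.
    unfold f. rewrite f_coef_fps. f_equal. rewrite c_coef_0 by trivial. fold p0_pow.
    f_equal.
    - rewrite ekappa. field. trivial.
    - now rewrite <- ekappa. }
  rewrite eS.
  set (V := partial_sum _ N) in *.
  (* As [I] vanishes at the cut, the total error splits into the tail [E * I1] and the local error
     at [k2]. *)
  assert (ek2 : I k2 = 0) by apply integral_from_self.
  cbv beta in b0. rewrite ek2 in b0.
  replace (E * (I1 - I0 / E) - V)%C with (E * I1 + (E * 0 - I0 - V))%C by (field; exact hE).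
  eapply Rle_trans; [apply Cmod_triangle|].
  unfold Rpower. fold BN. replace (- BN * ln rho) with (- (BN * ln rho)) by ring.
  assert (b2 := E3 rho ltac:(lra)).
  assert (b3 : K2 * exp (- (cc * rho)) <= K2 * (K3 * exp (- (BN * ln rho))))
    by now apply Rmult_le_compat_l.
  change (Cmod (E * 0 - I0 - V) <= K1 * exp (- (BN * ln rho))) in b0.
  lra.
Qed.
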